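(* Let $\mathcal{J}$ be a homogeneous ideal of $\mathcal{L}$. Then the compression algebra $\mathcal{L}_{\mathcal{J}}$ has the completely contractive approximation property (CCAP), and so has property $S_\sigma$.
   Context: Let $d$ be a fixed positive integer, $\mathbb{F}_d^*$ the unital free semigroup on the generators $\{1,\dots,d\}$ with identity $\varnothing$, and $|w|$ the length of a word $w$. Let $\ell^2(\mathbb{F}_d^* )$ have orthonormal basis $\{\xi_w : w\in\mathbb{F}_d^*\}$ and put $L_u\xi_w=\xi_{uw}$. $\mathcal{L}=\mathcal{L}_d$ is the unital weak-operator-closed (WOT-closed) algebra generated by $\{L_u:u\in\mathbb{F}_d^*\}$. An ideal of $\mathcal{L}$ always means a WOT-closed two-sided ideal; it is homogeneous if it is generated (as such an ideal) by homogeneous polynomials, i.e. by elements of the form $\sum_{|w|=n}a_wL_w$. For an ideal $\mathcal{J}$, let $\mathcal{N}_{\mathcal{J}}=(\mathcal{J}\xi_\varnothing)^\perp$, let $P_{\mathcal{N}_{\mathcal{J}}}$ be the orthogonal projection onto it, and let $\mathcal{L}_{\mathcal{J}}=P_{\mathcal{N}_{\mathcal{J}}}\mathcal{L}|_{\mathcal{N}_{\mathcal{J}}}\subseteq B(\mathcal{N}_{\mathcal{J}})$; this is a weak*-closed algebra (completely isometrically isomorphic and weak*-homeomorphic to $\mathcal{L}/\mathcal{J}$). A weak*-closed subspace $\mathcal{S}\subseteq B(\mathcal{H})$ has the CCAP if there is a net of completely contractive weak*-continuous finite rank maps $\Phi_i:\mathcal{S}\to\mathcal{S}$ with $\lim_i\Phi_i(A)=A$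 in the weak* topology for all $A\in\mathcal{S}$. It has property $S_\sigma$ if $\mathcal{S}\otimes_{\mathcal{F}}\mathcal{T}=\mathcal{S}\overline{\otimes}\mathcal{T}$ for every weak*-closed subspace $\mathcal{T}\subseteq B(\mathcal{K})$ and every Hilbert space $\mathcal{K}$, where $\overline\otimes$ is the normal (weak*-closed spatial) tensor product and $\mathcal{S}\otimes_{\mathcal{F}}\mathcal{T}$ is the Fubini tensor product, i.e. the set of $X\in B(\mathcal{H}\otimes\mathcal{K})$ such that $(\varphi\otimes\mathrm{id})(X)\in\mathcal{T}$ and $(\mathrm{id}\otimes\psi)(X)\in\mathcal{S}$ for all normal functionals $\varphi$ on $B(\mathcal{H})$ and $\psi$ on $B(\mathcal{K})$. *)

(* Defs.v *)
From HB Require Import structures.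
From mathcomp Require Import all_boot all_order all_algebra.
From mathcomp Require Import complex.
From mathcomp Require Import all_classical all_reals all_analysis.
From mathcomp Require Import ring.

Set Implicit Arguments.
Unset Strict Implicit.
Unset Printing Implicit Defensive.

Import Order.TTheory GRing.Theory Num.Theory.
Import numFieldNormedType.Exports.

Local Open Scope classical_set_scope.
Local Open Scope ring_scope.

(* The library puts a topology on an abstract [numClosedFieldType] only; these *)
(* are the same instances for the concrete type [R[i]].                        *)
Section ComplexTopology.
Context (R : realType).
HB.instance Definition _ := PseudoPointedMetric.copy R[i] R[i]^o.
HB.instance Definition _ := GRing.ComAlgebra.copy R[i] R[i]^o.
HB.instance Definition _ := Vector.copy R[i] R[i]^o.
HB.instance Definition _ := NormedModule.copy R[i] R[i]^o.
HB.instance Definition _ := Num.ClosedField.on R[i].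
End ComplexTopology.

Section DotNorm.
Context (C : numClosedFieldType) (V : lmodType C).
Variable dot : {dot V for @Num.conj C}.

Lemma CauchySchwarz x y : `|dot x y| ^+ 2 <= dot x x * dot y y.
Proof.
have [->|y0] := eqVneq y 0.
  by rewrite linear0r normr0 expr0n mulr_ge0 ?dnorm_ge0.
have dy0 : 0 < dot y y by rewrite dnorm_gt0.
set a := dot x y / dot y y.
have ac : a^* = (dot x y)^* / dot y y.
  by rewrite /a rmorphM fmorphV/= (CrealP (ger0_real (ltW dy0))).
have := dnorm_ge0 dot (x - a *: y).
rewrite dnormB dnormZ linearZr_LR/= [`|a| ^+ 2]normCK.
have -> : (a^* * dot x y)^* = a * (dot x y)^* by rewrite rmorphM/= conjCK.
rewrite ac /a.
have -> : dot x x + dot x y / dot y y * ((dot x y)^* / dot y y) * dot y y -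
    ((dot x y)^* / dot y y * dot x y + dot x y / dot y y * (dot x y)^*) =
    dot x x - (dot x y * (dot x y)^*) / dot y y.
  by field; rewrite gt_eqF.
by rewrite subr_ge0 ler_pdivrMr// -normCK.
Qed.

Definition dot_norm x := sqrtC (dot x x).

Lemma dot_norm_ge0 x : 0 <= dot_norm x.
Proof. exact: sqrt_dnorm_ge0. Qed.

Lemma dot_norm_sqr x : dot_norm x ^+ 2 = dot x x.
Proof. exact: sqrtCK. Qed.

Lemma dot_normZ a x : dot_norm (a *: x) = `|a| * dot_norm x.
Proof.
rewrite /dot_norm dnormZ sqrtCM ?nnegrE ?dnorm_ge0// ?exprn_ge0//.
by rewrite sqrCK.
Qed.

Lemma dot_norm_eq0 x : dot_norm x = 0 -> x = 0.
Proof. by move/eqP; rewrite sqrt_dnorm_eq0 => /eqP. Qed.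

Lemma dot_normD x y : dot_norm (x + y) <= dot_norm x + dot_norm y.
Proof.
rewrite -(@ler_pXn2r _ 2) ?nnegrE ?addr_ge0 ?dot_norm_ge0//.
rewrite dot_norm_sqr dnormD sqrrD !dot_norm_sqr addrAC lerD2r lerD2l.
have CS : `|dot x y| <= dot_norm x * dot_norm y.
  rewrite -(@ler_pXn2r _ 2) ?nnegrE ?mulr_ge0 ?dot_norm_ge0//.
  by rewrite exprMn !dot_norm_sqr CauchySchwarz.
have r : dot x y + (dot x y)^* \is Num.real by rewrite CrealE rmorphD/= conjCK addrC.
apply: (le_trans (real_ler_norm r)); apply: (le_trans (ler_normD _ _)).
by rewrite norm_conjC -mulr2n ler_pMn2r.
Qed.

End DotNorm.

Lemma complex_gt0 (R : realType) (e : R[i]) : 0 < e -> exists2 a : R, 0 < a & e = a%:C%C.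
Proof.
case: e => a b; rewrite [_ < _]ltcE/= => /andP[/eqP -> a0].
by exists a.
Qed.

Lemma complex_archi (R : realType) (e : R[i]) : 0 < e -> exists n, n.+1%:R^-1 < e.
Proof.
move=> /complex_gt0[a a0 ->]; exists (Num.truncn a^-1).
have -> : (Num.truncn a^-1).+1%:R^-1 = ((Num.truncn a^-1).+1%:R^-1)%:C%C :> R[i].
  by rewrite fmorphV rmorph_nat.
by rewrite ltcR -[ltRHS]invrK ltf_pV2 ?posrE ?invr_gt0// truncnS_gt.
Qed.

HB.mixin Record CompleteNormedModule_isHilbert (R : realType) V
    & CompleteNormedModule R[i] V := {
  inner : V -> V -> R[i] ;
  innerPl : forall (a : R[i]) (x y z : V),
    inner (a *: x + y) z = a * inner x z + inner y z ;
  innerC : forall x y : V, inner x y = (inner y x)^* ;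
  normE_inner : forall x : V, `|x| ^+ 2 = inner x x
}.

#[short(type="hilbertType")]
HB.structure Definition Hilbert (R : realType) :=
  {V of CompleteNormedModule R[i] V & CompleteNormedModule_isHilbert R V}.


Section InnerDot.
Context (R : realType) (H : hilbertType R).

Lemma inner_bilinear :
  bilinear_for *%R (Num.conj \; *%R) (@inner R H).
Proof.
split=> [z a x y|z a x y]; first exact: innerPl.
by rewrite innerC innerPl rmorphD rmorphM/= -!innerC.
Qed.
HB.instance Definition _ := @bilinear_isBilinear.Build R[i] H H
  R[i] *%R (Num.conj \; *%R) (@inner R H) inner_bilinear.

Lemma inner_herm (x y : H) :
  inner x y = (-1) ^+ false * Num.conj (inner y x).
Proof. by rewrite mul1r innerC. Qed.
HB.instance Definition _ := isHermitianSesquilinear.Build R[i] H false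
  Num.conj (@inner R H) inner_herm.

Lemma inner_gt0 (x : H) : x != 0 -> 0 < inner x x.
Proof. by move=> x0; rewrite -normE_inner exprn_gt0// normr_gt0. Qed.
HB.instance Definition _ := isDotProduct.Build R[i] H (@inner R H) inner_gt0.

Lemma norm_inner (x y : H) : `|inner x y| <= `|x| * `|y|.
Proof.
rewrite -(@ler_pXn2r _ 2) ?nnegrE ?mulr_ge0// exprMn !normE_inner.
exact: CauchySchwarz.
Qed.

End InnerDot.

Section CauchySequences.
Context (R : realType) (V : normedModType R[i]).

Definition cauchy_sequence (u : nat -> V) := forall e : R[i], 0 < e ->
  exists N, forall m n, (N <= m)%N -> (N <= n)%N -> `|u m - u n| < e.

Lemma cauchy_sequence_complete :
  (forall u : nat -> V, cauchy_sequence u -> cvgn u) ->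
  forall F : set_system V, ProperFilter F -> cauchy F -> cvg F.
Proof.
move=> Vc F FF /cauchyP Fc.
have FB n : exists x : V, F (ball x n.+1%:R^-1).
  by apply: Fc; rewrite invr_gt0.
have [u uP] := choice FB.
have {}uP n : F [set y | `|u n - y| < n.+1%:R^-1].
  by have := uP n; rewrite -ball_normE.
have inv_le (n m : nat) : (n <= m)%N -> m.+1%:R^-1 <= n.+1%:R^-1 :> R[i].
  by move=> nm; rewrite lef_pV2 ?posrE// ler_nat ltnS.
have uc : cauchy_sequence u.
  move=> e e0.
  have [N Ne] := complex_archi (divr_gt0 e0 (ltr0n _ 2 : 0 < 2%:R)).
  exists N => m n Nm Nn.
  have [y [/= y1 y2]] := filter_ex (filterI (uP m) (uP n)).
  rewrite -(subrKA y) (splitr e) (le_lt_trans (ler_normD _ _))// ltrD//.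
    by rewrite (lt_trans y1)// (le_lt_trans _ Ne)// inv_le.
  by rewrite distrC (lt_trans y2)// (le_lt_trans _ Ne)// inv_le.
have /cvg_ex[l ul] := Vc _ uc.
apply/cvg_ex; exists l; apply/fcvgrPdist_lt => e e0.
have e20 : 0 < e / 2%:R by rewrite divr_gt0.
have [N Ne] := complex_archi e20.
have [M _ MP] := (cvgrPdist_lt _ _).1 ul _ e20.
apply: filterS (uP (maxn N M)) => y /= y1.
rewrite -(subrKA (u (maxn N M))) (splitr e) (le_lt_trans (ler_normD _ _))// ltrD//.
  by apply: MP => /=; rewrite leq_maxr.
by rewrite (lt_trans y1)// (le_lt_trans _ Ne)// inv_le// leq_maxl.
Qed.

End CauchySequences.

Lemma cauchy_sequence_cvg (R : realType) (V : completeNormedModType R[i])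
  (u : nat -> V) : cauchy_sequence u -> cvgn u.
Proof.
move=> uc; apply/cauchy_cvgP/cauchy_exP => e e0.
have [N NP] := uc _ e0; exists (u N); exists N => // n /= Nn.
by rewrite -ball_normE; exact: NP.
Qed.

HB.factory Record Lmodule_isHilbert (R : realType) V & GRing.Lmodule R[i] V := {
  dot : V -> V -> R[i] ;
  dotPl : forall (a : R[i]) (x y z : V),
    dot (a *: x + y) z = a * dot x z + dot y z ;
  dotC : forall x y : V, dot x y = (dot y x)^* ;
  dot_gt0 : forall x : V, x != 0 -> 0 < dot x x ;
  dot_complete : forall u : nat -> V,
    (forall e : R[i], 0 < e -> exists N, forall m n,
       (N <= m)%N -> (N <= n)%N -> dot (u m - u n) (u m - u n) < e) ->
    exists l, forall e : R[i], 0 < e -> exists N, forall n,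
       (N <= n)%N -> dot (l - u n) (l - u n) < e
}.

HB.builders Context R V & Lmodule_isHilbert R V.

Lemma dot_bilinear : bilinear_for *%R (Num.conj \; *%R) dot.
Proof.
split=> [z a x y|z a x y]; first exact: dotPl.
by rewrite dotC dotPl rmorphD rmorphM/= -!dotC.
Qed.
HB.instance Definition _ := @bilinear_isBilinear.Build R[i] V V
  R[i] *%R (Num.conj \; *%R) dot dot_bilinear.

Lemma dot_herm x y : dot x y = (-1) ^+ false * Num.conj (dot y x).
Proof. by rewrite mul1r dotC. Qed.
HB.instance Definition _ := isHermitianSesquilinear.Build R[i] V false
  Num.conj dot dot_herm.

HB.instance Definition _ := isDotProduct.Build R[i] V dot dot_gt0.

HB.instance Definition _ := Lmodule_isNormed.Build R[i] V
  (dot_normD dot) (dot_normZ dot) (@dot_norm_eq0 _ _ dot).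

Lemma dot_cauchy_cvg (F : set_system V) : ProperFilter F -> cauchy F -> cvg F.
Proof.
have sqr_lt (x : V) (e : R[i]) : 0 < e -> (dot x x < e ^+ 2) = (`|x| < e).
  move=> e0; rewrite -[dot x x]/(Dot.sort _ x x) -dot_norm_sqr.
  by rewrite ltr_pXn2r ?nnegrE ?dot_norm_ge0// ltW.
apply: cauchy_sequence_complete => u uc.
have /dot_complete[l ul] : forall e : R[i], 0 < e -> exists N, forall m n,
    (N <= m)%N -> (N <= n)%N -> dot (u m - u n) (u m - u n) < e.
  move=> e e0; have se0 : 0 < sqrtC e by rewrite sqrtC_gt0.
  have [N NP] := uc _ se0.
  by exists N => m n Nm Nn; rewrite -(sqrtCK e) sqr_lt// NP.
apply/cvg_ex; exists l; apply/cvgrPdist_lt => e e0.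
have [N NP] := ul _ (exprn_gt0 2 e0).
by exists N => // n /= Nn; rewrite -sqr_lt// NP.
Qed.

HB.instance Definition _ := Uniform_isComplete.Build V dot_cauchy_cvg.

HB.instance Definition _ := CompleteNormedModule_isHilbert.Build R V
  dotPl dotC (dot_norm_sqr dot).

HB.end.


Section BoundedOperators.
Context (R : realType) (H : hilbertType R).

Definition bounded_linear : {pred H -> H} :=
  fun f => `[< linear f /\ continuous f >].

Record bop := Bop { bop_fun :> H -> H ; bopP : bop_fun \in bounded_linear }.

HB.instance Definition _ := [isSub for bop_fun].
HB.instance Definition _ := [Choice of bop by <:].

Lemma bop_linear (A : bop) : linear A.
Proof. by have /asboolP[] := bopP A. Qed.

Lemma bop_continuous (A : bop) : continuous A.
Proof. by have /asboolP[] := bopP A. Qed.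

HB.instance Definition _ (A : bop) :=
  GRing.isLinear.Build R[i] H H *:%R A (bop_linear A).

Lemma bounded_linear_submod_closed : submod_closed bounded_linear.
Proof.
split.
  apply/asboolP; split; first by move=> a x y; rewrite scaler0 addr0.
  by move=> x; exact: cvg_cst.
move=> a f g /asboolP[fl fc] /asboolP[gl gc]; apply/asboolP; split.
  move=> b x y; rewrite /= !fctE fl gl !scalerDr -!addrA; congr (_ + _).
    by rewrite !scalerA mulrC.
  by rewrite addrCA.
by move=> x; apply: cvgD; [apply: cvgZr; exact: fc | exact: gc].
Qed.

HB.instance Definition _ := GRing.isSubmodClosed.Build R[i] (H -> H)
  bounded_linear bounded_linear_submod_closed.
HB.instance Definition _ := [SubChoice_isSubLmodule of bop by <:].

Lemma contraction_bounded_linear (f : H -> H) :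
  linear f -> (forall x, `|f x| <= `|x|) -> f \in bounded_linear.
Proof.
move=> fl f1; apply/asboolP; split=> // x; apply/cvgrPdist_lt => e e0; near=> y.
have -> : f x - f y = f (x - y).
  by have := fl (-1) y x; rewrite !scaleN1r addrC => <-; rewrite addrC.
by apply: (le_lt_trans (f1 _)); near: y; exact: cvgr_dist_lt.
Unshelve. all: by end_near. Qed.

Lemma bid_subproof : (fun x : H => x) \in bounded_linear.
Proof. by apply/asboolP; split=> // x; exact: cvg_id. Qed.
Definition bid : bop := Bop bid_subproof.

Lemma bcomp_subproof (A B : bop) : (fun x => A (B x)) \in bounded_linear.
Proof.
apply/asboolP; split; first by move=> a x y; rewrite !linearP.
by move=> x; apply: continuous_comp; exact: bop_continuous.
Qed.
Definition bcomp (A B : bop) : bop := Bop (bcomp_subproof A B).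

End BoundedOperators.

Section OrthogonalComplement.
Context (R : realType) (H : hilbertType R) (S : set H).

Definition orthocomp : {pred H} := fun x => `[< forall s, S s -> inner x s = 0 >].

Record orthoc := Orthoc { orthoc_val :> H ; orthocP : orthoc_val \in orthocomp }.

HB.instance Definition _ := [isSub for orthoc_val].
HB.instance Definition _ := [Choice of orthoc by <:].

Lemma orthocomp_submod_closed : submod_closed orthocomp.
Proof.
split; first by apply/asboolP => s _; rewrite linear0l.
move=> a x y /asboolP xS /asboolP yS; apply/asboolP => s Ss.
by rewrite innerPl xS// yS// mulr0 addr0.
Qed.

HB.instance Definition _ := GRing.isSubmodClosed.Build R[i] H
  orthocomp orthocomp_submod_closed.
HB.instance Definition _ := [SubChoice_isSubLmodule of orthoc by <:].

Definition orthoc_dot (x y : orthoc) : R[i] := inner (val x) (val y).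

Lemma orthoc_dotPl (a : R[i]) x y z :
  orthoc_dot (a *: x + y) z = a * orthoc_dot x z + orthoc_dot y z.
Proof. exact: innerPl. Qed.

Lemma orthoc_dotC x y : orthoc_dot x y = (orthoc_dot y x)^*.
Proof. exact: innerC. Qed.

Lemma orthoc_dot_gt0 x : x != 0 -> 0 < orthoc_dot x x.
Proof. by move=> x0; exact: inner_gt0. Qed.

Lemma orthoc_complete (u : nat -> orthoc) :
    (forall e : R[i], 0 < e -> exists N, forall m n,
       (N <= m)%N -> (N <= n)%N -> orthoc_dot (u m - u n) (u m - u n) < e) ->
    exists l, forall e : R[i], 0 < e -> exists N, forall n,
       (N <= n)%N -> orthoc_dot (l - u n) (l - u n) < e.
Proof.
move=> uc.
have [l ul] : exists l : H, val \o u @ \oo --> l.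
  apply/cvg_ex; apply: cauchy_sequence_cvg => e e0.
  have [N NP] := uc _ (exprn_gt0 2 e0).
  exists N => m n Nm Nn; rewrite -(@ltr_pXn2r _ 2) ?nnegrE ?(ltW e0)//.
  by rewrite normE_inner; exact: NP.
have lS : l \in orthocomp.
  apply/asboolP => s Ss; apply/eqP; rewrite -normr_eq0; apply: contraT => ls0.
  have {}ls0 : 0 < `|inner l s| by rewrite lt_def ls0 normr_ge0.
  have s1 : 0 < `|s| + 1 by rewrite ltr_wpDl.
  have [N _ /(_ N (leqnn N))/=] := (cvgrPdist_lt _ _).1 ul _ (divr_gt0 ls0 s1).
  rewrite ltr_pdivlMr// => h.
  have : `|inner l s| <= `|l - val (u N)| * `|s|.
    apply: le_trans (norm_inner _ _).
    rewrite linearBl/= [X in _ - X](_ : _ = 0) ?subr0//.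
    by have /asboolP := orthocP (u N); apply.
  by move=> /(lt_le_trans h); rewrite le_gtF// ler_wpM2l// lerDl.
exists (Orthoc lS) => e e0; have se0 : 0 < sqrtC e by rewrite sqrtC_gt0.
have [N _ NP] := (cvgrPdist_lt _ _).1 ul _ se0.
exists N => n Nn; rewrite /orthoc_dot -normE_inner -(sqrtCK e).
by rewrite ltr_pXn2r ?nnegrE ?(ltW se0)//; exact: NP.
Qed.

HB.instance Definition _ := Lmodule_isHilbert.Build R orthoc
  orthoc_dotPl orthoc_dotC orthoc_dot_gt0 orthoc_complete.

End OrthogonalComplement.

Section ComplexComplete.
Context (R : realType).

Lemma normr_complex (a : R) : `|a%:C%C| = `|a|%:C%C.
Proof. by rewrite normc_def/= expr0n addr0 sqrtr_sqr. Qed.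

Lemma complex_norm_lt (z : R[i]) (e : R) :
  (`|z| < e%:C%C) -> (`|complex.Re z| < e) /\ (`|complex.Im z| < e).
Proof.
move=> ze; rewrite -!ltcR; split; apply: le_lt_trans ze.
  exact: normc_ge_Re.
by rewrite normc_def lecR -sqrtr_sqr ler_wsqrtr// lerDr sqr_ge0.
Qed.

Lemma norm_lt_complex (z : R[i]) (e : R) :
  (`|complex.Re z| < e) -> (`|complex.Im z| < e) -> `|z| < (e *+ 2)%:C%C.
Proof.
move=> rz iz; rewrite [z]complexE (le_lt_trans (ler_normD _ _))//.
rewrite normrM [`|'i%C|]normc_def/= expr0n expr1n add0r sqrtr1 mul1r.
rewrite !normr_complex -rmorphD ltcR mulr2n.
by rewrite ltrD.
Qed.

Lemma real_cauchy_cvg (a : nat -> R) :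
  (forall e : R, 0 < e -> exists N, forall m n, (N <= m)%N -> (N <= n)%N ->
     `|a m - a n| < e) -> cvgn a.
Proof.
move=> ac; apply/cauchy_cvgP/cauchy_exP => e e0.
have [N NP] := ac _ e0; exists (a N); exists N => // n /= Nn.
by rewrite -ball_normE; exact: NP.
Qed.

Lemma complex_cauchy_sequence_cvg (u : nat -> R[i]) :
  cauchy_sequence u -> cvgn u.
Proof.
move=> uc.
have ReC : cvgn (fun n => complex.Re (u n)).
  apply: real_cauchy_cvg => e e0.
  have [|N NP] := uc e%:C%C; first by rewrite ltcR.
  exists N => m n Nm Nn; have /complex_norm_lt[+ _] := NP m n Nm Nn.
  by rewrite raddfB.
have ImC : cvgn (fun n => complex.Im (u n)).
  apply: real_cauchy_cvg => e e0.
  have [|N NP] := uc e%:C%C; first by rewrite ltcR.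
  exists N => m n Nm Nn; have /complex_norm_lt[_ +] := NP m n Nm Nn.
  by rewrite raddfB.
have [a ua] := (cvg_ex _).1 ReC; have [b ub] := (cvg_ex _).1 ImC.
apply/cvg_ex; exists (Complex a b); apply/cvgrPdist_lt => _ /complex_gt0[e e0 ->].
have e20 : 0 < e / 2 by rewrite divr_gt0.
have ua' := (cvgrPdist_lt _ _).1 ua _ e20.
have ub' := (cvgrPdist_lt _ _).1 ub _ e20.
near=> n.
have -> : e = (e / 2) *+ 2 by rewrite -mulr_natr divfK.
apply: norm_lt_complex; rewrite raddfB/=.
- by near: n; exact: ua'.
- by near: n; exact: ub'.
Unshelve. all: by end_near. Qed.

HB.instance Definition _ := Uniform_isComplete.Build R[i]
  (cauchy_sequence_complete complex_cauchy_sequence_cvg).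

Lemma cauchy_sequence_dominated (u v : nat -> R[i]) : cauchy_sequence v ->
  (forall m n, (m <= n)%N -> `|u m - u n| <= `|v m - v n|) -> cauchy_sequence u.
Proof.
move=> vc uv e e0; have [N NP] := vc e e0; exists N => m n Nm Nn.
have [mn|/ltnW nm] := leqP m n; first by rewrite (le_lt_trans (uv _ _ mn))// NP.
by rewrite distrC (le_lt_trans (uv _ _ nm))// NP.
Qed.

Lemma nondecreasing_cauchy (u : nat -> R[i]) (M : R[i]) :
  (forall m n, (m <= n)%N -> u m <= u n) -> 0 <= u 0%N -> (forall n, u n <= M) ->
  cauchy_sequence u.
Proof.
move=> u_nd u0 uM.
have uR n : u n = (complex.Re (u n))%:C%C.
  by rewrite RRe_real// ger0_real// (le_trans u0)// u_nd.
have /cvg_ex[l ul] : cvgn (fun n => complex.Re (u n)).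
  apply: nondecreasing_is_cvgn.
    by move=> m n mn; have := u_nd _ _ mn; rewrite lecE => /andP[].
  by exists (complex.Re M) => _ [n _ <-]; have := uM n; rewrite lecE => /andP[].
move=> _ /complex_gt0[e e0 ->].
have [N _ NP] := (cvgrPdist_lt _ _).1 ul _ (divr_gt0 e0 (ltr0n _ 2)).
exists N => m n Nm Nn; rewrite (uR m) (uR n) -rmorphB normr_complex ltcR.
rewrite -(subrKA l) (splitr e) (le_lt_trans (ler_normD _ _))// ltrD//.
  by rewrite distrC; exact: NP.
exact: NP.
Qed.

Lemma limn_complex_ge (u : nat -> R[i]) (l c : R[i]) N : u @ \oo --> l ->
  (forall n, (N <= n)%N -> c <= u n) -> c <= l.
Proof.
move=> ul uc; rewrite -subr_ge0.
have h1 : (fun n => u n - c) @ \oo --> l - c.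
  by apply: (cvgB ul); exact: cvg_cst.
have h2 : (fun n => `|u n - c|) @ \oo --> `|l - c| by apply: (cvg_norm h1).
suff -> : l - c = `|l - c| by exact: normr_ge0.
apply: (cvg_unique _ h1); first exact: norm_hausdorff.
apply: cvg_trans h2; apply: near_eq_cvg; exists N => // n /= Nn.
by rewrite ger0_norm// subr_ge0 uc.
Qed.

Lemma limn_complex_le (u : nat -> R[i]) (l c : R[i]) N : u @ \oo --> l ->
  (forall n, (N <= n)%N -> u n <= c) -> l <= c.
Proof.
move=> ul uc; rewrite -lerN2; apply: (@limn_complex_ge (fun n => - u n) _ _ N).
  exact: cvgN.
by move=> n Nn; rewrite lerN2 uc.
Qed.

End ComplexComplete.

Section EllTwo.
Context (R : realType) (d : nat).
Local Notation word := (seq 'I_d).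
Implicit Types (f g : word -> R[i]) (w u : word).

(* The sum of F over the (finitely many) words of length < N. *)
Definition word_sum (F : word -> R[i]) (N : nat) : R[i] :=
  \sum_(n < N) \sum_(w : n.-tuple 'I_d) F w.

Lemma word_sumD F G N :
  word_sum (fun w => F w + G w) N = word_sum F N + word_sum G N.
Proof. by rewrite -big_split; apply: eq_bigr => n _; rewrite -big_split. Qed.

Lemma word_sumZ a F N : word_sum (fun w => a * F w) N = a * word_sum F N.
Proof. by rewrite big_distrr; apply: eq_bigr => n _; rewrite big_distrr. Qed.

Lemma word_sum_ge0 F N : (forall w, 0 <= F w) -> 0 <= word_sum F N.
Proof. by move=> F0; apply: sumr_ge0 => n _; exact: sumr_ge0. Qed.

Lemma le_word_sum F G N : (forall w, F w <= G w) -> word_sum F N <= word_sum G N.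
Proof. by move=> FG; apply: ler_sum => n _; exact: ler_sum. Qed.

Lemma word_sumB F m n : (m <= n)%N ->
  word_sum F n - word_sum F m =
  \sum_(m <= k < n) \sum_(w : k.-tuple 'I_d) F w.
Proof.
move=> mn; rewrite /word_sum -!(big_mkord xpredT
  (fun k => \sum_(w : k.-tuple 'I_d) F w)) (big_cat_nat (leq0n m) mn)/=.
by rewrite [X in X - _]addrC addrK.
Qed.

Lemma word_sum_nondecreasing F : (forall w, 0 <= F w) ->
  forall m n, (m <= n)%N -> word_sum F m <= word_sum F n.
Proof.
move=> F0 m n mn; rewrite -subr_ge0 word_sumB//.
by apply: sumr_ge0 => k _; exact: sumr_ge0.
Qed.

Lemma word_sum_ge_term F w N : (forall w, 0 <= F w) -> (size w < N)%N ->
  F w <= word_sum F N.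
Proof.
move=> F0 wN; rewrite /word_sum (bigD1 (Ordinal wN))//= (bigD1 (in_tuple w))//=.
rewrite -addrA lerDl addr_ge0//; first exact: sumr_ge0.
by apply: sumr_ge0 => k _; exact: sumr_ge0.
Qed.

Lemma word_sum_cvg (F_ : nat -> word -> R[i]) F N :
  (forall w, F_ ^~ w @ \oo --> F w) ->
  (fun k => word_sum (F_ k) N) @ \oo --> word_sum F N.
Proof.
move=> FF; rewrite /word_sum.
apply: cvg_big => [|n _]; first exact: add_continuous.
by apply: cvg_big => [|w _]; [exact: add_continuous|exact: FF].
Qed.

Definition square_summable : {pred word -> R[i]} := fun f =>
  `[< exists M, forall N, word_sum (fun w => `|f w| ^+ 2) N <= M >].

Record l2 := Ell2 { l2_fun :> word -> R[i] ; l2P : l2_fun \in square_summable }.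

HB.instance Definition _ := [isSub for l2_fun].
HB.instance Definition _ := [Choice of l2 by <:].

Lemma square_summable_submod_closed : submod_closed square_summable.
Proof.
split.
  apply/asboolP; exists 0 => N; rewrite /word_sum big1// => n _.
  by rewrite big1// => w _; rewrite normr0 expr0n.
move=> a f g /asboolP[M fM] /asboolP[M' gM']; apply/asboolP.
exists (2%:R * (`|a| ^+ 2 * M) + 2%:R * M') => N.
apply: (@le_trans _ _ (word_sum
    (fun w => 2%:R * (`|a| ^+ 2 * `|f w| ^+ 2) + 2%:R * `|g w| ^+ 2) N)).
  apply: le_word_sum => w; rewrite -exprMn -normrM -[f w]/(f w).
  rewrite /= !fctE; set x := a * f w; set y := g w.
  have xy : `|x + y| ^+ 2 <= (`|x| + `|y|) ^+ 2.
    by rewrite ler_pXn2r ?nnegrE ?addr_ge0// ler_normD.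
  apply: (le_trans xy); rewrite -subr_ge0.
  rewrite (_ : _ - _ = (`|x| - `|y|) ^+ 2); last by ring.
  by rewrite real_exprn_even_ge0// realB// normr_real.
by rewrite word_sumD !word_sumZ lerD// ler_wpM2l// ler_wpM2l// exprn_ge0.
Qed.

HB.instance Definition _ := GRing.isSubmodClosed.Build R[i] (word -> R[i])
  square_summable square_summable_submod_closed.
HB.instance Definition _ := [SubChoice_isSubLmodule of l2 by <:].

Lemma l2_cauchy (f : l2) : cauchy_sequence (word_sum (fun w => `|f w| ^+ 2)).
Proof.
have /asboolP[M fM] := l2P f.
have F0 w : 0 <= `|f w| ^+ 2 by rewrite exprn_ge0.
apply: (nondecreasing_cauchy (M := M)) => //; last exact: word_sum_ge0.
exact: word_sum_nondecreasing.
Qed.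

Definition l2_dot (f g : l2) : R[i] :=
  limn (word_sum (fun w => f w * (g w)^*)).

Lemma l2_dot_cvg (f g : l2) :
  word_sum (fun w => f w * (g w)^*) @ \oo --> l2_dot f g.
Proof.
apply: complex_cauchy_sequence_cvg.
apply: (@cauchy_sequence_dominated _ _ (fun N =>
    word_sum (fun w => `|f w| ^+ 2) N + word_sum (fun w => `|g w| ^+ 2) N)).
  move=> e e0; have e20 : 0 < e / 2%:R by rewrite divr_gt0.
  have [N NP] := l2_cauchy f e20; have [M MP] := l2_cauchy g e20.
  exists (maxn N M) => m n; rewrite !geq_max => /andP[Nm Mm] /andP[Nn Mn].
  rewrite opprD addrACA (splitr e) (le_lt_trans (ler_normD _ _))// ltrD//.
    exact: NP.
  exact: MP.
move=> m n mn; rewrite distrC [leRHS]distrC opprD addrACA !word_sumB//.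
rewrite -big_split/=.
rewrite [leRHS]ger0_norm; last first.
  by apply: sumr_ge0 => k _; apply: addr_ge0; apply: sumr_ge0 => w _; rewrite exprn_ge0.
apply: (le_trans (ler_norm_sum _ _ _)); apply: ler_sum => k _.
rewrite -big_split/=.
apply: (le_trans (ler_norm_sum _ _ _)); apply: ler_sum => w _.
rewrite normrM norm_conjC; set x := `|f w|; set y := `|g w|.
have x0 : 0 <= x by rewrite /x.
have y0 : 0 <= y by rewrite /y.
rewrite -subr_ge0.
rewrite (_ : _ - _ = ((x - y) ^+ 2 + (x ^+ 2 + y ^+ 2)) / 2%:R); last by field.
apply: divr_ge0 => //; apply: addr_ge0; last by rewrite addr_ge0// exprn_ge0.
by rewrite real_exprn_even_ge0// realB// ger0_real.
Qed.

Lemma l2_dot_lim (f g : l2) (F : word -> R[i]) l :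
  (forall w, F w = f w * (g w)^*) -> word_sum F @ \oo --> l -> l2_dot f g = l.
Proof.
move=> FE Fl; apply: cvg_unique Fl; first exact: norm_hausdorff.
have -> : F = (fun w => f w * (g w)^*) by apply/funext.
exact: l2_dot_cvg.
Qed.

Lemma l2_dotPl (a : R[i]) (f g h : l2) :
  l2_dot (a *: f + g) h = a * l2_dot f h + l2_dot g h.
Proof.
apply: (@l2_dot_lim _ _ (fun w => a * (f w * (h w)^*) + g w * (h w)^*)).
  by move=> w; rewrite mulrA -mulrDl.
have -> : word_sum (fun w => a * (f w * (h w)^*) + g w * (h w)^*) =
    (fun N => a * word_sum (fun w => f w * (h w)^*) N
              + word_sum (fun w => g w * (h w)^*) N).
  by apply/funext => N; rewrite word_sumD word_sumZ.
apply: cvgD; last exact: l2_dot_cvg.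
by apply: cvgMr; exact: l2_dot_cvg.
Qed.

Lemma l2_dotC (f g : l2) : l2_dot f g = (l2_dot g f)^*.
Proof.
apply: (@l2_dot_lim _ _ (fun w => (g w * (f w)^*)^*)).
  by move=> w; rewrite rmorphM/= conjCK mulrC.
have -> : word_sum (fun w => (g w * (f w)^*)^*) =
    (fun N => (word_sum (fun w => g w * (f w)^*) N)^*).
  apply/funext => N; rewrite /word_sum rmorph_sum; apply: eq_bigr => n _.
  by rewrite rmorph_sum.
apply/cvgrPdist_lt => e e0.
have [N _ NP] := (cvgrPdist_lt _ _).1 (@l2_dot_cvg g f) _ e0.
by exists N => // n Nn; rewrite /= -rmorphB norm_conjC; exact: NP.
Qed.

Lemma l2_dot_sqr_cvg (f : l2) :
  word_sum (fun w => `|f w| ^+ 2) @ \oo --> l2_dot f f.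
Proof.
have -> : (fun w => `|f w| ^+ 2) = (fun w => f w * (f w)^*).
  by apply/funext => w; rewrite normCK.
exact: l2_dot_cvg.
Qed.

Lemma l2_dot_ge_term (f : l2) w : `|f w| ^+ 2 <= l2_dot f f.
Proof.
apply: (limn_complex_ge (@l2_dot_sqr_cvg f) (N := (size w).+1)) => n wn.
by apply: word_sum_ge_term => // v; rewrite exprn_ge0.
Qed.

Lemma l2_dot_le (f : l2) (M : R[i]) :
  (forall N, word_sum (fun w => `|f w| ^+ 2) N <= M) -> l2_dot f f <= M.
Proof. by move=> fM; apply: (limn_complex_le (@l2_dot_sqr_cvg f) (N := 0%N)). Qed.

Lemma word_sum_le_dot (f : l2) N : word_sum (fun w => `|f w| ^+ 2) N <= l2_dot f f.
Proof.
apply: (limn_complex_ge (@l2_dot_sqr_cvg f) (N := N)) => n Nn.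
by apply: word_sum_nondecreasing => // v; rewrite exprn_ge0.
Qed.

Lemma l2_dot_gt0 (f : l2) : f != 0 -> 0 < l2_dot f f.
Proof.
move=> f0.
have [w fw0] : exists w, f w != 0.
  apply: contrapT => /forallNP fE; move/eqP: f0; apply.
  by apply/val_inj/funext => w; apply/eqP; apply: contra_notT (fE w).
by rewrite (lt_le_trans _ (l2_dot_ge_term f w))// exprn_gt0// normr_gt0.
Qed.

Lemma l2_complete (u : nat -> l2) :
    (forall e : R[i], 0 < e -> exists N, forall m n,
       (N <= m)%N -> (N <= n)%N -> l2_dot (u m - u n) (u m - u n) < e) ->
    exists l, forall e : R[i], 0 < e -> exists N, forall n,
       (N <= n)%N -> l2_dot (l - u n) (l - u n) < e.
Proof.
move=> uc.
have cu : forall w : word, exists l : R[i], (fun n => u n w) @ \oo --> l.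
  move=> w; exists (limn (fun n => u n w)); apply: complex_cauchy_sequence_cvg => e e0.
  have [N NP] := uc _ (exprn_gt0 2 e0).
  exists N => m n Nm Nn; rewrite -(@ltr_pXn2r _ 2) ?nnegrE ?(ltW e0)//.
  exact: le_lt_trans (l2_dot_ge_term (u m - u n) w) (NP _ _ Nm Nn).
have [f uf] := choice cu.
have tail (e : R[i]) : 0 < e -> exists N, forall n, (N <= n)%N ->
    forall K, word_sum (fun w => `|f w - u n w| ^+ 2) K <= e.
  move=> e0; have [N NP] := uc _ e0; exists N => n Nn K.
  have sq w : (fun m => `|u m w - u n w| ^+ 2) @ \oo --> `|f w - u n w| ^+ 2.
    have h : (fun m => `|u m w - u n w|) @ \oo --> `|f w - u n w|.
      by apply: cvg_norm; apply: cvgB; [exact: uf|exact: cvg_cst].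
    rewrite (_ : (fun m => _) =
        (fun m => `|u m w - u n w| * `|u m w - u n w|)) ?expr2.
      by apply: cvgM.
    by apply/funext => m; rewrite expr2.
  have cv : (fun m => word_sum (fun w => `|u m w - u n w| ^+ 2) K) @ \oo -->
      word_sum (fun w => `|f w - u n w| ^+ 2) K.
    exact: word_sum_cvg sq.
  apply: (limn_complex_le cv (N := N)) => m Nm.
  exact: le_trans (word_sum_le_dot (u m - u n) K) (ltW (NP _ _ Nm Nn)).
have [N0 N0P] := tail 1 ltr01.
have fu : (fun w => f w - u N0 w) \in square_summable.
  by apply/asboolP; exists 1; exact: N0P.
have fS : f \in square_summable.
  have -> : f = (fun w => f w - u N0 w) + (u N0 : word -> R[i]).
    by apply/funext => w; rewrite /= !fctE subrK.
  by rewrite rpredD// l2P.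
exists (Ell2 fS) => e e0; have e20 : 0 < e / 2%:R by rewrite divr_gt0.
have [N NP] := tail _ e20; exists N => n Nn.
apply: (@le_lt_trans _ _ (e / 2%:R)); first by apply: l2_dot_le => K; exact: NP.
by rewrite ltr_pdivrMr// ltr_pMr// ltr1n.
Qed.

HB.instance Definition _ := Lmodule_isHilbert.Build R l2
  l2_dotPl l2_dotC l2_dot_gt0 l2_complete.

Lemma xi_subproof (w : word) :
  (fun v => (v == w)%:R : R[i]) \in square_summable.
Proof.
apply/asboolP; exists 1 => N.
have [wN|Nw] := ltnP (size w) N; last first.
  rewrite /word_sum big1 ?ler01// => n _; rewrite big1// => v _.
  have [vw|_] := eqVneq (v : word) w; last by rewrite normr0 expr0n.
  by have := leq_trans (ltn_ord n) Nw; rewrite -vw size_tuple ltnn.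
rewrite /word_sum (bigD1 (Ordinal wN))//= [X in _ + X]big1 ?addr0.
  rewrite (bigD1 (in_tuple w))//= eqxx normr1 expr1n big1 ?addr0// => v vw.
  by rewrite -val_eqE/= in vw; rewrite (negbTE vw) normr0 expr0n.
move=> n nw; rewrite big1// => v _.
have [vw|_] := eqVneq (v : word) w; last by rewrite normr0 expr0n.
by move: nw; rewrite -val_eqE/= -vw size_tuple eqxx.
Qed.

Definition xi (w : word) : l2 := Ell2 (xi_subproof w).

Lemma inner_xi (f : l2) (w : word) : inner f (xi w) = f w.
Proof.
apply: (@l2_dot_lim _ _ (fun v => if v == w then f w else 0)).
  move=> v /=; have [->|_] := eqVneq v w; first by rewrite rmorph1 mulr1.
  by rewrite rmorph0 mulr0.
apply: cvg_near_cst; exists (size w).+1 => // N /= wN.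
rewrite /word_sum (bigD1 (Ordinal wN))//= [X in _ + X]big1 ?addr0.
  rewrite (bigD1 (in_tuple w))//= eqxx big1 ?addr0// => v vw.
  by rewrite -val_eqE/= in vw; rewrite (negbTE vw).
move=> n nw; rewrite big1// => v _.
have [vw|//] := eqVneq (v : word) w.
by move: nw; rewrite -val_eqE/= -vw size_tuple eqxx.
Qed.

Definition word_shift (u : word) (f : word -> R[i]) (w : word) : R[i] :=
  if prefix u w then f (drop (size u) w) else 0.

Lemma word_shift_cons i u f w : word_shift (i :: u) f w =
  if w is j :: v then (if i == j then word_shift u f v else 0) else 0.
Proof. by case: w => [|j v]//=; rewrite /word_shift/=; case: eqP. Qed.

Lemma word_sum_cons (i : 'I_d) (F G : word -> R[i]) N : (forall w, 0 <= F w) ->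
  (forall w, G w = if w is j :: v then (if i == j then F v else 0) else 0) ->
  word_sum G N <= word_sum F N.
Proof.
move=> F0 GE; case: N => [|N]; first by rewrite /word_sum !big_ord0.
apply: (@le_trans _ _ (word_sum F N)); last exact: word_sum_nondecreasing.
rewrite /word_sum big_ord_recl/= [X in X + _]big1 ?add0r; last first.
  by move=> w _; rewrite (tuple0 w) GE.
apply: ler_sum => n _.
rewrite (reindex (fun p : 'I_d * n.-tuple 'I_d => [tuple of p.1 :: p.2]))/=; last first.
  exists (fun w : n.+1.-tuple 'I_d => (thead w, [tuple of behead w])) => [[j v] _|w _].
    by congr pair; apply/val_inj.
  by rewrite [RHS]tuple_eta; apply/val_inj.
rewrite (eq_bigr (fun p : 'I_d * n.-tuple 'I_d => if i == p.1 then F p.2 else 0)); last first.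
  by move=> [j v] _; rewrite GE.
rewrite -(pair_bigA _ (fun j (v : n.-tuple 'I_d) => if i == j then F v else 0))/=.
rewrite (bigD1 i)//= [X in _ + X]big1 ?addr0.
  by rewrite eqxx.
by move=> j ji; rewrite big1// => v _; rewrite eq_sym (negbTE ji).
Qed.

Lemma word_sum_shift u f N :
  word_sum (fun w => `|word_shift u f w| ^+ 2) N <= word_sum (fun w => `|f w| ^+ 2) N.
Proof.
elim: u => [|i u IHu].
  by apply: le_word_sum => w; rewrite /word_shift prefix0s drop0.
apply: le_trans IHu; apply: (@word_sum_cons i) => [w|[|j v]].
- by rewrite exprn_ge0.
- by rewrite word_shift_cons normr0 expr0n.
- by rewrite word_shift_cons; case: eqP => // _; rewrite normr0 expr0n.
Qed.

Lemma word_shift_summable u (f : l2) : word_shift u f \in square_summable.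
Proof.
have /asboolP[M fM] := l2P f; apply/asboolP; exists M => N.
exact: le_trans (word_sum_shift _ _ _) (fM N).
Qed.

Lemma word_shift_bounded_linear u :
  (fun f : l2 => Ell2 (word_shift_summable u f)) \in @bounded_linear R l2.
Proof.
have lin : linear (fun f : l2 => Ell2 (word_shift_summable u f)).
  move=> a f g; apply/val_inj/funext => w /=.
  by rewrite /= !fctE /= /word_shift; case: ifP => // _; rewrite scaler0 addr0.
apply: (contraction_bounded_linear lin) => f.
rewrite -(@ler_pXn2r _ 2) ?nnegrE// !normE_inner; apply: l2_dot_le => N.
exact: le_trans (word_sum_shift _ _ _) (word_sum_le_dot _ _).
Qed.

Definition Lshift (u : word) : bop l2 := Bop (word_shift_bounded_linear u).

Lemma Lshift_xi u w : Lshift u (xi w) = xi (u ++ w).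
Proof.
apply/val_inj/funext => v /=; rewrite /word_shift.
have [/prefixP[v' ->]|uv] := boolP (prefix u v).
  by rewrite drop_size_cat// eqseq_cat// eqxx.
have [vE|//] := eqVneq v (u ++ w).
by rewrite vE prefix_prefix in uv.
Qed.

End EllTwo.

Definition lin_subspace (R : realType) (V : lmodType R[i]) (U : set V) : Prop :=
  U 0 /\ forall (a : R[i]) (x y : V), U x -> U y -> U (a *: x + y).

Section OperatorTopologies.
Context (R : realType) (H : hilbertType R).
Implicit Types (A : bop H) (S : set (bop H)).

Definition wot : Type := sup_topology (fun p : H * H =>
  Topological.class (initial_topology (fun A : bop H => inner (A p.1) p.2))).
HB.instance Definition _ := Topological.copy wot
  (sup_topology (fun p : H * H =>
    Topological.class (initial_topology (fun A : bop H => inner (A p.1) p.2)))).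

Definition square_summable_seq (x : nat -> H) : Prop :=
  cvgn (series (fun n => `|x n| ^+ 2)).

(* The normal functionals on B(H), i.e. those given by trace class operators. *)
Definition normal_functional (phi : bop H -> R[i]) : Prop :=
  exists x y : nat -> H, [/\ square_summable_seq x, square_summable_seq y &
    forall A, phi A = limn (series (fun n => inner (A (x n)) (y n)))].

Definition wstar : Type := sup_topology (fun phi : {phi | normal_functional phi} =>
  Topological.class (initial_topology (sval phi))).
HB.instance Definition _ := Topological.copy wstar
  (sup_topology (fun phi : {phi | normal_functional phi} =>
    Topological.class (initial_topology (sval phi)))).

Definition wstar_closed_subspace S : Prop :=
  lin_subspace S /\ closed (S : set wstar).

(* The operator matrix A, acting on the n-fold direct sum of H, has operator  *)
(* norm at most c.                                                            *)
Definition mx_norm_le (n : nat) (A : 'M[bop H]_n) (c : R[i]) : Prop :=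
  forall x : 'I_n -> H,
    \sum_i `|\sum_j A i j (x j)| ^+ 2 <= c ^+ 2 * \sum_j `|x j| ^+ 2.

(* Maps S -> S are represented by functions on B(H), of which only the        *)
(* restriction to S matters.                                                  *)
Definition linear_on S (Phi : bop H -> bop H) : Prop :=
  forall (a : R[i]) A B, S A -> S B -> Phi (a *: A + B) = a *: Phi A + Phi B.

Definition finite_rank_on S (Phi : bop H -> bop H) : Prop :=
  exists (n : nat) (E : 'I_n -> bop H), forall A, S A ->
    exists c : 'I_n -> R[i], Phi A = \sum_i c i *: E i.

Definition completely_contractive_on S (Phi : bop H -> bop H) : Prop :=
  forall (n : nat) (A : 'M[bop H]_n) (c : R[i]), 0 <= c ->
    (forall i j, S (A i j)) -> mx_norm_le A c -> mx_norm_le (map_mx Phi A) c.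

Definition wstar_continuous_on S (Phi : bop H -> bop H) : Prop :=
  {within (S : set wstar), continuous (Phi : wstar -> wstar)}.

Definition directed (I : Type) (le : I -> I -> Prop) : Prop :=
  [/\ inhabited I, forall i, le i i,
      forall i j k, le i j -> le j k -> le i k &
      forall i j, exists k, le i k /\ le j k].

Definition tails (I : Type) (le : I -> I -> Prop) : set_system I :=
  filter_from [set: I] (fun i => [set j | le i j]).

Definition CCAP S : Prop :=
  wstar_closed_subspace S /\
  exists (I : Type) (le : I -> I -> Prop) (Phi : I -> bop H -> bop H),
  [/\ directed le,
      forall i, [/\ forall A, S A -> S (Phi i A), linear_on S (Phi i),
        finite_rank_on S (Phi i), completely_contractive_on S (Phi i) &
        wstar_continuous_on S (Phi i)] &
      forall A, S A ->
        (fun i => Phi i A : wstar) @ tails le --> (A : wstar)].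

End OperatorTopologies.

(* [HK] is a model of the Hilbert space tensor product of [H] and [K]; such a *)
(* model is unique up to a unitary carrying [tens] to [tens].                 *)
Record hilbert_tensor (R : realType) (H K HK : hilbertType R) := HilbertTensor {
  tens :> {bilinear H -> K -> HK} ;
  inner_tens : forall (x x' : H) (y y' : K),
    inner (tens x y) (tens x' y') = inner x x' * inner y y' ;
  tens_total : dense (smallest (@lin_subspace R HK)
    [set z | exists x y, z = tens x y])
}.

Section TensorProducts.
Context (R : realType) (H K HK : hilbertType R) (t : hilbert_tensor H K HK).

Definition is_tensor_op (A : bop H) (B : bop K) (X : bop HK) : Prop :=
  forall x y, X (t x y) = t (A x) (B y).

Definition normal_tensor (S : set (bop H)) (T : set (bop K)) : set (bop HK) :=
  smallest (@wstar_closed_subspace R HK)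
    [set X | exists A B, [/\ S A, T B & is_tensor_op A B X]].

(* [B] is (phi (x) id)(X), where phi(A) is the sum of the <A x_n, y_n>; the   *)
(* sum below is then the value of phi (x) <. k, k'> at [X].                   *)
Definition is_left_slice (x y : nat -> H) (X : bop HK) (B : bop K) : Prop :=
  forall k k', inner (B k) k' =
    limn (series (fun n => inner (X (t (x n) k)) (t (y n) k'))).

(* [A] is (id (x) psi)(X), where psi(B) is the sum of the <B x_n, y_n>.       *)
Definition is_right_slice (x y : nat -> K) (X : bop HK) (A : bop H) : Prop :=
  forall h h', inner (A h) h' =
    limn (series (fun n => inner (X (t h (x n))) (t h' (y n)))).

Definition fubini_tensor (S : set (bop H)) (T : set (bop K)) : set (bop HK) :=
  [set X |
    (forall x y : nat -> H, square_summable_seq x -> square_summable_seq y ->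
      exists2 B, T B & is_left_slice x y X B) /\
    (forall x y : nat -> K, square_summable_seq x -> square_summable_seq y ->
      exists2 A, S A & is_right_slice x y X A)].

End TensorProducts.

Definition property_S_sigma (R : realType) (H : hilbertType R)
    (S : set (bop H)) : Prop :=
  wstar_closed_subspace S /\
  forall (K HK : hilbertType R) (t : hilbert_tensor H K HK) (T : set (bop K)),
    wstar_closed_subspace T -> fubini_tensor t S T = normal_tensor t S T.

Section FreeSemigroupAlgebra.
Context (R : realType) (d : nat).
Local Notation H := (l2 R d).
Implicit Types (J S : set (bop H)).

Definition wot_closed S : Prop := closed (S : set (wot H)).

Definition wot_closed_unital_algebra S : Prop :=
  [/\ lin_subspace S, S (bid H), forall A B, S A -> S B -> S (bcomp A B) &
      wot_closed S].

Definition free_semigroup_algebra : set (bop H) :=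
  smallest wot_closed_unital_algebra (range (@Lshift R d)).

Definition is_ideal J : Prop :=
  [/\ J `<=` free_semigroup_algebra, lin_subspace J, wot_closed J &
      forall A X, free_semigroup_algebra A -> J X ->
        J (bcomp A X) /\ J (bcomp X A)].

Definition homogeneous_polynomial (A : bop H) : Prop :=
  exists (n : nat) (a : n.-tuple 'I_d -> R[i]), A = \sum_w a w *: Lshift R w.

Definition homogeneous_ideal J : Prop :=
  exists2 G, G `<=` homogeneous_polynomial & J = smallest is_ideal G.

Definition vacuum_orbit J : set H := [set A (xi R [::]) | A in J].

(* N_J *)
Definition coinvariant J := orthoc (vacuum_orbit J).

(* [z] is the orthogonal projection of [x] onto the closed subspace [N].      *)
Definition is_orth_proj (N : {pred H}) (x z : H) : Prop :=
  z \in N /\ forall y, y \in N -> inner (x - z) y = 0.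

(* L_J *)
Definition compression J : set (bop (coinvariant J)) :=
  [set B | exists2 A, free_semigroup_algebra A &
    forall x, is_orth_proj (orthocomp (vacuum_orbit J)) (A (val x)) (val (B x))].

End FreeSemigroupAlgebra.

Arguments compression {R d} J _.

(* Main.v *)
From HB Require Import structures.
Require Import Defs.
From mathcomp Require Import all_boot all_order all_algebra.
From mathcomp Require Import complex.
From mathcomp Require Import all_classical all_reals all_analysis.
From mathcomp Require Import ring lra zify.
Set Implicit Arguments.
Unset Strict Implicit.
Unset Printing Implicit Defensive.
Import Order.TTheory GRing.Theory Num.Theory.
Import numFieldNormedType.Exports.
Local Open Scope classical_set_scope.
Local Open Scope ring_scope.

(** Write [N] for the coinvariant space [N_J], [R_i] for the operators creating
    the letter [i] on the right and [T_i] for the compression of [R_i] to [N].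
    The space [N] is invariant under all [L_w^*] and [R_i^*], because [J] is a
    two-sided ideal, and it is graded by word length, because [J] is generated
    by homogeneous elements ([homogeneous_graded_orth]). Everything follows
    from three facts about such graded coinvariant spaces, among which is the
    whole Fock space.

    First, an operator [B] commuting with all [T_i] has the formal Fourier
    series [sum_w f_w E_w], with [E_w] the compression of [L_w] and [f] the
    image under [B] of the compressed vacuum. Its Fejer means are
    [Phi_n(B) = (1/n) sum_m Q_m B Q_m], where [Q_m] projects onto the degrees
    of a window of length [n]; as [sum_m Q_m^2 = n], they are complete
    contractions ([fejer_completely_contractive]) and converge weak* to [B].
    On the Fock space this shows that the free semigroup algebra is the
    commutant of the [R_i] ([free_semigroup_algebraE]).

    Secondly, an operator commuting with the [T_i] is the compression of one
    commuting with the [R_i] ([commutant_lifting]). The lift is the transfer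
    function of a linear system whose states are vectors of [N]: the identity
    [1 - sum_i T_i T_i^* = e e^*], for [e] the compressed vacuum, gives the
    energy balance that makes the lift bounded. No sharp norm is needed, which
    leaves room to replace the defect operator of [B^*] by an invertible one.
    Hence the compression algebra is exactly the commutant of the [T_i]
    ([compressionE]); in particular it is weak* closed, and the Fejer means
    give the CCAP.

    Thirdly, each [Phi_n] is a finite sum of [<B p, q> E], so that
    [Phi_n (x) id] maps an element [X] of the Fubini product to a finite sum of
    elementary tensors [E (x) (slice of X)]. Complete contractivity bounds these
    elements by the norm of [X], they converge weak* to [X], and so [X] lies in
    the normal tensor product ([fubini_normal]). *)

(** * Hilbert spaces and bounded forms *)

Section LinearSubspaces.
Context (R : realType).

Lemma lin_subspace_sum (V : lmodType R[i]) (S : set V) I (r : seq I) (P : pred I)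
    (F : I -> V) : lin_subspace S ->
  (forall i, P i -> S (F i)) -> S (\sum_(i <- r | P i) F i).
Proof.
move=> [S0 SD] SF; elim/big_ind: _ => // x y Sx Sy.
by rewrite -[x]scale1r; exact: SD.
Qed.

Lemma lin_subspaceZ (V : lmodType R[i]) (S : set V) a x :
  lin_subspace S -> S x -> S (a *: x).
Proof. by move=> [S0 SD] Sx; rewrite -[_ *: _]addr0; exact: SD. Qed.

End LinearSubspaces.

Section InnerProduct.
Context (R : realType) (H : hilbertType R).
Implicit Types x y z : H.

Lemma innerDl x y z : inner (x + y) z = inner x z + inner y z.
Proof. exact: linearDl. Qed.

Lemma innerDr x y z : inner z (x + y) = inner z x + inner z y.
Proof. exact: linearDr. Qed.

Lemma innerZl a x z : inner (a *: x) z = a * inner x z.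
Proof. by rewrite linearZl_LR. Qed.

Lemma innerZr a x z : inner z (a *: x) = a^* * inner z x.
Proof. by rewrite linearZr_LR. Qed.

Lemma innerBl x y z : inner (x - y) z = inner x z - inner y z.
Proof. exact: linearBl. Qed.

Lemma innerBr x y z : inner z (x - y) = inner z x - inner z y.
Proof. exact: linearBr. Qed.

Lemma inner0l x : inner 0 x = 0.
Proof. exact: linear0l. Qed.

Lemma inner0r x : inner x 0 = 0.
Proof. exact: linear0r. Qed.

Lemma inner_suml I (r : seq I) (P : pred I) (F : I -> H) y :
  inner (\sum_(i <- r | P i) F i) y = \sum_(i <- r | P i) inner (F i) y.
Proof. by elim/big_rec2: _ => [|i u v _ <-]; rewrite ?inner0l ?innerDl. Qed.

Lemma inner_sumr I (r : seq I) (P : pred I) (F : I -> H) y :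
  inner y (\sum_(i <- r | P i) F i) = \sum_(i <- r | P i) inner y (F i).
Proof. by elim/big_rec2: _ => [|i u v _ <-]; rewrite ?inner0r ?innerDr. Qed.

Lemma inner_ge0 x : 0 <= inner x x.
Proof. by rewrite -normE_inner exprn_ge0. Qed.

Lemma inner_eq x y : (forall z, inner x z = inner y z) -> x = y.
Proof.
move=> xy; apply/eqP; rewrite -subr_eq0 -normr_eq0 -sqrf_eq0 normE_inner.
by rewrite innerBl xy subrr.
Qed.

End InnerProduct.

Section Limits.
Context (R : realType).

Lemma cvg_dominated (V : normedModType R[i]) (T : Type) (F : set_system T)
    (u : T -> V) (v : T -> R[i]) l : Filter F ->
  v @ F --> 0 -> (forall n, `|l - u n| <= v n) -> u @ F --> l.
Proof.
move=> FF v0 uv; apply/cvgrPdist_lt => e e0.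
have /(_ FF) := (cvgrPdist_lt _ _).1 v0 _ e0; apply: filterS => n.
rewrite sub0r normrN => h; apply: le_lt_trans (uv n) _.
by rewrite (le_lt_trans _ h)// real_ler_norm// ger0_real// (le_trans _ (uv n)).
Qed.

Lemma inv_cvg0 : (fun n => n.+1%:R^-1 : R[i]) @ \oo --> (0 : R[i]).
Proof.
apply/cvgrPdist_lt => e e0; have [N Ne] := complex_archi e0.
exists N => // n /= Nn; rewrite sub0r normrN ger0_norm ?invr_ge0//.
by apply: le_lt_trans Ne; rewrite lef_pV2 ?posrE// ler_nat ltnS.
Qed.

Lemma inner_cvg (H : hilbertType R) (T : Type) (F : set_system T)
    (x y : T -> H) a b : Filter F ->
  x @ F --> a -> y @ F --> b -> (fun n => inner (x n) (y n)) @ F --> inner a b.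
Proof.
move=> FF xa yb.
apply: (@cvg_dominated _ _ _ _
  (fun n => `|a - x n| * `|y n| + `|a| * `|b - y n|)) => [|n].
  rewrite -[0](_ : 0 * `|b| + `|a| * 0 = 0); last by rewrite mul0r mulr0 addr0.
  apply: cvgD; apply: cvgM; last 1 first.
  - by rewrite -(normr0 H); apply: cvg_norm; rewrite -[0 in X in _ --> X](subrr b);
      apply: cvgB => //; exact: cvg_cst.
  - by rewrite -(normr0 H); apply: cvg_norm; rewrite -[0 in X in _ --> X](subrr a);
      apply: cvgB => //; exact: cvg_cst.
  - exact: cvg_norm.
  - exact: cvg_cst.
have -> : inner a b - inner (x n) (y n) =
    inner (a - x n) (y n) + inner a (b - y n).
  by rewrite innerBl innerBr; ring.
by apply: le_trans (ler_normD _ _) _; rewrite lerD// norm_inner.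
Qed.

End Limits.

Section BoundedMaps.
Context (R : realType).

Lemma bop_bounded (H : hilbertType R) (A : bop H) :
  exists2 c : R, 0 < c & forall x, `|A x| <= c%:C%C * `|x|.
Proof.
have /linear_bounded_continuous/linear_boundedP := @bop_continuous _ _ A.
case=> M [Mr MP].
have [|c c0 cE] := @complex_gt0 R (`|M| + 1); first by rewrite ltr_wpDl.
exists c => // x; rewrite -cE; apply: MP.
by rewrite (le_lt_trans (real_ler_norm Mr))// ltrDl.
Qed.

Lemma bounded_linear_le (H : hilbertType R) (f : H -> H) (c : R[i]) :
  linear f -> (forall x, `|f x| <= c * `|x|) -> f \in @bounded_linear R H.
Proof.
move=> fl fc; apply/asboolP; split=> // x.
pose h := GRing.isLinear.Build R[i] H H *:%R f fl.
pose g : {linear H -> H} := HB.pack f h.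
have fB u v : f (u - v) = f u - f v by exact: (raddfB g).
apply: (@cvg_dominated _ _ _ _ _ (fun y => c * `|x - y|)) => [|y].
  rewrite -[0](_ : c * `|x - x| = 0); last by rewrite subrr normr0 mulr0.
  by apply: cvgMr; apply: cvg_norm; apply: cvgB; [exact: cvg_cst|exact: cvg_id].
by rewrite -fB.
Qed.

End BoundedMaps.

Section LaxMilgram.
Context (R : realType) (H : hilbertType R).

Lemma Re_mulr (a : R) (z : R[i]) : complex.Re (a%:C%C * z) = a * complex.Re z.
Proof. by case: z => x y; rewrite /= mul0r subr0. Qed.

Lemma conj_real (a : R) : (a%:C%C)^* = a%:C%C.
Proof. exact: conjc_real. Qed.

Lemma norm_Re (z : R[i]) : `|complex.Re z|%:C%C <= `|z|.
Proof. exact: normc_ge_Re. Qed.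

Lemma normr_ReE (V : normedModType R[i]) (x : V) : `|x| = (complex.Re `|x|)%:C%C.
Proof. by rewrite RRe_real// normr_real. Qed.

Lemma quadratic_nonneg (a n : R) : 0 <= n ->
  (forall t, 0 <= 2 * t * a + t ^+ 2 * n) -> a = 0.
Proof.
(* The minimiser would be [- a / n]; adding 1 allows for [n = 0]. *)
move=> n0 /(_ (- a / (n + 1))); set s := n + 1.
have s0 : 0 < s by rewrite /s; lra.
have -> : 2 * (- a / s) * a + (- a / s) ^+ 2 * n =
    - (a ^+ 2 * ((2 * s - n) / s ^+ 2)).
  by field; rewrite gt_eqF.
rewrite oppr_ge0 pmulr_lle0.
  by rewrite le_eqVlt ltNge sqr_ge0 orbF sqrf_eq0 => /eqP.
by rewrite divr_gt0// ?exprn_gt0//; rewrite /s; lra.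
Qed.

(** Minimise [Re g(x,x) - 2 Re l(x)]: the parallelogram identity makes a
    minimising sequence Cauchy, and the first variation vanishes at its limit.
    The form may differ from the inner product because commutant lifting
    inverts an operator that is only bounded below. *)
Lemma symmetric_lax_milgram (g : H -> H -> R[i]) (l : H -> R[i]) (M C : R) :
  (forall a x y z, g (a *: x + y) z = a * g x z + g y z) ->
  (forall x y, g x y = (g y x)^*) ->
  (forall x, `|x| ^+ 2 <= g x x) ->
  (forall x y, `|g x y| <= M%:C%C * (`|x| * `|y|)) ->
  (forall a x y, l (a *: x + y) = a * l x + l y) ->
  (forall x, `|l x| <= C%:C%C * `|x|) ->
  exists z, forall y, g y z = l y.
Proof.
move=> gl gC g1 gM ll lC.
have gr a x y z : g z (a *: x + y) = a^* * g z x + g z y.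
  by rewrite gC gl rmorphD rmorphM/= -!gC.
have gDl x y z : g (x + y) z = g x z + g y z.
  by have := gl 1 x y z; rewrite scale1r mul1r.
have gDr x y z : g z (x + y) = g z x + g z y.
  by have := gr 1 x y z; rewrite scale1r rmorph1 mul1r.
have lD x y : l (x + y) = l x + l y.
  by have := ll 1 x y; rewrite scale1r mul1r.
have g0l z : g 0 z = 0 by apply: (addrI (g 0 z)); rewrite -gDl !addr0.
have l0 : l 0 = 0 by apply: (addrI (l 0)); rewrite -lD !addr0.
have gZl a x z : g (a *: x) z = a * g x z by rewrite -[a *: x]addr0 gl g0l addr0.
have gZr a x z : g z (a *: x) = a^* * g z x by rewrite gC gZl rmorphM/= -gC.
have lZ a x : l (a *: x) = a * l x by rewrite -[a *: x]addr0 ll l0 addr0.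
pose Q x := g x x - 2%:R * l x.
pose q x := complex.Re (Q x).
pose nr (x : H) := complex.Re `|x|.
have nr0 x : 0 <= nr x by rewrite -lecR -normr_ReE normr_ge0.
have qN x : q x = complex.Re (g x x) - 2 * complex.Re (l x).
  by rewrite /q raddfB/= -[2%:R](rmorph_nat (real_complex R)) Re_mulr.
have Rel x : `|complex.Re (l x)| <= C * nr x.
  by rewrite -lecR (le_trans (norm_Re _))// (le_trans (lC _))// normr_ReE -rmorphM.
have nrg x : nr x ^+ 2 <= complex.Re (g x x).
  by have := g1 x; rewrite normr_ReE -rmorphXn/= lecE => /andP[].
have qlb x : - C ^+ 2 <= q x.
  rewrite qN; have := Rel x; have := nrg x; rewrite ler_norml => h /andP[_ h'].
  by have := sqr_ge0 (nr x - C); nra.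
have hi : has_inf (range q).
  by split; [exists (q 0); exists 0|exists (- C ^+ 2) => _ [x _ <-]].
set m := inf (range q).
have mq x : m <= q x by apply: ge_inf; [exact: hi.2|exists x].
have /choice[x xP] (n : nat) : exists y : H, q y < m + n.+1%:R^-1.
  have [|_ [y _ <-] hy] := inf_adherent _ hi (eps := n.+1%:R^-1).
    by rewrite invr_gt0.
  by exists y.
(* The value at the midpoint is at least the infimum [m]. *)
have par y z : nr (y - z) ^+ 2 <= 2 * q y + 2 * q z - 4 * m.
  apply: le_trans (nrg _) _.
  pose h := 2%:R^-1 *: (y + z).
  have -> : complex.Re (g (y - z) (y - z)) = 2 * q y + 2 * q z - 4 * q h.
    have -> : g (y - z) (y - z) = 2%:C%C * Q y + 2%:C%C * Q z - 4%:C%C * Q h.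
      rewrite -[- z]scaleN1r /Q /h gZl gZr !gDl !gDr !gZl !gZr lZ lD.
      rewrite fmorphV !rmorphN !rmorph1 !rmorph_nat.
      by field.
    by rewrite raddfB raddfD/= !Re_mulr.
  by have := mq h; lra.
have xc : cauchy_sequence x.
  move=> _ /complex_gt0[e e0 ->].
  pose N := Num.truncn (4 / e ^+ 2).
  have Ne : 4 / N.+1%:R < e ^+ 2.
    rewrite ltr_pdivrMr// mulrC -ltr_pdivrMr ?exprn_gt0//.
    by rewrite /N truncnS_gt.
  exists N => i k Ni Nk; rewrite normr_ReE ltcR -(@ltr_pXn2r _ 2) ?nnegrE ?(ltW e0)//; last exact: nr0.
  apply: le_lt_trans (par _ _) _.
  have inv_le (j : nat) : (N <= j)%N -> j.+1%:R^-1 <= N.+1%:R^-1 :> R.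
    by move=> nm; rewrite lef_pV2 ?posrE// ler_nat ltnS.
  have := xP i; have := xP k; have := inv_le _ Ni; have := inv_le _ Nk; move: Ne.
  move: (N.+1%:R^-1) (i.+1%:R^-1) (k.+1%:R^-1) => u v w.
  by move: (q (x i)) (q (x k)) (e ^+ 2) => *; lra.
have /cvg_ex[z xz] := cauchy_sequence_cvg xc.
exists z.
(* First variation along the real multiples of [y]. *)
have ReZ y : complex.Re (g y z - l y) = 0.
  apply: (@quadratic_nonneg _ (complex.Re (g y y))).
    by rewrite (le_trans _ (nrg y))// sqr_ge0.
  move=> t; rewrite -[leLHS](subrr (0 : R)) lerBlDr; apply/ler_addgt0Pr => e e0.
  have e2 : 0 < e / 2 by rewrite divr_gt0.
  pose D := 2 * `|t| * (`|M| * nr y) + 1.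
  have D0 : 0 < D by rewrite ltr_wpDl// ?mulr_ge0.
  have De : 0 < e / 2 / D by rewrite divr_gt0.
  have De' : 0 < (e / 2 / D)%:C%C :> R[i] by rewrite ltcR.
  have [N1 _ N1P] := (cvgrPdist_lt _ _).1 xz _ De'.
  pose n := maxn N1 (Num.truncn (2 / e)).
  have ne : n.+1%:R^-1 < e / 2.
    rewrite -[ltRHS]invrK ltf_pV2 ?posrE ?invr_gt0// invf_div.
    by apply: lt_le_trans (truncnS_gt _) _; rewrite ler_nat ltnS leq_maxr.
  have nz : nr (z - x n) < e / 2 / D.
    by rewrite -ltcR -normr_ReE; apply: N1P => /=; rewrite leq_maxl.
  have al : `|complex.Re (g y z - l y) - complex.Re (g y (x n) - l y)| <=
      `|M| * nr y * nr (z - x n).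
    rewrite -raddfB/= opprB addrA subrK.
    have -> : g y z - g y (x n) = g y (z - x n).
      by rewrite gDr -[- x n]scaleN1r gZr rmorphN1 mulN1r.
    rewrite -lecR (le_trans (norm_Re _))// (le_trans (gM _ _))//.
    rewrite [`|y|]normr_ReE [`|z - x n|]normr_ReE.
    rewrite -!rmorphM lecR mulrA; apply: ler_wpM2r; first exact: nr0.
    by apply: ler_wpM2r; [exact: nr0|exact: ler_norm].
  have var : q (x n + t%:C%C *: y) = q (x n) +
      2 * t * complex.Re (g y (x n) - l y) + t ^+ 2 * complex.Re (g y y).
    rewrite /q; have -> : Q (x n + t%:C%C *: y) = Q (x n) +
        t%:C%C * (g (x n) y + g y (x n)) - (2 * t)%:C%C * l y + (t ^+ 2)%:C%C * g y y.
      rewrite /Q gDl !gDr !gZl !gZr lD lZ conj_real rmorphXn rmorphM.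
      by rewrite /= -[2%:R](rmorph_nat (real_complex R)); ring.
    have ReD (u v : R[i]) : complex.Re (u + v) = complex.Re u + complex.Re v.
      by case: u; case: v.
    have ReN (u : R[i]) : complex.Re (- u) = - complex.Re u by case: u.
    rewrite !ReD !ReN !Re_mulr [g (x n) y]gC.
    have -> : complex.Re ((g y (x n))^* + g y (x n)) = 2 * complex.Re (g y (x n)).
      by case: (g y (x n)) => a b /=; ring.
    by ring.
  have := mq (x n + t%:C%C *: y); rewrite var; have := xP n; move: ne.
  move: (n.+1%:R^-1) (q (x n)) => r qx.
  set a := complex.Re (g y z - l y) in al *.
  set b := complex.Re (g y (x n) - l y) in al *.
  set k := complex.Re (g y y).
  have tb : `|2 * t * a - 2 * t * b| <= e / 2.
    rewrite -mulrBr normrM normrM ger0_norm// -mulrA.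
    apply: (@le_trans _ _ (2 * (`|t| * (`|M| * nr y * nr (z - x n))))).
      by rewrite !ler_wpM2l.
    rewrite !mulrA -[2 * _ * _ * _]mulrA -mulrA.
    apply: (@le_trans _ _ (D * nr (z - x n))).
      by rewrite !mulrA ler_wpM2r// /D !mulrA lerDl.
    by rewrite mulrC -ler_pdivlMr// ltW.
  move: tb; rewrite ler_norml addr0.
  move: (2 * t * a) (2 * t * b) (t ^+ 2 * k) => ? ? ? /andP[? ?] ? ? ?.
  by lra.
move=> y; apply/eqP; rewrite -subr_eq0; apply/eqP.
(* The direction ['i y] takes care of the imaginary part. *)
have := ReZ ('i%C *: y); have := ReZ y.
rewrite gZl lZ -mulrBr; case: (g y z - l y) => a b /= -> /eqP.
by rewrite mul0r mul1r sub0r oppr_eq0 => /eqP ->.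
Qed.

End LaxMilgram.

Section Riesz.
Context (R : realType) (H : hilbertType R).

Lemma riesz (l : H -> R[i]) (C : R) :
  (forall a x y, l (a *: x + y) = a * l x + l y) ->
  (forall x, `|l x| <= C%:C%C * `|x|) ->
  exists z, forall y, inner y z = l y.
Proof.
apply: (@symmetric_lax_milgram _ _ (@inner R H) l 1) => [a x y z|x y|x|x y].
- exact: innerPl.
- exact: innerC.
- by rewrite normE_inner.
- by rewrite mul1r norm_inner.
Qed.

(** Adjoints and slices are obtained from their forms in this way. *)
Lemma bop_of_form (F : H -> H -> R[i]) (C : R) :
  (forall a x y z, F (a *: x + y) z = a * F x z + F y z) ->
  (forall a x y z, F z (a *: x + y) = a^* * F z x + F z y) ->
  (forall x y, `|F x y| <= C%:C%C * (`|x| * `|y|)) ->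
  exists B : bop H, forall x y, inner (B x) y = F x y.
Proof.
move=> Fl Fr FC.
have /choice[f fP] x : exists z, forall y, inner z y = F x y.
  have [|y|z zP] := @riesz (fun y => (F x y)^*) (C * complex.Re `|x|).
  - by move=> a y z; rewrite Fr rmorphD rmorphM/= conjCK.
  - by rewrite norm_conjC (le_trans (FC _ _))// rmorphM/= -normr_ReE mulrA.
  by exists z => y; rewrite innerC zP conjCK.
have fl : linear f.
  by move=> a x y; apply: inner_eq => z; rewrite innerPl !fP Fl.
have fb : forall x, `|f x| <= C%:C%C * `|x|.
  move=> x; have [->|fx0] := eqVneq (f x) 0.
    rewrite normr0; have [->|x0] := eqVneq x 0; first by rewrite normr0 mulr0.
    have := FC x x; have x1 : 0 < `|x| by rewrite normr_gt0.
    by move=> /(le_trans (normr_ge0 _)); rewrite mulrA pmulr_lge0.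
  have fx1 : 0 < `|f x| by rewrite normr_gt0.
  rewrite -(ler_pM2r fx1) -expr2 normE_inner fP -mulrA.
  by apply: le_trans (FC _ _); rewrite real_ler_norm// -fP ger0_real// inner_ge0.
by exists (Bop (bounded_linear_le fl fb)) => x y /=.
Qed.

Lemma adj_subproof (A : bop H) :
  exists B : bop H, forall x y, inner (B x) y = inner x (A y).
Proof.
have [c c0 cA] := bop_bounded A.
apply: (@bop_of_form _ c) => [a x y z|a x y z|x y].
- by rewrite innerPl.
- by rewrite linearP innerDr innerZr.
- rewrite mulrCA; apply: le_trans (norm_inner _ _) _.
  by rewrite ler_wpM2l.
Qed.

Definition adj (A : bop H) : bop H := sval (cid (adj_subproof A)).

Lemma inner_adjl A x y : inner (adj A x) y = inner x (A y).
Proof. exact: (svalP (cid (adj_subproof A))). Qed.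

Lemma inner_adjr A x y : inner x (adj A y) = inner (A x) y.
Proof. by rewrite innerC inner_adjl -innerC. Qed.

Lemma bop_eq (A B : bop H) :
  (forall x y, inner (A x) y = inner (B x) y) -> A = B.
Proof.
by move=> AB; apply/val_inj/funext => x; apply: inner_eq => y; exact: AB.
Qed.

Lemma bop_sumE I (r : seq I) (P : pred I) (F : I -> bop H) x :
  (\sum_(i <- r | P i) F i) x = \sum_(i <- r | P i) F i x.
Proof. by elim/big_rec2: _ => // i u v _ <-. Qed.

Lemma bop_lincombE a (A B : bop H) x : (a *: A + B) x = a *: A x + B x.
Proof. by []. Qed.

Lemma bopZ (A : bop H) a x : A (a *: x) = a *: A x.
Proof. exact: linearZ_LR. Qed.

Lemma bop_sum (A : bop H) I (r : seq I) (P : pred I) (F : I -> H) :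
  A (\sum_(i <- r | P i) F i) = \sum_(i <- r | P i) A (F i).
Proof. exact: (raddf_sum A). Qed.

(** With [Q] the sum of the [|v i|^2] and [S] the sum of inner products, expand
    the sum of the [|Q u i - S v i|^2]. *)
Lemma sum_CauchySchwarz (I : Type) (r : seq I) (u v : I -> H) :
  `|\sum_(i <- r) inner (u i) (v i)| ^+ 2 <=
  (\sum_(i <- r) `|u i| ^+ 2) * (\sum_(i <- r) `|v i| ^+ 2).
Proof.
set S := \sum_(i <- r) inner _ _; set P := \sum_(i <- r) `|u i| ^+ 2.
set Q := \sum_(i <- r) `|v i| ^+ 2.
have Q0 : 0 <= Q by apply: sumr_ge0 => i _; rewrite exprn_ge0.
have P0 : 0 <= P by apply: sumr_ge0 => i _; rewrite exprn_ge0.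
have QR : Q^* = Q by apply: CrealP; rewrite ger0_real.
have E a b : a^* = a -> \sum_(i <- r) `|a *: u i - b *: v i| ^+ 2 =
    a ^+ 2 * P - a * (b^* * S) - a * (b * S^*) + b * b^* * Q.
  move=> aR; rewrite /P /S /Q rmorph_sum !mulr_sumr -!sumrB -big_split/=.
  apply: eq_bigr => i _; rewrite !normE_inner innerBl !innerBr !innerZl !innerZr aR.
  by rewrite -innerC; ring.
have E0 a b : a^* = a -> 0 <= a ^+ 2 * P - a * (b^* * S) - a * (b * S^*) + b * b^* * Q.
  by move=> aR; rewrite -E//; apply: sumr_ge0 => i _; rewrite exprn_ge0.
rewrite normCK; set s := S * S^*.
have s0 : 0 <= s by rewrite /s mul_conjC_ge0.
have sE a b : a^* = a -> b^* = b -> 0 <= a ^+ 2 * P - a * b * s *+ 2 + b ^+ 2 * s * Q.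
  move=> aR bR; have := E0 a (b * S) aR; rewrite rmorphM/= bR /s.
  by congr (_ <= _); ring.
(* If [Q = 0] then [S = 0], or a large multiple of [S] would make the
   expansion negative. *)
have [Qz|Qn] := eqVneq Q 0.
  have [->|sn] := eqVneq s 0; first by rewrite mulr_ge0.
  have s1 : 0 < s by rewrite lt_def sn.
  have bR : ((P + 1) / s)^* = (P + 1) / s.
    by apply: CrealP; rewrite ger0_real// divr_ge0// addr_ge0.
  have := sE 1 _ (rmorph1 _) bR.
  rewrite Qz mulr0 addr0 expr1n !mul1r divfK// mulrS mulr1n opprD addrA.
  have -> : P - (P + 1) - (P + 1) = - (P + 1 + 1) by ring.
  rewrite oppr_ge0 => h; have P2 : 0 < P + 1 + 1 by rewrite ltr_wpDl// addr_ge0.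
  by have := lt_le_trans P2 h; rewrite ltxx.
have Q1 : 0 < Q by rewrite lt_def Qn.
have := sE Q 1 QR (rmorph1 _).
have -> : Q ^+ 2 * P - Q * 1 * s *+ 2 + 1 ^+ 2 * s * Q = Q * (P * Q - s) by ring.
by rewrite pmulr_rge0// subr_ge0.
Qed.

(** Pairing a family with itself turns a bound on a form into a bound on an
    operator: [s^2 <= c s] gives [s <= c]. *)
Lemma norm_le_of_form (I : Type) (r : seq I) (u : I -> H) (c : R[i]) : 0 <= c ->
  `|\sum_(i <- r) inner (u i) (u i)| ^+ 2 <= c * (\sum_(i <- r) `|u i| ^+ 2) ->
  \sum_(i <- r) `|u i| ^+ 2 <= c.
Proof.
move=> c0; set s := \sum_(i <- r) `|u i| ^+ 2.
have s0 : 0 <= s by apply: sumr_ge0 => i _; rewrite exprn_ge0.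
have -> : \sum_(i <- r) inner (u i) (u i) = s.
  by apply: eq_bigr => i _; rewrite normE_inner.
rewrite ger0_norm// expr2; have [->//|sn] := eqVneq s 0.
by rewrite ler_pM2r// lt_def sn.
Qed.

End Riesz.

(** * Weak operator and weak* topologies *)

Section OperatorTopologyLemmas.
Context (R : realType) (H : hilbertType R).

Lemma cvg_initial (S : choiceType) (T : topologicalType) (f : S -> T)
    (F : set_system S) (s : S) : Filter F ->
  f @ F --> f s -> F --> (s : initial_topology f).
Proof.
move=> FF Ff A /= [_ [[B Bop <-] Bfs sBfA]].
have /Ff FB : nbhs (f s) B by rewrite nbhsE; exists B.
exact: filterS sBfA FB.
Qed.

Lemma wstar_cvgP (T : Type) (F : set_system T) (u : T -> bop H) (A : bop H) :
  Filter F ->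
  (forall phi, normal_functional phi -> (fun t => phi (u t)) @ F --> phi A) ->
  (fun t => u t : wstar H) @ F --> (A : wstar H).
Proof.
move=> FF uA; apply/cvg_sup => -[phi phin].
by apply: cvg_initial => /=; exact: uA.
Qed.

Lemma normal_continuous phi : normal_functional phi ->
  continuous (phi : wstar H -> R[i]).
Proof.
move=> phin A.
have /cvg_sup/(_ (exist _ phi phin)) : nbhs (A : wstar H) --> (A : wstar H) by [].
move=> h; apply: cvg_trans (@initial_continuous _ _ phi A).
exact: (cvg_app phi h).
Qed.

Lemma wot_cvgP (T : Type) (F : set_system T) (u : T -> bop H) (A : bop H) :
  Filter F ->
  (forall x y, (fun t => inner (u t x) y) @ F --> inner (A x) y) ->
  (fun t => u t : wot H) @ F --> (A : wot H).
Proof.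
move=> FF uA; apply/cvg_sup => -[x y].
by apply: cvg_initial => /=; exact: uA.
Qed.

Lemma wot_continuous x y : continuous (fun A : wot H => inner ((A : bop H) x) y).
Proof.
move=> A.
have /cvg_sup/(_ (x, y)) : nbhs (A : wot H) --> (A : wot H) by [].
move=> h; apply: cvg_trans (@initial_continuous _ _ (fun A : bop H => inner (A x) y) A).
exact: (cvg_app (fun A : bop H => inner (A x) y) h).
Qed.

Definition seq1 (x : H) (n : nat) : H := if n is 0%N then x else 0.

Lemma series_seq1 (V : normedModType R[i]) (u : nat -> V) :
  (forall n, u n.+1 = 0) -> series u @ \oo --> u 0%N.
Proof.
move=> u0; apply: cvg_near_cst; exists 1%N => // -[//|n] _ /=.
rewrite /series/= big_nat_recl// big1 ?addr0// => i _; exact: u0.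
Qed.

Lemma square_summable_seq1 x : square_summable_seq (seq1 x).
Proof.
apply/cvg_ex; exists (`|x| ^+ 2).
by apply: (@series_seq1 _ (fun n => `|seq1 x n| ^+ 2)) => n /=; rewrite normr0 expr0n.
Qed.

(** Only the first terms of the two sequences are nonzero. *)
Lemma vector_functional_normal x y :
  normal_functional (fun A : bop H => inner (A x) y).
Proof.
exists (seq1 x), (seq1 y); split; [exact: square_summable_seq1 ..|move=> A].
apply/esym/cvg_lim; first exact: norm_hausdorff.
by apply: (@series_seq1 _ (fun n => inner (A (seq1 x n)) (seq1 y n))) => n; rewrite inner0r.
Qed.

Lemma closed_eq_continuous (T : topologicalType) (f g : T -> R[i]) :
  continuous f -> continuous g -> closed [set t | f t = g t].
Proof.
move=> fc gc; have -> : [set t | f t = g t] = (fun t => f t - g t) @^-1` [set 0].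
  apply/seteqP; split => t /=; first by move->; rewrite subrr.
  by move/eqP; rewrite subr_eq0 => /eqP.
apply: preimage_closed.
  by move=> t _; apply: cvgB; [exact: fc|exact: gc].
by apply: accessible_closed_set1; apply: hausdorff_accessible; exact: norm_hausdorff.
Qed.

Lemma wot_closed_eq x y x' y' :
  closed ([set A | inner ((A : bop H) x) y = inner (A x') y'] : set (wot H)).
Proof. exact: closed_eq_continuous (@wot_continuous x y) (@wot_continuous x' y'). Qed.

Lemma wstar_closed_eq x y x' y' :
  closed ([set A | inner ((A : bop H) x) y = inner (A x') y'] : set (wstar H)).
Proof.
by apply: closed_eq_continuous; apply: normal_continuous;
  exact: vector_functional_normal.
Qed.

End OperatorTopologyLemmas.

Section AbsoluteSeries.
Context (R : realType).

Lemma seriesDE (a b : nat -> R[i]) :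
  series (fun n => a n + b n) = (fun n => series a n + series b n).
Proof. by apply/funext => n; rewrite /series/= big_split. Qed.

Lemma seriesB_le (a b : nat -> R[i]) (c : R[i]) m n : 0 <= c ->
  (forall k, `|b k| <= c * a k) -> (m <= n)%N ->
  `|series b n - series b m| <= c * (series a n - series a m).
Proof.
move=> c0 ba mn; rewrite /series/= (big_cat_nat (leq0n m) mn)/=.
rewrite [X in _ * (X - _)](big_cat_nat (leq0n m) mn)/=.
rewrite ![\sum_(0 <= i < m) _ + _]addrC !addrK mulr_sumr.
by apply: le_trans (ler_norm_sum _ _ _) _; apply: ler_sum => k _.
Qed.

(** The error bound depends on [b] only through [c], so it is uniform over all
    the series with the same majorant. *)
Lemma series_dominated (a b : nat -> R[i]) (c s : R[i]) : 0 <= c ->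
  (forall k, 0 <= a k) -> series a @ \oo --> s ->
  (forall k, `|b k| <= c * a k) ->
  series b @ \oo --> limn (series b) /\
  forall n, `|limn (series b) - series b n| <= c * (s - series a n).
Proof.
move=> c0 a0 sa ba.
have amon m n : (m <= n)%N -> series a m <= series a n.
  move=> mn; rewrite -subr_ge0 /series/= (big_cat_nat (leq0n m) mn)/= addrC addrK.
  by apply: sumr_ge0 => k _.
have aub n : series a n <= s by apply: (limn_complex_ge sa (N := n)) => k; exact: amon.
have bc : series b @ \oo --> limn (series b).
  apply: complex_cauchy_sequence_cvg => e e0.
  have c1 : 0 < c + 1 by rewrite ltr_wpDl.
  have ac : cauchy_sequence (series a).
    apply: (nondecreasing_cauchy (M := s)) => //.
    by rewrite /series/= big_geq.
  have [N NP] := ac _ (divr_gt0 e0 c1).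
  have le m n : (m <= n)%N -> (N <= m)%N -> `|series b n - series b m| < e.
    move=> mn Nm; apply: le_lt_trans (seriesB_le c0 ba mn) _.
    have := NP _ _ (leq_trans Nm mn) Nm; rewrite ger0_norm ?subr_ge0 ?amon//.
    rewrite ltr_pdivlMr// mulrC; apply: le_lt_trans.
    by rewrite ler_wpM2r ?subr_ge0 ?amon// lerDl.
  exists N => m n Nm Nn; have [mn|/ltnW nm] := leqP m n; last exact: le.
  by rewrite distrC; exact: le.
split=> // n.
have h : (fun k => `|series b k - series b n|) @ \oo --> `|limn (series b) - series b n|.
  exact: (cvg_norm (cvgB bc (cvg_cst (series b n)))).
apply: (limn_complex_le h (N := n)) => k nk.
by apply: le_trans (seriesB_le c0 ba nk) _; rewrite ler_wpM2l// lerB.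
Qed.

End AbsoluteSeries.

Section BoundedConvergence.
Context (R : realType) (H : hilbertType R).

Lemma norm_inner_sqr (x y : H) : `|x| * `|y| <= `|x| ^+ 2 + `|y| ^+ 2.
Proof.
rewrite -subr_ge0.
have -> : `|x| ^+ 2 + `|y| ^+ 2 - `|x| * `|y| =
    (((`|x| - `|y|) ^+ 2) + (`|x| ^+ 2 + `|y| ^+ 2)) / 2%:R by field.
apply: divr_ge0 => //; apply: addr_ge0.
  by rewrite real_exprn_even_ge0// realB// normr_real.
by apply: addr_ge0; rewrite exprn_ge0.
Qed.

Lemma normal_series (x y : nat -> H) :
  square_summable_seq x -> square_summable_seq y ->
  exists2 s, series (fun n => `|x n| ^+ 2 + `|y n| ^+ 2) @ \oo --> s &
  forall (b : nat -> R[i]) c, 0 <= c -> (forall n, `|b n| <= c * (`|x n| * `|y n|)) ->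
    series b @ \oo --> limn (series b) /\
    forall n, `|limn (series b) - series b n| <=
      c * (s - series (fun n => `|x n| ^+ 2 + `|y n| ^+ 2) n).
Proof.
move=> /cvg_ex[s1 h1] /cvg_ex[s2 h2]; exists (s1 + s2).
  by rewrite seriesDE; exact: (cvgD h1 h2).
move=> b c c0 bc.
apply: (@series_dominated _ (fun n => `|x n| ^+ 2 + `|y n| ^+ 2) b c (s1 + s2) c0).
- by move=> n; rewrite addr_ge0// exprn_ge0.
- by rewrite seriesDE; exact: (cvgD h1 h2).
- by move=> n; apply: le_trans (bc n) _; rewrite ler_wpM2l// norm_inner_sqr.
Qed.

(** Three epsilons: the uniform norm bound controls the change of both
    vectors. *)
Lemma weak_cvg_dense (X : nat -> bop H) (A : bop H) (c : R[i]) (D : set H) :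
  0 <= c -> (forall n x, `|X n x| <= c * `|x|) -> (forall x, `|A x| <= c * `|x|) ->
  (forall x (e : R[i]), 0 < e -> exists2 x', D x' & `|x - x'| < e) ->
  (forall x y, D x -> D y -> (fun n => inner (X n x) y) @ \oo --> inner (A x) y) ->
  forall x y, (fun n => inner (X n x) y) @ \oo --> inner (A x) y.
Proof.
move=> c0 Xc Ac Dd XA x y; apply/cvgrPdist_lt => e e0.
have e3 : 0 < e / 3%:R by rewrite divr_gt0.
have bnd a b : 0 <= a -> `|b| < e / 3%:R / (2%:R * c * a + 1) ->
    2%:R * c * a * `|b| < e / 3%:R :> R[i].
  move=> a0; have p0 : 0 < 2%:R * c * a + 1 by rewrite ltr_wpDl ?mulr_ge0.
  rewrite ltr_pdivlMr// mulrC; apply: le_lt_trans.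
  by rewrite ler_wpM2r// lerDl.
have pos a : 0 <= a -> 0 < e / 3%:R / (2%:R * c * a + 1) :> R[i].
  by move=> a0; rewrite divr_gt0// ltr_wpDl ?mulr_ge0.
have [x' Dx' xx'] := Dd x _ (pos _ (normr_ge0 y)).
have [y' Dy' yy'] := Dd y _ (pos _ (normr_ge0 x')).
have [N _ NP] := (cvgrPdist_lt _ _).1 (XA _ _ Dx' Dy') _ e3.
exists N => // n /NP /= h.
have -> : inner (A x) y - inner (X n x) y =
    inner (A (x - x') - X n (x - x')) y + inner (A x' - X n x') (y - y')
    + (inner (A x') y' - inner (X n x') y').
  by rewrite (linearB A) (linearB (X n)) !innerBl !innerBr; ring.
have -> : e = e / 3%:R + e / 3%:R + e / 3%:R by field.
have XAle z : `|A z - X n z| <= 2%:R * c * `|z|.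
  apply: le_trans (ler_normB _ _) _.
  by rewrite -mulrA mulr_natl mulr2n lerD.
apply: le_lt_trans (ler_normD _ _) _; apply: ltrD => //.
apply: le_lt_trans (ler_normD _ _) _; apply: ltrD.
  apply: le_lt_trans (norm_inner _ _) _.
  apply: le_lt_trans (ler_wpM2r (normr_ge0 _) (XAle _)) _.
  by rewrite mulrAC -normr_id; apply: bnd; rewrite ?normr_id.
apply: le_lt_trans (norm_inner _ _) _.
apply: le_lt_trans (ler_wpM2r (normr_ge0 _) (XAle _)) _.
by rewrite -[`|y - y'|]normr_id; apply: bnd; rewrite ?normr_id.
Qed.

(** The tail of the series defining a normal functional is small uniformly on
    norm bounded sets, which leaves finitely many matrix coefficients. *)
Lemma wstar_cvg_bounded (X : nat -> bop H) (A : bop H) (c : R[i]) : 0 <= c ->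
  (forall n x, `|X n x| <= c * `|x|) -> (forall x, `|A x| <= c * `|x|) ->
  (forall x y, (fun n => inner (X n x) y) @ \oo --> inner (A x) y) ->
  (fun n => X n : wstar H) @ \oo --> (A : wstar H).
Proof.
move=> c0 Xc Ac XA; apply: wstar_cvgP => phi [x [y [xs ys phiE]]].
have [s sP bP] := normal_series xs ys.
have bnd (B : bop H) : (forall z, `|B z| <= c * `|z|) ->
    forall n, `|inner (B (x n)) (y n)| <= c * (`|x n| * `|y n|).
  move=> Bc n; apply: le_trans (norm_inner _ _) _.
  by rewrite mulrA ler_wpM2r.
apply/cvgrPdist_lt => e e0; rewrite phiE.
have c1 : 0 < 2%:R * c + 1 by rewrite ltr_wpDl ?mulr_ge0.
have e2 : 0 < e / 2%:R by rewrite divr_gt0.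
have [K _ KP] := (cvgrPdist_lt _ _).1 sP _ (divr_gt0 e2 c1).
have [_ tA] := bP _ c c0 (bnd A Ac).
have part : (fun n => series (fun k => inner (X n (x k)) (y k)) K) @ \oo -->
    series (fun k => inner (A (x k)) (y k)) K.
  by rewrite /series/=; apply: cvg_big => [|k _]; [exact: add_continuous|exact: XA].
have [N _ NP] := (cvgrPdist_lt _ _).1 part _ e2.
exists N => // n /NP /= h; rewrite phiE.
have [_ tX] := bP _ c c0 (bnd (X n) (Xc n)).
set lA := limn _; set lX := limn _.
have -> : lA - lX = (lA - series (fun k => inner (A (x k)) (y k)) K) -
   (lX - series (fun k => inner (X n (x k)) (y k)) K) +
   (series (fun k => inner (A (x k)) (y k)) K - series (fun k => inner (X n (x k)) (y k)) K).
  by ring.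
rewrite [ltRHS](splitr e); apply: le_lt_trans (ler_normD _ _) _; apply: ltrD => //.
apply: le_lt_trans (ler_normB _ _) _.
apply: le_lt_trans (lerD (tA K) (tX K)) _.
have := KP K (leqnn K); rewrite ltr_pdivlMr// => hK.
set q := s - _ in hK *.
have -> : c * q + c * q = q * (2%:R * c) by ring.
apply: le_lt_trans hK.
have qr : q \is Num.real.
  rewrite /q; apply: realB; last by apply: rpred_sum => k _; rewrite ger0_real// addr_ge0// exprn_ge0.
  rewrite ger0_real//; apply: (limn_complex_ge sP (N := 0%N)) => k _.
  by apply: sumr_ge0 => j _; rewrite addr_ge0// exprn_ge0.
apply: (@le_trans _ _ (`|q| * (2%:R * c))).
  by rewrite ler_wpM2r ?mulr_ge0// real_ler_norm.
by rewrite ler_wpM2l// lerDl.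
Qed.

Lemma normal_functional_linear (phi : bop H -> R[i]) : normal_functional phi ->
  forall a A B, phi (a *: A + B) = a * phi A + phi B.
Proof.
move=> [x [y [xs ys phiE]]] a A B.
have [s _ bP] := normal_series xs ys.
have cv (C : bop H) : cvgn (series (fun n => inner (C (x n)) (y n))).
  have [c c0 Cc] := bop_bounded C.
  have cc : 0 <= c%:C%C :> R[i] by rewrite lecR ltW.
  apply: (bP _ c%:C%C cc _).1 => n; apply: le_trans (norm_inner _ _) _.
  by rewrite mulrA ler_wpM2r.
rewrite !phiE; apply/cvg_lim; first exact: norm_hausdorff.
have -> : series (fun n => inner ((a *: A + B) (x n)) (y n)) =
    (fun n => a * series (fun n => inner (A (x n)) (y n)) n +
      series (fun n => inner (B (x n)) (y n)) n).
  apply/funext => n; rewrite /series/= mulr_sumr -big_split/=.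
  by apply: eq_bigr => i _; rewrite -innerPl.
exact: (cvgD (cvgMr (cv A)) (cv B)).
Qed.

Lemma normal_functional_sum (phi : bop H -> R[i]) : normal_functional phi ->
  forall (I : Type) (r : seq I) (c : I -> R[i]) (F : I -> bop H),
  phi (\sum_(i <- r) c i *: F i) = \sum_(i <- r) c i * phi (F i).
Proof.
move=> /normal_functional_linear pl I r c F.
have p0 : phi 0 = 0.
  by have := pl (-1) 0 0; rewrite scaler0 addr0 mulN1r addNr.
by elim: r => [|i r IHr]; rewrite ?big_nil// !big_cons pl IHr.
Qed.

End BoundedConvergence.

(** * Tensor products and slices *)

Section TensorFlip.
Context (R : realType) (H K HK : hilbertType R) (t : hilbert_tensor H K HK).

Definition flip_fun (y : K) (x : H) : HK := t x y.

Lemma flip_bilinear : bilinear_for *:%R *:%R flip_fun.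
Proof. by split=> [z a x y|z a x y]; rewrite /flip_fun ?linearPr ?linearPl. Qed.

HB.instance Definition _ := @bilinear_isBilinear.Build R[i] K H HK *:%R *:%R
  flip_fun flip_bilinear.

Definition flip_tensor : hilbert_tensor K H HK.
Proof.
refine (@HilbertTensor R K H HK flip_fun _ _).
  by move=> x x' y y'; rewrite /flip_fun inner_tens mulrC.
rewrite (_ : [set z | _] = [set z | exists x y, z = t x y]); first exact: tens_total.
by apply/seteqP; split => [_ [y [x ->]]|_ [x [y ->]]]; [exists x, y|exists y, x].
Defined.

End TensorFlip.

Section TensorVectors.
Context (R : realType) (H K HK : hilbertType R) (t : hilbert_tensor H K HK).

Definition tensor_sum (s : seq (H * K)) : HK := \sum_(p <- s) t p.1 p.2.

Lemma tensor_sum_dense z (e : R[i]) : 0 < e -> exists s, `|z - tensor_sum s| < e.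
Proof.
move=> e0; have [|z' []] := tens_total t (O := ball z e) _ (ball_open z e).
  by exists z; exact: ballxx.
rewrite -ball_normE /= => zz'.
suff : smallest (@lin_subspace R HK) [set z | exists x y, z = t x y] `<=` range tensor_sum.
  by move=> h /h[s _ sE]; exists s; rewrite sE.
apply: smallest_sub; last first.
  by move=> _ [x [y ->]]; exists [:: (x, y)] => //; rewrite /tensor_sum big_seq1.
split; first by exists [::] => //; rewrite /tensor_sum big_nil.
move=> a _ _ [s _ <-] [s' _ <-].
exists ([seq (a *: p.1, p.2) | p <- s] ++ s') => //.
rewrite /tensor_sum big_cat big_map scaler_sumr; congr (_ + _).
by apply: eq_bigr => p _; rewrite linearZl_LR.
Qed.

Lemma norm_tens x y : `|t x y| = `|x| * `|y|.
Proof.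
apply/eqP; rewrite -(@eqrXn2 _ 2) ?mulr_ge0// exprMn !normE_inner.
by rewrite inner_tens.
Qed.

Lemma tens_suml I (r : seq I) (P : pred I) (F : I -> H) y :
  t (\sum_(i <- r | P i) F i) y = \sum_(i <- r | P i) t (F i) y.
Proof. by elim/big_rec2: _ => [|i u v _ <-]; rewrite ?linear0l ?linearDl. Qed.

Lemma tens_sumr I (r : seq I) (P : pred I) (F : I -> K) x :
  t x (\sum_(i <- r | P i) F i) = \sum_(i <- r | P i) t x (F i).
Proof. by elim/big_rec2: _ => [|i u v _ <-]; rewrite ?linear0r ?linearDr. Qed.

Definition orthonormal n (e : 'I_n -> K) := forall i l, inner (e i) (e l) = (i == l)%:R.

(** Gram-Schmidt. Over an orthonormal family in the second leg the squared norm
    of a tensor is the sum of the squared norms of its coefficients, which is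
    how operators on the first leg are estimated below. *)
Lemma orthonormal_expansion (s : seq K) : exists n (e : 'I_n -> K),
  orthonormal e /\ forall y, y \in s -> y = \sum_i inner y (e i) *: e i.
Proof.
elim: s => [|y s [n [e [eo es]]]].
  by exists 0%N, (fun=> 0); split=> // -[].
pose y' := y - \sum_i inner y (e i) *: e i.
have y'e i : inner y' (e i) = 0.
  rewrite /y' innerBl inner_suml (bigD1 i)//= innerZl eo eqxx mulr1 big1 ?addr0 ?subrr//.
  by move=> l li; rewrite innerZl eo (negbTE li) mulr0.
have [y'0|y'0] := eqVneq y' 0.
  exists n, e; split=> // z; rewrite inE => /orP[/eqP ->|/es//].
  by apply/eqP; rewrite -subr_eq0 -/y' y'0.
pose e' (i : 'I_n.+1) := if unlift ord0 i is Some k then e k else `|y'|^-1 *: y'.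
have e'0 : e' ord0 = `|y'|^-1 *: y' by rewrite /e' unlift_none.
have e'S k : e' (lift ord0 k) = e k by rewrite /e' liftK.
have ny' : `|y'| != 0 by rewrite normr_eq0.
have cy' : (`|y'|^-1)^* = `|y'|^-1 by apply: CrealP; rewrite ger0_real// invr_ge0.
have e'o : orthonormal e'.
  move=> i l; case: (unliftP ord0 i) => [i'|] ->; case: (unliftP ord0 l) => [l'|] ->.
  - by rewrite !e'S eo (inj_eq lift_inj).
  - by rewrite e'S e'0 innerZr innerC y'e rmorph0 mulr0 eq_sym (negbTE (neq_lift _ _)).
  - by rewrite e'S e'0 innerZl y'e mulr0 (negbTE (neq_lift _ _)).
  - by rewrite e'0 innerZl innerZr cy' -normE_inner eqxx mulrA -expr2 -exprMn mulVf// expr1n.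
exists n.+1, e'; split=> // z; rewrite inE => zs.
have zE c k : z = c *: y' + \sum_i k i *: e i -> z = \sum_i inner z (e' i) *: e' i.
  move=> zE; have {}zE : z = \sum_i (if unlift ord0 i is Some l then k l else c * `|y'|) *: e' i.
    rewrite big_ord_recl unlift_none e'0 scalerA mulfK// zE; congr (_ + _).
    by apply: eq_bigr => i _; rewrite liftK e'S.
  rewrite {1}zE; apply: eq_bigr => i _; congr (_ *: _).
  rewrite zE inner_suml (bigD1 i)//= innerZl e'o eqxx mulr1 big1 ?addr0//.
  by move=> l li; rewrite innerZl e'o (negbTE li) mulr0.
case/orP: zs => [/eqP zy|/es zs].
  by apply: (zE 1 (fun i => inner y (e i))); rewrite scale1r /y' subrK.
by apply: (zE 0 (fun i => inner z (e i))); rewrite scale0r add0r.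
Qed.

Section OnOrthonormalFamily.
Context (n : nat) (e : 'I_n -> K).

(** A tensor whose second leg runs through a fixed family; [h] is then its
    vector of coefficients. *)
Definition tensor_on (h : 'I_n -> H) : HK := \sum_i t (h i) (e i).

Lemma inner_tensor_on h h' : orthonormal e -> inner (tensor_on h) (tensor_on h') = \sum_i inner (h i) (h' i).
Proof.
move=> eo; rewrite inner_suml; apply: eq_bigr => i _; rewrite inner_sumr (bigD1 i)//=.
rewrite inner_tens eo eqxx mulr1 big1 ?addr0// => l li.
by rewrite inner_tens eo eq_sym (negbTE li) mulr0.
Qed.

Lemma norm_tensor_on h : orthonormal e -> `|tensor_on h| ^+ 2 = \sum_i `|h i| ^+ 2.
Proof.
by move=> eo; rewrite normE_inner inner_tensor_on//; apply: eq_bigr => i _; rewrite normE_inner.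
Qed.

Definition coefs (s : seq (H * K)) (i : 'I_n) : H :=
  \sum_(p <- s) inner p.2 (e i) *: p.1.

Lemma tensor_sum_on (A : bop H) s :
  (forall p, p \in s -> p.2 = \sum_i inner p.2 (e i) *: e i) ->
  tensor_sum [seq (A p.1, p.2) | p <- s] = tensor_on (fun i => A (coefs s i)).
Proof.
move=> sE; rewrite /tensor_sum big_map /tensor_on.
transitivity (\sum_(p <- s) \sum_i t (inner p.2 (e i) *: A p.1) (e i)).
  rewrite big_seq [RHS]big_seq; apply: eq_bigr => p ps /=.
  rewrite {1}(sE p ps) tens_sumr; apply: eq_bigr => i _.
  by rewrite linearZr_LR linearZl_LR.
rewrite exchange_big/=; apply: eq_bigr => i _.
rewrite -tens_suml; congr (t _ _); rewrite /coefs bop_sum.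
by apply: eq_bigr => p _; rewrite bopZ.
Qed.

End OnOrthonormalFamily.

Lemma tensor_sum_expand (s : seq (H * K)) n (e : 'I_n -> K) :
  (forall p, p \in s -> p.2 = \sum_i inner p.2 (e i) *: e i) ->
  tensor_sum s = tensor_on e (coefs e s).
Proof.
move=> /(tensor_sum_on (bid H)) <-; congr tensor_sum.
by elim: s => //= -[x y] s <-.
Qed.

(** The list [s] is rewritten over an orthonormal family, where [A] acts on each
    coefficient separately. *)
Lemma tensor_sum_bound (A : bop H) (c : R[i]) s : 0 <= c ->
  (forall x, `|A x| <= c * `|x|) ->
  `|tensor_sum [seq (A p.1, p.2) | p <- s]| <= c * `|tensor_sum s|.
Proof.
move=> c0 Ac; have [n [e [eo es]]] := orthonormal_expansion [seq p.2 | p <- s].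
have sE p : p \in s -> p.2 = \sum_i inner p.2 (e i) *: e i.
  by move=> ps; apply: es; exact: map_f.
rewrite -(@ler_pXn2r _ 2) ?nnegrE ?mulr_ge0// exprMn.
rewrite (tensor_sum_on _ sE) (tensor_sum_expand sE) !norm_tensor_on// mulr_sumr.
by apply: ler_sum => i _; rewrite -exprMn ler_pXn2r ?nnegrE ?mulr_ge0.
Qed.

End TensorVectors.

Section Extension.
Context (R : realType) (V : hilbertType R).

(** Extension by continuity. Source and target are two families with the same
    indices, so that the value need not be known to depend only on the vector:
    the norm bound implies it. *)
Lemma extend_bounded (I : Type) (u v : I -> V) (c : R[i]) : 0 <= c ->
  (forall z (e : R[i]), 0 < e -> exists k, `|z - u k| < e) ->
  (forall a k l, exists m, u m = a *: u k + u l /\ v m = a *: v k + v l) ->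
  (forall k, `|v k| <= c * `|u k|) ->
  exists X : bop V, forall k, X (u k) = v k.
Proof.
move=> c0 ud uv vc.
have vB k l : `|v k - v l| <= c * `|u k - u l|.
  have [m [um vm]] := uv (-1) l k.
  by have := vc m; rewrite um vm !scaleN1r ![- _ + _]addrC.
have c1 : 0 < c + 1 by rewrite ltr_wpDl.
pose G z y := forall e : R[i], 0 < e -> exists k, `|z - u k| < e /\ `|y - v k| < e.
have Gu k : G (u k) (v k) by move=> e e0; exists k; rewrite !subrr normr0.
(* The closure [G] of the relation is still bounded by [c], so it is the graph
   of a function. *)
have GB z y z' y' : G z y -> G z' y' -> `|y - y'| <= c * `|z - z'|.
  move=> Gzy Gzy'; apply/ler_addgt0Pr => e e0.
  have d0 : 0 < e / 2%:R / (c + 1) by rewrite !divr_gt0.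
  have [k [zk yk]] := Gzy _ d0; have [l [zl yl]] := Gzy' _ d0.
  set D := e / 2%:R / (c + 1) in d0 zk yk zl yl.
  have -> : y - y' = (y - v k) + (v k - v l) - (y' - v l) by rewrite subrKA opprB subrKA.
  have De : e = D * 2%:R * (c + 1) by rewrite /D; field; rewrite gt_eqF.
  apply: le_trans (ler_normB _ _) _.
  apply: le_trans (lerD (ler_normD _ _) (lexx _)) _.
  have h : `|v k - v l| <= c * (`|z - z'| + D + D).
    apply: le_trans (vB k l) _; apply: ler_wpM2l => //.
    have -> : u k - u l = (z - z') - (z - u k) + (z' - u l).
      by rewrite opprB [z - z' + _]addrC !subrKA.
    apply: le_trans (ler_normD _ _) _; apply: lerD; last exact: ltW.
    by apply: le_trans (ler_normB _ _) _; rewrite lerD// ltW.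
  apply: le_trans (lerD (lerD (ltW yk) h) (ltW yl)) _.
  rewrite De le_eqVlt; apply/orP; left; apply/eqP; ring.
have GD a z y z' y' : G z y -> G z' y' -> G (a *: z + z') (a *: y + y').
  move=> Gzy Gzy' e e0.
  have a1 : 0 < `|a| + 1 by rewrite ltr_wpDl.
  have d0 : 0 < e / (`|a| + 1) by rewrite divr_gt0.
  have [k [zk yk]] := Gzy _ d0; have [l [zl yl]] := Gzy' _ d0.
  have [m [um vm]] := uv a k l; exists m; rewrite um vm.
  have E w w' w1 w1' : `|w - w'| < e / (`|a| + 1) -> `|w1 - w1'| < e / (`|a| + 1) ->
      `|a *: w + w1 - (a *: w' + w1')| < e :> R[i].
    move=> h h'; rewrite opprD addrACA -scalerBr; apply: le_lt_trans (ler_normD _ _) _.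
    rewrite normrZ; have -> : e = `|a| * (e / (`|a| + 1)) + e / (`|a| + 1).
      by field; rewrite gt_eqF.
    by apply: ler_ltD => //; rewrite ler_wpM2l// ltW.
  by split; exact: E.
(* Any vector is the limit of a sequence from the domain, and the images of
   that sequence are Cauchy. *)
have Gex z : exists y, G z y.
  have /choice[k kP] (n : nat) : exists k, `|z - u k| < n.+1%:R^-1.
    by apply: ud; rewrite invr_gt0.
  have inv_le (n m : nat) : (n <= m)%N -> m.+1%:R^-1 <= n.+1%:R^-1 :> R[i].
    by move=> nm; rewrite lef_pV2 ?posrE// ler_nat ltnS.
  have vcauchy : cauchy_sequence (v \o k).
    move=> e e0; have d0 : 0 < e / 2%:R / (c + 1) by rewrite !divr_gt0.
    have [N NP] := complex_archi d0; exists N => m n Nm Nn /=.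
    apply: le_lt_trans (vB _ _) _.
    have uB : `|u (k m) - u (k n)| < e / (c + 1).
      have -> : u (k m) - u (k n) = (z - u (k n)) - (z - u (k m)).
        by rewrite opprB [RHS]addrC subrKA.
      apply: le_lt_trans (ler_normB _ _) _.
      have -> : e / (c + 1) = e / 2%:R / (c + 1) + e / 2%:R / (c + 1).
        by field; rewrite gt_eqF.
      by apply: ltrD; apply: lt_le_trans (kP _) _; apply: le_trans (inv_le _ _ _) (ltW NP).
    have h := uB; rewrite ltr_pdivlMr// mulrC in h; apply: le_lt_trans h.
    by rewrite ler_wpM2r// lerDl.
  have /cvg_ex[y vy] := cauchy_sequence_cvg vcauchy.
  exists y => e e0.
  have [N1 _ N1P] := (cvgrPdist_lt _ _).1 vy _ e0.
  have [N2 N2P] := complex_archi e0.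
  exists (k (maxn N1 N2)); split; last by apply: N1P => /=; rewrite leq_maxl.
  apply: lt_le_trans (kP _) _; apply: le_trans (inv_le _ _ _) (ltW N2P).
  exact: leq_maxr.
have [f fP] := choice Gex.
have Guniq z y y' : G z y -> G z y' -> y = y'.
  move=> h h'; apply/eqP; rewrite -subr_eq0 -normr_eq0 eq_le normr_ge0 andbT.
  by have := GB _ _ _ _ h h'; rewrite subrr normr0 mulr0.
have fl : linear f by move=> a z z'; apply: (Guniq (a *: z + z')) => //; exact: GD.
have G0 : G 0 0.
  have [k _] := ud 0 1 ltr01; have [m [um vm]] := uv (-1) k k.
  by have := Gu m; rewrite um vm !scaleN1r !addNr.
have fb z : `|f z| <= c * `|z| by have := GB _ _ _ _ (fP z) G0; rewrite !subr0.
by exists (Bop (bounded_linear_le fl fb)) => k; apply: (Guniq (u k)).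
Qed.

Lemma form_bound_norm (x : V) (C : R[i]) :
  0 <= C -> (forall y, `|inner x y| <= C * `|y|) -> `|x| <= C.
Proof.
move=> C0 h; have [->|x0] := eqVneq x 0; first by rewrite normr0.
have nx : 0 < `|x| by rewrite normr_gt0.
by rewrite -(ler_pM2r nx) -expr2 normE_inner -[leLHS]ger0_norm ?inner_ge0.
Qed.

Lemma dense_norm_bound (X : bop V) (D : set V) (c : R[i]) : 0 <= c ->
  (forall z (e : R[i]), 0 < e -> exists2 z', D z' & `|z - z'| < e) ->
  (forall z z', D z -> D z' -> `|inner (X z) z'| <= c * (`|z| * `|z'|)) ->
  forall z, `|X z| <= c * `|z|.
Proof.
move=> c0 Dd Xc z.
have app (y : V) : exists y_ : nat -> V, (forall n, D (y_ n)) /\ y_ @ \oo --> y.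
  have /choice[y_ yP] (n : nat) : exists y', D y' /\ `|y - y'| < n.+1%:R^-1.
    by have [|y' ? ?] := Dd y n.+1%:R^-1; [rewrite invr_gt0|exists y'].
  exists y_; split; first by move=> n; have [] := yP n.
  apply: (@cvg_dominated _ _ _ _ _ (fun n => n.+1%:R^-1)); first exact: inv_cvg0.
  by move=> n; have [_ /ltW] := yP n.
apply: form_bound_norm => [|y]; first by rewrite mulr_ge0.
have [z_ [Dz zz]] := app z; have [y_ [Dy yy]] := app y.
have h1 : (fun n => `|inner (X (z_ n)) (y_ n)|) @ \oo --> `|inner (X z) y|.
  apply: cvg_norm; apply: inner_cvg => //.
  by apply: continuous_cvg => //; exact: bop_continuous.
have h2 : (fun n => c * (`|z_ n| * `|y_ n|)) @ \oo --> c * (`|z| * `|y|).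
  by apply: cvgMr; apply: cvgM; apply: cvg_norm.
rewrite -mulrA -subr_ge0; apply: (limn_complex_ge (cvgB h2 h1) (N := 0%N)) => n _.
by rewrite subr_ge0; exact: Xc.
Qed.

End Extension.

Section TensorOperators.
Context (R : realType) (H K HK : hilbertType R) (t : hilbert_tensor H K HK).

Lemma tensor_op_exists (A : bop H) (B : bop K) : exists X : bop HK, is_tensor_op t A B X.
Proof.
have [a a0 Aa] := bop_bounded A; have [b b0 Bb] := bop_bounded B.
have a0' : 0 <= a%:C%C :> R[i] by rewrite lecR ltW.
have b0' : 0 <= b%:C%C :> R[i] by rewrite lecR ltW.
have [||||X XE] := @extend_bounded R HK (seq (H * K)) (tensor_sum t)
    (fun s => tensor_sum t [seq (A p.1, B p.2) | p <- s]) (a%:C%C * b%:C%C).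
- exact: mulr_ge0.
- by move=> z e e0; exact: tensor_sum_dense.
- move=> c k l; exists ([seq (c *: p.1, p.2) | p <- k] ++ l).
  rewrite /tensor_sum !(big_cat, big_map) !scaler_sumr/=.
  split; congr (_ + _); apply: eq_bigr => p _; first by rewrite linearZl_LR.
  by rewrite bopZ linearZl_LR.
- move=> s; rewrite -mulrA.
  have -> : [seq (A p.1, B p.2) | p <- s] = [seq (A p.1, p.2) | p <- [seq (p.1, B p.2) | p <- s]].
    by rewrite -map_comp.
  apply: le_trans (tensor_sum_bound _ _ a0' Aa) _; apply: ler_wpM2l => //.
  have := tensor_sum_bound (flip_tensor t) [seq (p.2, p.1) | p <- s] b0' Bb.
  by rewrite /tensor_sum -map_comp !big_map.
exists X => x y; have := XE [:: (x, y)].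
by rewrite /tensor_sum /= !big_seq1.
Qed.

Definition tensor_op A B : bop HK := sval (cid (tensor_op_exists A B)).

Lemma tensor_opP A B : is_tensor_op t A B (tensor_op A B).
Proof. exact: (svalP (cid (tensor_op_exists A B))). Qed.

Lemma slice_subproof (x y : H) (X : bop HK) :
  exists B : bop K, forall k k', inner (B k) k' = inner (X (t x k)) (t y k').
Proof.
have [c c0 Xc] := bop_bounded X.
apply: (@bop_of_form _ _ _ (c * complex.Re `|x| * complex.Re `|y|)) => [a k l k'|a k l k'|k l].
- by rewrite linearPr linearP innerPl.
- by rewrite linearPr innerDr innerZr.
- rewrite !rmorphM/= -!normr_ReE; apply: le_trans (norm_inner _ _) _.
  apply: le_trans (ler_wpM2r (normr_ge0 _) (Xc _)) _.
  by rewrite !norm_tens le_eqVlt; apply/orP; left; apply/eqP; ring.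
Qed.

(** The image of [X] under [phi (x) id], for [phi] the functional [<. x, y>]. *)
Definition slice x y X : bop K := sval (cid (slice_subproof x y X)).

Lemma sliceP x y X k k' : inner (slice x y X k) k' = inner (X (t x k)) (t y k').
Proof. exact: (svalP (cid (slice_subproof x y X)) k k'). Qed.

Lemma slice_seq1 x y X B : is_left_slice t (seq1 x) (seq1 y) X B -> B = slice x y X.
Proof.
move=> h; apply: bop_eq => k k'; rewrite h sliceP.
apply/cvg_lim; first exact: norm_hausdorff.
apply: (@series_seq1 _ _ (fun n => inner (X (t (seq1 x n) k)) (t (seq1 y n) k'))) => n.
by rewrite linear0l linear0 inner0l.
Qed.

(** If [psi] is the normal functional of the sequences [u] and [v], then [psi]
    composed with a slice is that of [x (x) u] and [y (x) v]. *)
Lemma slice_continuous x y : continuous (slice x y : wstar HK -> wstar K).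
Proof.
move=> X; apply: (@wstar_cvgP _ _ (wstar HK) (nbhs X) (slice x y) (slice x y X)) => phi [u [v [us vs phiE]]].
have ns (z : H) (w : nat -> K) : square_summable_seq w ->
    square_summable_seq (fun n => t z (w n)).
  move=> /cvg_ex[l wl]; apply/cvg_ex; exists (`|z| ^+ 2 * l).
  have -> : series (fun n => `|t z (w n)| ^+ 2) =
      (fun n => `|z| ^+ 2 * series (fun n => `|w n| ^+ 2) n).
    apply/funext => n; rewrite /series/= mulr_sumr; apply: eq_bigr => i _.
    by rewrite norm_tens exprMn.
  exact: cvgMr.
apply: (@normal_continuous _ _ (fun X => phi (slice x y X)) _ X).
exists (fun n => t x (u n)), (fun n => t y (v n)); split; [exact: ns|exact: ns|].
by move=> Y; rewrite phiE; congr (limn (series _)); apply/funext => n; rewrite sliceP.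
Qed.

Lemma slice_linear x y a X Y : slice x y (a *: X + Y) = a *: slice x y X + slice x y Y.
Proof.
apply: bop_eq => k k'; rewrite sliceP.
by rewrite !bop_lincombE !innerPl !sliceP.
Qed.

(** One of the two conditions defining the Fubini product; the other one is
    this condition for the flipped tensor product. *)
Definition left_fubini (T : set (bop K)) : set (bop HK) := [set X |
  forall x y : nat -> H, square_summable_seq x -> square_summable_seq y ->
  exists2 B, T B & is_left_slice t x y X B].

(** A slice by a general normal functional is the weak* limit of sums of slices
    by pairs of vectors. *)
Lemma left_fubiniE T : wstar_closed_subspace T ->
  left_fubini T = [set X | forall x y, T (slice x y X)].
Proof.
move=> [Tl Tc]; apply/seteqP; split => [X XT x y|X XT x y xs ys].
  have [B TB /slice_seq1 <-//] := XT _ _ (@square_summable_seq1 R H x) (@square_summable_seq1 R H y).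
have [s sP bP] := normal_series xs ys; have [c c0 Xc] := bop_bounded X.
have c0' : 0 <= c%:C%C :> R[i] by rewrite lecR ltW.
have bnd k k' n : `|inner (X (t (x n) k)) (t (y n) k')| <=
    c%:C%C * (`|k| * `|k'|) * (`|x n| * `|y n|).
  apply: le_trans (norm_inner _ _) _.
  apply: le_trans (ler_wpM2r (normr_ge0 _) (Xc _)) _.
  by rewrite !norm_tens le_eqVlt; apply/orP; left; apply/eqP; ring.
have C0 (k k' : K) : 0 <= c%:C%C * (`|k| * `|k'|) by rewrite !mulr_ge0.
have cv (k k' : K) := (bP _ _ (C0 k k') (bnd k k')).1.
have tl (k k' : K) := (bP _ _ (C0 k k') (bnd k k')).2.
have s0 : 0 <= s.
  apply: (limn_complex_ge sP (N := 0%N)) => n _.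
  by apply: sumr_ge0 => i _; rewrite addr_ge0 ?exprn_ge0.
pose F k k' := limn (series (fun n => inner (X (t (x n) k)) (t (y n) k'))).
have FC (k k' : K) : `|F k k'| <= c%:C%C * s * (`|k| * `|k'|).
  have := tl k k' 0%N; rewrite /series/= !big_geq// !subr0 => h.
  by apply: le_trans h _; rewrite mulrAC.
have [B BE] : exists B : bop K, forall k k', inner (B k) k' = F k k'.
  apply: (@bop_of_form _ _ F (c * complex.Re s)) => [a k l k'|a k l k'|k l].
  - apply/cvg_lim; first exact: norm_hausdorff.
    have -> : series (fun n => inner (X (t (x n) (a *: k + l))) (t (y n) k')) =
        (fun n => a * series (fun n => inner (X (t (x n) k)) (t (y n) k')) n +
          series (fun n => inner (X (t (x n) l)) (t (y n) k')) n).
      apply/funext => n; rewrite /series/= mulr_sumr -big_split/=.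
      by apply: eq_bigr => i _; rewrite linearPr linearP innerPl.
    exact: (cvgD (cvgMr (cv k k')) (cv l k')).
  - apply/cvg_lim; first exact: norm_hausdorff.
    have -> : series (fun n => inner (X (t (x n) k')) (t (y n) (a *: k + l))) =
        (fun n => a^* * series (fun n => inner (X (t (x n) k')) (t (y n) k)) n +
          series (fun n => inner (X (t (x n) k')) (t (y n) l)) n).
      apply/funext => n; rewrite /series/= mulr_sumr -big_split/=.
      by apply: eq_bigr => i _; rewrite linearPr innerDr innerZr.
    exact: (cvgD (cvgMr (cv k' k)) (cv k' l)).
  - by rewrite rmorphM/= RRe_real ?ger0_real.
exists B => //.
pose BN n : bop K := \sum_(0 <= i < n) slice (x i) (y i) X.
have BNE n k k' : inner (BN n k) k' = series (fun n => inner (X (t (x n) k)) (t (y n) k')) n.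
  by rewrite /BN bop_sumE inner_suml; apply: eq_bigr => i _; rewrite sliceP.
have cs0 : 0 <= c%:C%C * s * 2%:R by rewrite !mulr_ge0.
apply: (@closed_cvg _ (wstar K) \oo _ (fun n => BN n : wstar K) T Tc _ B).
  by apply: nearW => n; apply: lin_subspace_sum.
apply: (wstar_cvg_bounded cs0) => [n k|k|k k'].
- apply: form_bound_norm => [|k']; first by rewrite mulr_ge0.
  rewrite BNE -[series _ n](subrK (F k k')) addrC.
  apply: le_trans (ler_normD _ _) _.
  have -> : c%:C%C * s * 2%:R * `|k| * `|k'| =
      c%:C%C * s * (`|k| * `|k'|) + c%:C%C * (`|k| * `|k'|) * s by ring.
  apply: lerD => //; rewrite distrC; apply: le_trans (tl k k' n) _.
  by rewrite ler_wpM2l// gerBl; apply: sumr_ge0 => i _; rewrite addr_ge0 ?exprn_ge0.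
- apply: form_bound_norm => [|k']; first by rewrite mulr_ge0.
  rewrite BE; apply: le_trans (FC k k') _.
  have -> : c%:C%C * s * 2%:R * `|k| * `|k'| =
      c%:C%C * s * (`|k| * `|k'|) + c%:C%C * s * (`|k| * `|k'|) by ring.
  by rewrite lerDl !mulr_ge0.
- by rewrite BE; under eq_fun do rewrite BNE; exact: cv.
Qed.

Lemma left_fubini_wstar_closed T : wstar_closed_subspace T ->
  wstar_closed_subspace (left_fubini T).
Proof.
move=> TT; rewrite left_fubiniE//; have [[T0 TD] Tc] := TT; split.
  split=> [x y|a X Y XT YT x y /=]; last by rewrite slice_linear; exact: TD.
  suff -> : slice x y 0 = 0 by [].
  by apply: bop_eq => k k'; rewrite sliceP !inner0l.
have -> : [set X | forall x y, T (slice x y X)] =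
    \bigcap_(p in [set: H * H]) (slice p.1 p.2 @^-1` T).
  by apply/seteqP; split => [X XT p _|X XT x y]; [exact: XT|exact: (XT (x, y))].
apply: (@closed_bigI (wstar HK)) => p _.
by apply: (@preimage_closed (wstar HK) (wstar K)) => // X _; exact: slice_continuous.
Qed.

Lemma left_fubini_tensor (T : set (bop K)) A B X : wstar_closed_subspace T ->
  T B -> is_tensor_op t A B X -> left_fubini T X.
Proof.
move=> TT TB XAB; rewrite left_fubiniE// => x y /=; have [Tl _] := TT.
suff -> : slice x y X = inner (A x) y *: B by exact: lin_subspaceZ.
by apply: bop_eq => k k'; rewrite sliceP XAB inner_tens -innerZl.
Qed.

End TensorOperators.

(** * Fubini products and finite rank approximation *)

Section SlicePropertyFromApproximation.
Context (R : realType) (V : hilbertType R) (S : set (bop V)).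
Context (I : Type) (r : nat -> seq I) (p q : nat -> I -> V) (E : nat -> I -> bop V).

(** A finite rank map with vector functionals as coefficients. *)
Definition finite_rank_map n (A : bop V) : bop V :=
  \sum_(w <- r n) inner (A (p n w)) (q n w) *: E n w.
Local Notation Phi := finite_rank_map.

Context (S_closed : wstar_closed_subspace S) (ES : forall n w, S (E n w)).
Context (Phi_cc : forall n, completely_contractive_on S (Phi n)).
Context (Phi_cvg : forall A, S A -> forall x y,
  (fun n => inner (Phi n A x) y) @ \oo --> inner (A x) y).
Context (K HK : hilbertType R) (t : hilbert_tensor V K HK) (T : set (bop K)).
Context (T_closed : wstar_closed_subspace T).

(** The image of [X] under [Phi n (x) id]. *)
Definition amplified n (X : bop HK) : bop HK :=
  \sum_(w <- r n) tensor_op t (E n w) (slice t (p n w) (q n w) X).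

Lemma amplified_normal n X : left_fubini t T X -> normal_tensor t S T (amplified n X).
Proof.
rewrite left_fubiniE// => XT M [[Ml Mc] MP]; apply: lin_subspace_sum => // w _.
apply: MP; exists (E n w), (slice t (p n w) (q n w) X).
by split; [exact: ES|exact: XT|exact: tensor_opP].
Qed.

Lemma inner_amplified n X x k y l : inner (amplified n X (t x k)) (t y l) =
  inner (Phi n (slice (flip_tensor t) k l X) x) y.
Proof.
rewrite /amplified /Phi !bop_sumE !inner_suml; apply: eq_bigr => w _.
rewrite tensor_opP inner_tens sliceP -[RHS]/(inner (_ *: E n w x) y) innerZl sliceP.
by rewrite mulrC.
Qed.

Lemma inner_amplified_on n X m (e : 'I_m -> K) (h h' : 'I_m -> V) :
  inner (amplified n X (tensor_on t e h)) (tensor_on t e h') =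
  \sum_l inner (\sum_i Phi n (slice (flip_tensor t) (e i) (e l) X) (h i)) (h' l).
Proof.
rewrite /tensor_on bop_sum inner_sumr; apply: eq_bigr => l _.
by rewrite !inner_suml; apply: eq_bigr => i _; rewrite inner_amplified.
Qed.

Lemma common_orthonormal (s s' : seq (V * K)) : exists m (e : 'I_m -> K) (h h' : 'I_m -> V),
  [/\ orthonormal e, tensor_sum t s = tensor_on t e h & tensor_sum t s' = tensor_on t e h'].
Proof.
have [m [e [eo es]]] := orthonormal_expansion [seq w.2 | w <- s ++ s'].
exists m, e, (coefs e s), (coefs e s'); split=> //; apply: tensor_sum_expand => w ws.
  by apply: es; apply: map_f; rewrite mem_cat ws.
by apply: es; apply: map_f; rewrite mem_cat ws orbT.
Qed.

(** In an orthonormal family of the second leg, [X] is the operator matrix of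
    its slices. *)
Lemma slices_mx_norm (X : bop HK) (c : R[i]) m (e : 'I_m -> K) : 0 <= c ->
  (forall z, `|X z| <= c * `|z|) -> orthonormal e ->
  mx_norm_le (\matrix_(l, i) slice (flip_tensor t) (e i) (e l) X) c.
Proof.
move=> c0 Xc eo x.
pose u l := \sum_i slice (flip_tensor t) (e i) (e l) X (x i).
have -> : \sum_l `|\sum_i (\matrix_(l, i) slice (flip_tensor t) (e i) (e l) X) l i (x i)| ^+ 2 =
    \sum_l `|u l| ^+ 2.
  by apply: eq_bigr => l _; congr (`|_| ^+ 2); apply: eq_bigr => i _; rewrite mxE.
apply: norm_le_of_form.
  by rewrite mulr_ge0 ?exprn_ge0// sumr_ge0// => i _; rewrite exprn_ge0.
have -> : \sum_l inner (u l) (u l) = inner (X (tensor_on t e x)) (tensor_on t e u).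
  rewrite /tensor_on bop_sum inner_sumr; apply: eq_bigr => l _.
  by rewrite {1}/u !inner_suml; apply: eq_bigr => i _; rewrite sliceP.
have h : `|inner (X (tensor_on t e x)) (tensor_on t e u)| <=
    c * `|tensor_on t e x| * `|tensor_on t e u|.
  by apply: le_trans (norm_inner _ _) _; rewrite ler_wpM2r.
rewrite -(norm_tensor_on t x eo) -(norm_tensor_on t u eo) -!exprMn.
by rewrite ler_pXn2r ?nnegrE ?mulr_ge0.
Qed.

(** Complete contractivity, applied to the operator matrix of [X]. *)
Lemma amplified_bound n (X : bop HK) (c : R[i]) : 0 <= c -> left_fubini (flip_tensor t) S X ->
  (forall z, `|X z| <= c * `|z|) -> forall z, `|amplified n X z| <= c * `|z|.
Proof.
move=> c0; rewrite left_fubiniE// => XS Xc.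
apply: (@dense_norm_bound _ _ _ (range (tensor_sum t))) => //.
  by move=> z e e0; have [s] := tensor_sum_dense t z e0; exists (tensor_sum t s); first by exists s.
move=> _ _ [s _ <-] [s' _ <-]; have [m [e [h [h' [eo -> ->]]]]] := common_orthonormal s s'.
rewrite inner_amplified_on.
set u := fun l => \sum_i Phi n (slice (flip_tensor t) (e i) (e l) X) (h i).
have uh : \sum_l `|u l| ^+ 2 <= c ^+ 2 * \sum_i `|h i| ^+ 2.
  have H : mx_norm_le (map_mx (Phi n)
      (\matrix_(l, i) slice (flip_tensor t) (e i) (e l) X)) c.
    apply: Phi_cc => // [l i|]; first by rewrite mxE; exact: XS.
    exact: slices_mx_norm.
  apply: le_trans (H h).
  rewrite le_eqVlt; apply/orP; left; apply/eqP; apply: eq_bigr => l _.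
  by congr (`|_| ^+ 2); apply: eq_bigr => i _; rewrite !mxE.
rewrite -(@ler_pXn2r _ 2) ?nnegrE ?mulr_ge0//.
apply: le_trans (sum_CauchySchwarz _ u h') _.
rewrite !exprMn !norm_tensor_on// mulrA ler_wpM2r//.
by apply: sumr_ge0 => i _; rewrite exprn_ge0.
Qed.

Lemma amplified_cvg X : left_fubini (flip_tensor t) S X ->
  (fun n => amplified n X : wstar HK) @ \oo --> (X : wstar HK).
Proof.
move=> XS; have [c c0 Xc] := bop_bounded X.
have cc : 0 <= c%:C%C :> R[i] by rewrite lecR ltW.
have Yc n := amplified_bound n cc XS Xc.
apply: (wstar_cvg_bounded cc) => //.
apply: (weak_cvg_dense cc Yc Xc (D := range (tensor_sum t))).
  by move=> z e e0; have [s] := tensor_sum_dense t z e0; exists (tensor_sum t s); first by exists s.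
move=> _ _ [s _ <-] [s' _ <-].
have -> : inner (X (tensor_sum t s)) (tensor_sum t s') =
    \sum_(w <- s) \sum_(w' <- s') inner (slice (flip_tensor t) w.2 w'.2 X w.1) w'.1.
  rewrite /tensor_sum bop_sum inner_suml; apply: eq_bigr => w _.
  by rewrite inner_sumr; apply: eq_bigr => w' _; rewrite sliceP.
have E' n : inner (amplified n X (tensor_sum t s)) (tensor_sum t s') =
    \sum_(w <- s) \sum_(w' <- s') inner (Phi n (slice (flip_tensor t) w.2 w'.2 X) w.1) w'.1.
  rewrite /tensor_sum bop_sum inner_suml; apply: eq_bigr => w _.
  by rewrite inner_sumr; apply: eq_bigr => w' _; rewrite inner_amplified.
under eq_fun do rewrite E'.
move: XS; rewrite left_fubiniE// => XS.
apply: cvg_big => [|w _]; first exact: add_continuous.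
apply: cvg_big => [|w' _]; first exact: add_continuous.
by apply: Phi_cvg; exact: XS.
Qed.

(** An element of the Fubini product is the limit of its amplified images. For
    the converse, both slice conditions are weak* closed, so that elementary
    tensors suffice. *)
Lemma fubini_normal : fubini_tensor t S T = normal_tensor t S T.
Proof.
have -> : fubini_tensor t S T = left_fubini t T `&` left_fubini (flip_tensor t) S by [].
apply/seteqP; split => [X [XT XS] M MP|].
  have [[_ Mc] _] := MP.
  apply: (@closed_cvg _ (wstar HK) \oo _ (fun n => amplified n X : wstar HK) M Mc _ X).
    by apply: nearW => n; exact: (amplified_normal n XT MP).
  exact: amplified_cvg.
have [[T0 TD] Tc] := left_fubini_wstar_closed t T_closed.
have [[S0 SD] Sc] := left_fubini_wstar_closed (flip_tensor t) S_closed.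
apply: smallest_sub.
  split; last exact: (@closedI (wstar HK)).
  split=> // a X Y [XT XS] [YT YS].
  by split; [exact: TD|exact: SD].
move=> X [A [B [SA TB XAB]]]; split; first exact: left_fubini_tensor TB XAB.
by apply: (@left_fubini_tensor _ _ _ _ _ _ B A) => // k x; exact: XAB.
Qed.

End SlicePropertyFromApproximation.

(** * The Fock space *)

Section Words.
Context (d : nat).
Local Notation word := (seq 'I_d).

Fixpoint words (n : nat) : seq word :=
  if n is m.+1 then [::] :: [seq i :: w | i <- enum 'I_d, w <- words m] else [::].

Lemma mem_words n w : (w \in words n) = (size w < n)%N.
Proof.
elim: n w => [//|n IHn] [|i w] //=; rewrite inE ltnS /= -IHn.
apply/idP/idP => [/allpairsP[[j v] /= [_ vn [_ ->]]]//|wn].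
by apply: allpairs_f => //; rewrite mem_enum.
Qed.

Lemma uniq_words n : uniq (words n).
Proof.
elim: n => [//|n IHn] /=; apply/andP; split.
  by apply/negP => /allpairsP[[j v] /= [_ _]].
by apply: allpairs_uniq => // [|[i w] [j v] _ _ /= [-> ->]]; rewrite ?enum_uniq.
Qed.

Context (M : nmodType).
Implicit Types F : word -> M.

Lemma sum_words_cons F n : \sum_(w <- words n.+1) F w =
  F [::] + \sum_(i < d) \sum_(w <- words n) F (i :: w).
Proof. by rewrite /= big_cons big_allpairs_dep big_enum. Qed.

Lemma sum_words_rcons F n : \sum_(w <- words n.+1) F w =
  F [::] + \sum_(i < d) \sum_(w <- words n) F (rcons w i).
Proof.
rewrite (perm_big ([::] :: [seq rcons w i | i <- enum 'I_d, w <- words n])).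
  by rewrite big_cons big_allpairs_dep big_enum.
apply: uniq_perm; first exact: uniq_words.
  rewrite /=; apply/andP; split.
    by apply/negP => /allpairsP[[i w] /= [_ _]]; case: w.
  apply: allpairs_uniq => [||[i w] [j v] _ _ /= /rcons_inj[-> ->]]//.
    exact: enum_uniq.
  exact: uniq_words.
move=> w; rewrite mem_words inE; case/lastP: w => [//|w i].
rewrite size_rcons ltnS -mem_words.
have -> : (rcons w i == [::]) = false by case: w.
apply/idP/allpairsP => /= [wn|[[j v] /= [_ vn /rcons_inj[-> _]]]//].
by exists (i, w); rewrite mem_enum.
Qed.

Lemma sum_words_widen F m n : (m <= n)%N ->
  (forall w, (m <= size w)%N -> F w = 0) ->
  \sum_(w <- words n) F w = \sum_(w <- words m) F w.
Proof.
move=> mn F0; rewrite (bigID (fun w => (size w < m)%N))/= [X in _ + X]big1 ?addr0.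
  rewrite -big_filter; apply: perm_big; apply: uniq_perm.
  - by rewrite filter_uniq// uniq_words.
  - exact: uniq_words.
  - move=> w; rewrite mem_filter !mem_words andbC.
    by case: (ltnP (size w) m) => wm; rewrite ?andbF// andbT (leq_trans wm mn).
by move=> w; rewrite -leqNgt; exact: F0.
Qed.

End Words.

Section WordSums.
Context (R : realType) (d : nat).
Local Notation word := (seq 'I_d).
Local Notation H := (l2 R d).
Implicit Types (F : word -> R[i]) (f g x y : H).

Lemma word_sumE F n : word_sum F n = \sum_(w <- words d n) F w.
Proof.
elim: n F => [|n IHn] F; first by rewrite /word_sum big_ord0 big_nil.
rewrite sum_words_cons; under eq_bigr do rewrite -IHn.
rewrite {1}/word_sum big_ord_recl; congr (_ + _).
  by rewrite (bigD1 [tuple])//= big1 ?addr0// => w /eqP[]; exact: tuple0.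
rewrite /word_sum exchange_big; apply: eq_bigr => k _ /=.
rewrite (reindex (fun p : 'I_d * k.-tuple 'I_d => [tuple of p.1 :: p.2]))/=; last first.
  exists (fun w : k.+1.-tuple 'I_d => (thead w, [tuple of behead w])) => [[j v] _|w _].
    by congr pair; apply/val_inj.
  by rewrite [RHS]tuple_eta; apply/val_inj.
by rewrite pair_big.
Qed.

Lemma sum_words_le F m n : (forall w, 0 <= F w) -> (m <= n)%N ->
  \sum_(w <- words d m) F w <= \sum_(w <- words d n) F w.
Proof. by move=> F0 mn; rewrite -!word_sumE; exact: word_sum_nondecreasing. Qed.

Lemma lim_uniq (V : normedModType R[i]) (u : nat -> V) (a b : V) : u @ \oo --> a -> u @ \oo --> b -> a = b.
Proof. by move=> ua ub; apply: cvg_unique ub; first exact: norm_hausdorff. Qed.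

Lemma l2_inner_cvg f g :
  (fun n => \sum_(w <- words d n) f w * (g w)^*) @ \oo --> inner f g.
Proof.
have -> : (fun n => \sum_(w <- words d n) f w * (g w)^* ) =
    word_sum (fun w => f w * (g w)^* ) by apply/funext => n; rewrite word_sumE.
exact: l2_dot_cvg.
Qed.

Lemma inner_finite f g n :
  (forall w, (n <= size w)%N -> f w * (g w)^* = 0) ->
  inner f g = \sum_(w <- words d n) f w * (g w)^*.
Proof.
move=> fg0; apply: (lim_uniq (@l2_inner_cvg f g)).
by apply: cvg_near_cst; exists n => // k /= nk; exact: sum_words_widen.
Qed.

Lemma l2_eq f g : (forall w, f w = g w) -> f = g.
Proof. by move=> fg; apply/val_inj/funext. Qed.

(** The sum on the right runs one degree further, so that maps removing a
    letter are covered. *)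
Lemma coord_bop (phi : (word -> R[i]) -> word -> R[i]) (c : R[i]) : 0 <= c ->
  (forall a f g, phi (fun w => a * f w + g w) = fun w => a * phi f w + phi g w) ->
  (forall f n, \sum_(w <- words d n) `|phi f w| ^+ 2 <=
     c * \sum_(w <- words d n.+1) `|f w| ^+ 2) ->
  exists B : bop H, forall f w, B f w = phi f w.
Proof.
move=> c0 philin phib.
have sq (f : H) : phi f \in @square_summable R d.
  apply/asboolP; exists (c * l2_dot f f) => n.
  by rewrite word_sumE (le_trans (phib _ _))// ler_wpM2l// -word_sumE word_sum_le_dot.
pose B f := Ell2 (sq f).
have Bl : linear B.
  move=> a f g; apply: l2_eq => w /=.
  transitivity (a * phi f w + phi g w); last by [].
  by rewrite -[RHS](congr1 (fun h => h w) (philin a f g)).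
have Bb : forall f, `|B f| <= sqrtC c * `|f|.
  move=> f; rewrite -(@ler_pXn2r _ 2) ?nnegrE ?mulr_ge0 ?sqrtC_ge0//.
  rewrite exprMn [sqrtC c ^+ 2]sqrtCK !normE_inner; apply: l2_dot_le => n.
  rewrite word_sumE; apply: le_trans (phib f n) _; apply: ler_wpM2l => //.
  by rewrite -word_sumE word_sum_le_dot.
by exists (Bop (bounded_linear_le Bl Bb)).
Qed.

Lemma cut_subproof (D : nat -> bool) :
  exists B : bop H, forall f w, B f w = if D (size w) then f w else 0.
Proof.
apply: (@coord_bop (fun (f : word -> R[i]) w => if D (size w) then f w else 0) 1) => //.
  by move=> a f g; apply/funext => w; case: ifP => // _; rewrite mulr0 addr0.
move=> f n; rewrite mul1r.
apply: le_trans (sum_words_le _ (leqnSn n)); last by move=> w; rewrite exprn_ge0.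
by apply: ler_sum => w _; case: ifP => // _; rewrite normr0 expr0n exprn_ge0.
Qed.

Definition cut (D : nat -> bool) : bop H := sval (cid (cut_subproof D)).

Lemma cutE D f w : cut D f w = if D (size w) then f w else 0.
Proof. exact: (svalP (cid (cut_subproof D))). Qed.

Lemma inner_cut D f g : inner (cut D f) g = inner f (cut D g).
Proof.
apply: (lim_uniq (@l2_inner_cvg _ _)).
apply: cvg_trans (@l2_inner_cvg _ _); apply: near_eq_cvg; near=> n.
apply: eq_bigr => w _; rewrite !cutE; case: ifP => // _.
by rewrite rmorph0 mulr0 mul0r.
Unshelve. all: by end_near. Qed.

Lemma rstar_subproof (i : 'I_d) :
  exists B : bop H, forall f w, B f w = f (rcons w i).
Proof.
apply: (@coord_bop (fun (f : word -> R[i]) w => f (rcons w i)) 1) => //.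
move=> f n; rewrite mul1r sum_words_rcons (bigD1 i)//= addrCA lerDl addr_ge0// ?exprn_ge0//.
by apply: sumr_ge0 => j _; apply: sumr_ge0 => w _; rewrite exprn_ge0.
Qed.

(** The adjoint of the creation operator adding the letter [i] on the right. *)
Definition rstar (i : 'I_d) : bop H := sval (cid (rstar_subproof i)).

Lemma rstarE i f w : rstar i f w = f (rcons w i).
Proof. exact: (svalP (cid (rstar_subproof i))). Qed.

Lemma lstarE u f w : adj (Lshift R u) f w = f (u ++ w).
Proof. by rewrite -inner_xi inner_adjl Lshift_xi inner_xi. Qed.

(** The ranges of the right creation operators are orthogonal to each other and
    fill up everything but the vacuum. *)
Lemma sum_rstar f g :
  \sum_i inner (rstar i f) (rstar i g) = inner f g - f [::] * (g [::])^*.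
Proof.
have h : (fun n => \sum_i \sum_(w <- words d n) rstar i f w * (rstar i g w)^*) @ \oo
    --> \sum_i inner (rstar i f) (rstar i g).
  apply: cvg_big => [|i _]; first exact: add_continuous.
  exact: l2_inner_cvg.
apply: (lim_uniq h).
have h' : (fun n => \sum_(w <- words d n.+1) f w * (g w)^* - f [::] * (g [::])^*) @ \oo
    --> inner f g - f [::] * (g [::])^*.
  apply: cvgB; last exact: cvg_cst.
  by have := @l2_inner_cvg f g; rewrite -(cvg_shiftS _ _).
apply: cvg_trans h'; apply: near_eq_cvg; near=> n.
rewrite sum_words_rcons [LHS]addrC addKr; apply: eq_bigr => i _; apply: eq_bigr => w _.
by rewrite !rstarE.
Unshelve. all: by end_near. Qed.

Lemma cut_cvg f : (fun n => cut (fun k => k < n)%N f) @ \oo --> f.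
Proof.
apply/cvgrPdist_lt => e e0; have e2 : 0 < e ^+ 2 by rewrite exprn_gt0.
have [N _ NP] := (cvgrPdist_lt _ _).1 (@l2_inner_cvg f f) _ e2.
exists N => // n /NP /=; set g := cut _ f => h.
rewrite -(@ltr_pXn2r _ 2) ?nnegrE ?(ltW e0)// normE_inner.
have gg : inner g g = \sum_(w <- words d n) f w * (f w)^*.
  rewrite (@inner_finite _ _ n) => [|w nw]; last first.
    by rewrite /g cutE ltnNge nw mul0r.
  rewrite big_seq [RHS]big_seq; apply: eq_bigr => w.
  by rewrite mem_words /g cutE => ->.
have gf : inner g f = inner g g.
  rewrite !(@inner_finite _ _ n) => [|w nw|w nw]; last 2 first.
  - by rewrite /g cutE ltnNge nw mul0r.
  - by rewrite /g cutE ltnNge nw mul0r.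
  rewrite big_seq [RHS]big_seq; apply: eq_bigr => w.
  by rewrite mem_words /g cutE => ->.
rewrite innerBl !innerBr [inner f g]innerC gf -innerC subrr subr0 gg.
apply: le_lt_trans h; rewrite real_ler_norm// -gg realB// ger0_real// inner_ge0//.
Unshelve. all: by end_near. Qed.

End WordSums.

(** * Fejer means on graded coinvariant subspaces *)

(** Degrees in the interval from [m - n + 1] to [m]. Every degree lies in [n]
    windows and two degrees at distance [l] share [n - l] of them, which are
    the weights of the Fejer kernel. *)
Definition window (n m k : nat) : bool := (k <= m < k + n)%N.

Lemma sum_interval (a b K : nat) : (b <= K)%N -> (\sum_(m < K) (a <= m < b) = b - a)%N.
Proof.
elim: K b => [|K IHK] b bK; first by rewrite big_ord0; lia.
rewrite big_ord_recr/=; have [bK'|Kb] := leqP b K.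
  by rewrite IHK// andbF addn0.
have -> : b = K.+1 by lia.
rewrite (eq_bigr (fun m : 'I_K => (a <= m < K)%N : nat)) => [|m _]; last first.
  by have := ltn_ord m; lia.
by rewrite IHK// andbT; case: leqP => /=; lia.
Qed.

Lemma sum_window_overlap (n l a K : nat) : (a + n <= K)%N ->
  (\sum_(m < K) (window n m a && window n m (l + a)) = n - l)%N.
Proof.
move=> aK; rewrite (eq_bigr (fun m : 'I_K => (l + a <= m < a + n)%N : nat)).
  by rewrite sum_interval//; lia.
by move=> m _; rewrite /window; congr nat_of_bool; lia.
Qed.

Lemma sum_window (n a K : nat) : (a + n <= K)%N -> (\sum_(m < K) window n m a = n)%N.
Proof. by move=> aK; rewrite (sum_interval a aK); lia. Qed.

Section GradedCoinvariant.
Context (R : realType) (d : nat).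
Local Notation word := (seq 'I_d).
Local Notation H := (l2 R d).

(** A graded subspace of the Fock space that is invariant under the adjoints of
    the creation operators on both sides, presented by its embedding: this
    treats the spaces [N_J] and the whole Fock space at the same time. *)
Record graded_coinvariant (V : hilbertType R) := GradedCoinvariant {
  emb :> V -> H ;
  emb_linear : linear emb ;
  inner_emb : forall x y, inner (emb x) (emb y) = inner x y ;
  emb_lstar : forall u x, exists x', emb x' = adj (Lshift R u) (emb x) ;
  emb_rstar : forall i x, exists x', emb x' = rstar R i (emb x) ;
  emb_cut : forall D x, exists x', emb x' = cut R d D (emb x)
}.

Context (V : hilbertType R) (j : graded_coinvariant V).

Lemma norm_emb x : `|j x| = `|x|.
Proof.
by apply/eqP; rewrite -(@eqrXn2 _ 2)// !normE_inner inner_emb.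
Qed.

Lemma embD x y : j (x + y) = j x + j y.
Proof. by have := emb_linear j 1 x y; rewrite !scale1r. Qed.

Lemma emb0 : j 0 = 0.
Proof. by apply: (addrI (j 0)); rewrite -embD !addr0. Qed.

Lemma embZ a x : j (a *: x) = a *: j x.
Proof. by rewrite -[a *: x]addr0 (emb_linear j) emb0 addr0. Qed.

Lemma embB x y : j (x - y) = j x - j y.
Proof. by rewrite -scaleN1r embD embZ scaleN1r. Qed.

Lemma emb_inj : injective j.
Proof.
move=> x y xy; apply/eqP; rewrite -subr_eq0 -normr_eq0 -norm_emb.
by rewrite embB xy subrr normr0.
Qed.

Lemma restrict_subproof (A : bop H) : (forall x, exists x', j x' = A (j x)) ->
  exists B : bop V, forall x, j (B x) = A (j x).
Proof.
move=> /choice[f fP]; have [c c0 cA] := bop_bounded A.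
have fl : linear f.
  move=> a x y; apply: emb_inj.
  by rewrite fP !(emb_linear j) linearP !fP.
have fb x : `|f x| <= c%:C%C * `|x| by rewrite -norm_emb fP -[`|x|]norm_emb.
by exists (Bop (bounded_linear_le fl fb)).
Qed.

Definition mlstar u : bop V := sval (cid (restrict_subproof (emb_lstar j u))).
Definition mrstar i : bop V := sval (cid (restrict_subproof (emb_rstar j i))).
Definition mcut D : bop V := sval (cid (restrict_subproof (emb_cut j D))).

Lemma emb_mlstar u x w : j (mlstar u x) w = j x (u ++ w).
Proof.
by rewrite (svalP (cid (restrict_subproof (emb_lstar j u)))) lstarE.
Qed.

Lemma emb_mrstar i x w : j (mrstar i x) w = j x (rcons w i).
Proof.
by rewrite (svalP (cid (restrict_subproof (emb_rstar j i)))) rstarE.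
Qed.

Lemma emb_mcutE D x : j (mcut D x) = cut R d D (j x).
Proof. exact: (svalP (cid (restrict_subproof (emb_cut j D)))). Qed.

Lemma emb_mcut D x w : j (mcut D x) w = if D (size w) then j x w else 0.
Proof. by rewrite emb_mcutE cutE. Qed.

(** The adjoint of the restriction of [L_u^*] is the compression of [L_u]. *)
Definition lcomp u : bop V := adj (mlstar u).
Definition rcomp i : bop V := adj (mrstar i).

Lemma coord_subproof w : exists e : V, forall y, inner y e = j y w.
Proof.
apply: (@riesz _ _ (fun y => j y w) (complex.Re `|xi R w|)) => [a x y|y].
  by rewrite emb_linear.
by rewrite -normr_ReE -inner_xi mulrC -norm_emb norm_inner.
Qed.

(** The compression of the basis vector [xi w]; for the empty word this is the
    compressed vacuum. *)
Definition mxi w : V := sval (cid (coord_subproof w)).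

Lemma inner_mxi y w : inner y (mxi w) = j y w.
Proof. exact: (svalP (cid (coord_subproof w))). Qed.

(** The adjoint of right creation by [w], which strips the suffix [w]. *)
Fixpoint rword (w : word) (x : V) : V :=
  if w is i :: v then mrstar i (rword v x) else x.

Lemma emb_rword w x v : j (rword w x) v = j x (v ++ w).
Proof.
elim: w v => [|i w IHw] v /=; first by rewrite cats0.
by rewrite emb_mrstar IHw cat_rcons.
Qed.

(** The commutation [B T_i = T_i B] is stated through matrix coefficients, which
    makes it a closed condition for the weak topologies. *)
Definition rcommutant : set (bop V) :=
  [set B : bop V | forall i x y, inner (B (rcomp i x)) y = inner (B x) (mrstar i y)].

Lemma rcommutant_lin : lin_subspace rcommutant.
Proof.
split=> [i x y|a A B cA cB i x y]; first by rewrite !inner0l.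
by rewrite -![(a *: A + B) _]/(a *: A _ + B _) !innerPl cA cB.
Qed.

Lemma rcommutant_wstar_closed : wstar_closed_subspace rcommutant.
Proof.
split; first exact: rcommutant_lin.
have -> : rcommutant = \bigcap_(p in [set: 'I_d * V * V])
    [set A : bop V | inner (A (rcomp p.1.1 p.1.2)) p.2 = inner (A p.1.2) (mrstar p.1.1 p.2)].
  by apply/seteqP; split => [A cA p _|A cA i x y]; [exact: cA|exact: (cA (i, x, y))].
by apply: (@closed_bigI (wstar V)) => p _; exact: wstar_closed_eq.
Qed.

Lemma rcommutant_wot_closed : closed (rcommutant : set (wot V)).
Proof.
have -> : rcommutant = \bigcap_(p in [set: 'I_d * V * V])
    [set A : bop V | inner (A (rcomp p.1.1 p.1.2)) p.2 = inner (A p.1.2) (mrstar p.1.1 p.2)].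
  by apply/seteqP; split => [A cA p _|A cA i x y]; [exact: cA|exact: (cA (i, x, y))].
by apply: (@closed_bigI (wot V)) => p _; exact: wot_closed_eq.
Qed.

Lemma adj_mrstar B : rcommutant B ->
  forall i y, adj B (mrstar i y) = mrstar i (adj B y).
Proof.
move=> cB i y; apply: inner_eq => x.
by rewrite inner_adjl innerC -cB -innerC -inner_adjl inner_adjr.
Qed.

Lemma adj_rword B : rcommutant B ->
  forall w y, adj B (rword w y) = rword w (adj B y).
Proof. by move=> cB; elim=> [//|i w IHw] y /=; rewrite adj_mrstar// IHw. Qed.

(** Every coordinate becomes a vacuum coordinate after stripping a suffix, and
    the adjoint of [B] commutes with that. *)
Lemma emb_adj B : rcommutant B ->
  forall y v, j (adj B y) v = inner (rword v y) (B (mxi [::])).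
Proof.
move=> cB y v; rewrite -[v in LHS]cat0s -emb_rword -adj_rword//.
by rewrite -inner_mxi inner_adjl.
Qed.

Definition degree_lt M : set V := [set x | forall w, (M <= size w)%N -> j x w = 0].

Lemma degree_lt_le M N x : (M <= N)%N -> degree_lt M x -> degree_lt N x.
Proof. by move=> MN xM w Nw; apply: xM; exact: leq_trans Nw. Qed.

Lemma degree_lt_mcut M D x : degree_lt M x -> degree_lt M (mcut D x).
Proof. by move=> xM w Mw; rewrite emb_mcut xM// if_same. Qed.

Lemma mcut_degree_lt M x : degree_lt M (mcut (fun k => k < M)%N x).
Proof. by move=> w Mw; rewrite emb_mcut ltnNge Mw. Qed.

Lemma inner_degree_lt M x y : degree_lt M x ->
  inner x y = \sum_(w <- words d M) j x w * (j y w)^*.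
Proof.
by move=> xM; rewrite -(inner_emb j); apply: inner_finite => w Mw; rewrite xM// mul0r.
Qed.

Lemma inner_lcomp M x y u : degree_lt M x ->
  inner (lcomp u x) y = \sum_(v <- words d M) j x v * (j y (u ++ v))^*.
Proof.
move=> xM; rewrite inner_adjl (inner_degree_lt _ xM).
by apply: eq_bigr => v _; rewrite emb_mlstar.
Qed.

(** For vectors of finite degree the formal Fourier series of [B] reduces to a
    finite sum. *)
Lemma fourier_series B M x y : rcommutant B -> degree_lt M x -> degree_lt M y ->
  inner (B x) y = \sum_(w <- words d M) inner (B (mxi [::])) (mxi w) * inner (lcomp w x) y.
Proof.
move=> cB xM yM; rewrite -inner_adjr (inner_degree_lt _ xM).
under [RHS]eq_bigr do rewrite (inner_lcomp _ _ xM) mulr_sumr.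
rewrite exchange_big/=; apply: eq_bigr => v _.
rewrite emb_adj// -innerC -(inner_emb j) (@inner_finite _ _ _ _ M); last first.
  by move=> w Mw; rewrite emb_rword yM ?rmorph0 ?mulr0// size_cat (leq_trans Mw)// leq_addr.
rewrite mulr_sumr; apply: eq_bigr => w _.
by rewrite inner_mxi emb_rword mulrCA.
Qed.

Lemma sum_window_lcomp n M x y u : degree_lt M x ->
  \sum_(m < M + n) inner (lcomp u (mcut (window n m) x)) (mcut (window n m) y) =
  (n - size u)%:R * inner (lcomp u x) y.
Proof.
move=> xM; under eq_bigr do rewrite (inner_lcomp _ _ (degree_lt_mcut _ xM)).
rewrite exchange_big/= (inner_lcomp _ _ xM) mulr_sumr big_seq [RHS]big_seq.
apply: eq_bigr => v; rewrite mem_words => vM.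
rewrite -(@sum_window_overlap n (size u) (size v) (M + n)) ?leq_add2r ?(ltnW vM)//.
rewrite natr_sum mulr_suml; apply: eq_bigr => m _.
rewrite !emb_mcut size_cat.
case: (window n m (size v)); rewrite /= ?mul0r//.
by case: (window n m _); rewrite ?mul1r ?mul0r ?rmorph0 ?mulr0.
Qed.

Lemma sum_window_norm n M x : degree_lt M x ->
  \sum_(m < M + n) `|mcut (window n m) x| ^+ 2 = n%:R * `|x| ^+ 2.
Proof.
move=> xM; rewrite normE_inner (inner_degree_lt _ xM).
under eq_bigr do rewrite normE_inner (inner_degree_lt _ (degree_lt_mcut _ xM)).
rewrite exchange_big/= mulr_sumr big_seq [RHS]big_seq.
apply: eq_bigr => v; rewrite mem_words => vM.
rewrite -[in RHS](@sum_window n (size v) (M + n)) ?leq_add2r ?(ltnW vM)//.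
rewrite natr_sum mulr_suml; apply: eq_bigr => m _.
rewrite !emb_mcut.
by case: (window n m _); rewrite ?mul1r ?mul0r.
Qed.

Definition fejer_coef (n : nat) (B : bop V) (w : word) : R[i] :=
  (1 - (size w)%:R / n%:R) * inner (B (mxi [::])) (mxi w).

Definition fejer n (B : bop V) : bop V :=
  \sum_(w <- words d n) fejer_coef n B w *: lcomp w.

Lemma inner_fejer n B x y : inner (fejer n B x) y =
  \sum_(w <- words d n) fejer_coef n B w * inner (lcomp w x) y.
Proof.
by rewrite bop_sumE inner_suml; apply: eq_bigr => w _; rewrite -innerZl.
Qed.

(** The term of the Fourier series for [w] raises degrees by [|w|], and [n - |w|]
    windows contain both the old and the new degree: these are the Fejer
    weights. The bound on the degrees makes the sum over the windows finite. *)
Lemma fejer_average n M B x y : (0 < n)%N -> (n <= M)%N -> rcommutant B ->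
  degree_lt M x -> degree_lt M y ->
  \sum_(m < M + n) inner (B (mcut (window n m) x)) (mcut (window n m) y) =
  n%:R * inner (fejer n B x) y.
Proof.
move=> n0 nM cB xM yM.
under eq_bigr do
  rewrite (fourier_series cB (degree_lt_mcut _ xM) (degree_lt_mcut _ yM)).
rewrite exchange_big/= inner_fejer mulr_sumr.
rewrite (sum_words_widen nM) => [|w nw]; last first.
  rewrite -mulr_sumr sum_window_lcomp//.
  by rewrite (eqP (nw : n - size w == 0)%N) mul0r mulr0.
rewrite big_seq [RHS]big_seq; apply: eq_bigr => w; rewrite mem_words => wn.
rewrite -mulr_sumr sum_window_lcomp// natrB 1?ltnW// /fejer_coef.
by field; rewrite pnatr_eq0 -lt0n.
Qed.

Lemma mcut_cvg x : (fun n => mcut (fun k => k < n)%N x) @ \oo --> x.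
Proof.
apply/cvgrPdist_lt => e e0.
have [N _ NP] := (cvgrPdist_lt _ _).1 (@cut_cvg _ _ (j x)) _ e0.
by exists N => // n /NP /=; rewrite -[X in _ -> X < _]norm_emb embB emb_mcutE.
Qed.

Lemma norm_mcut D x : `|mcut D x| <= `|x|.
Proof.
rewrite -(@ler_pXn2r _ 2) ?nnegrE// -!norm_emb !normE_inner emb_mcutE.
apply: l2_dot_le => n; apply: le_trans (word_sum_le_dot (j x) n).
by apply: le_word_sum => w; rewrite cutE; case: ifP => // _; rewrite normr0 expr0n exprn_ge0.
Qed.

(** Averaging over windows: [n Phi_n(B)] is the sum of the [Q_m B Q_m] and the
    [Q_m] are projections with sum [n], so Cauchy-Schwarz over the windows and
    the rows of the matrix gives the bound on vectors of finite degree. *)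
Lemma fejer_completely_contractive n : (0 < n)%N ->
  completely_contractive_on rcommutant (fejer n).
Proof.
move=> n0 k A c c0 cA Ac.
have n1 : 0 < n%:R :> R[i] by rewrite ltr0n.
pose F (x y : 'I_k -> V) := \sum_i inner (\sum_l fejer n (A i l) (x l)) (y i).
have Ffin M (x y : 'I_k -> V) : (n <= M)%N ->
    (forall i, degree_lt M (x i)) -> (forall i, degree_lt M (y i)) ->
    `|F x y| ^+ 2 <= (c ^+ 2 * \sum_i `|x i| ^+ 2) * \sum_i `|y i| ^+ 2.
  move=> nM xM yM.
  pose Q m := mcut (window n m).
  pose u (p : 'I_(M + n) * 'I_k) := \sum_l A p.2 l (Q p.1 (x l)).
  pose v (p : 'I_(M + n) * 'I_k) := Q p.1 (y p.2).
  have E : n%:R * F x y = \sum_p inner (u p) (v p).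
    rewrite -(pair_bigA _ (fun m i => inner (u (m, i)) (v (m, i))))/= exchange_big/=.
    rewrite mulr_sumr; apply: eq_bigr => i _.
    under [RHS]eq_bigr do rewrite inner_suml.
    rewrite exchange_big/= inner_suml mulr_sumr; apply: eq_bigr => l _.
    by rewrite -(@fejer_average n M).
  have vE : \sum_p `|v p| ^+ 2 = n%:R * \sum_i `|y i| ^+ 2.
    rewrite -(pair_bigA _ (fun m i => `|v (m, i)| ^+ 2))/= exchange_big/= mulr_sumr.
    by apply: eq_bigr => i _; rewrite -(sum_window_norm n (yM i)).
  have uE : \sum_p `|u p| ^+ 2 <= n%:R * (c ^+ 2 * \sum_i `|x i| ^+ 2).
    rewrite -(pair_bigA _ (fun m i => `|u (m, i)| ^+ 2))/=.
    apply: (@le_trans _ _ (\sum_(m < M + n) c ^+ 2 * \sum_l `|Q m (x l)| ^+ 2)).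
      by apply: ler_sum => m _; exact: (Ac (fun l => Q m (x l))).
    rewrite -mulr_sumr exchange_big/= mulrCA ler_wpM2l ?exprn_ge0//.
    by rewrite mulr_sumr; apply: ler_sum => l _; rewrite (sum_window_norm n (xM l)).
  have := sum_CauchySchwarz (index_enum _) u v; rewrite -E vE normrM exprMn normr_nat.
  set P := \sum_i _; set S := \sum_i `|y i| ^+ 2 => h.
  have S0 : 0 <= n%:R * S.
    by rewrite mulr_ge0// sumr_ge0// => i _; rewrite exprn_ge0.
  have := le_trans h (ler_wpM2r S0 uE).
  have -> : n%:R * (c ^+ 2 * \sum_i `|x i| ^+ 2) * (n%:R * S) =
      n%:R ^+ 2 * ((c ^+ 2 * \sum_i `|x i| ^+ 2) * S) by ring.
  by rewrite ler_pM2l// exprn_gt0.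
(* Truncating the degrees does not increase norms. *)
have Fall (x y : 'I_k -> V) :
    `|F x y| ^+ 2 <= (c ^+ 2 * \sum_i `|x i| ^+ 2) * \sum_i `|y i| ^+ 2.
  pose Q N := mcut (fun k => k < N)%N.
  have cv : (fun N => F (fun i => Q N (x i)) (fun i => Q N (y i))) @ \oo --> F x y.
    apply: cvg_big => [|i _]; first exact: add_continuous.
    apply: inner_cvg; last exact: mcut_cvg.
    apply: cvg_big => [|l _]; first exact: add_continuous.
    apply: continuous_cvg; first exact: bop_continuous.
    exact: mcut_cvg.
  have cv2 : (fun N => `|F (fun i => Q N (x i)) (fun i => Q N (y i))| ^+ 2) @ \oo -->
      `|F x y| ^+ 2.
    by rewrite expr2; under eq_fun do rewrite expr2; apply: cvgM; apply: cvg_norm.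
  apply: (limn_complex_le cv2 (N := n)) => N nN.
  apply: le_trans (Ffin N _ _ nN _ _) _ => [i|i|].
  - exact: mcut_degree_lt.
  - exact: mcut_degree_lt.
  apply: ler_pM.
  - by rewrite mulr_ge0 ?exprn_ge0// sumr_ge0// => i _; rewrite exprn_ge0.
  - by rewrite sumr_ge0// => i _; rewrite exprn_ge0.
  - rewrite ler_wpM2l ?exprn_ge0//; apply: ler_sum => i _.
    by rewrite ler_pXn2r ?nnegrE// norm_mcut.
  - by apply: ler_sum => i _; rewrite ler_pXn2r ?nnegrE// norm_mcut.
move=> x.
under eq_bigr do under eq_bigr do rewrite mxE.
apply: norm_le_of_form; last exact: Fall.
by rewrite mulr_ge0 ?exprn_ge0// sumr_ge0// => i _; rewrite exprn_ge0.
Qed.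

Lemma fejer_norm_le n B (c : R[i]) : (0 < n)%N -> rcommutant B -> 0 <= c ->
  (forall x, `|B x| <= c * `|x|) -> forall x, `|fejer n B x| <= c * `|x|.
Proof.
move=> n0 cB c0 Bc x.
have : mx_norm_le (map_mx (fejer n) (\matrix_(i < 1, l < 1) B)) c.
  apply: fejer_completely_contractive => // [i l|y]; first by rewrite mxE.
  by rewrite !big_ord1 mxE -exprMn ler_pXn2r ?nnegrE ?mulr_ge0.
move=> /(_ (fun=> x)); rewrite !big_ord1 !mxE -exprMn.
by rewrite ler_pXn2r ?nnegrE ?mulr_ge0.
Qed.

Lemma fejer_weak_cvg B x y : rcommutant B ->
  (fun n => inner (fejer n.+1 B x) y) @ \oo --> inner (B x) y.
Proof.
move=> cB; have [c c0 Bc] := bop_bounded B.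
have cc : 0 <= c%:C%C :> R[i] by rewrite lecR ltW.
apply: (@weak_cvg_dense _ _ _ _ c%:C%C [set x | exists M, degree_lt M x]) => //.
- by move=> n z; exact: fejer_norm_le.
- move=> z e e0; have [N _ NP] := (cvgrPdist_lt _ _).1 (@mcut_cvg z) _ e0.
  exists (mcut (fun k => k < N)%N z); last by apply: NP => /=.
  by exists N; exact: mcut_degree_lt.
(* Between vectors of finite degree only finitely many terms survive, and
   their weights tend to 1. *)
move=> {x y} x y [M xM] [M' yM'].
have {}xM := degree_lt_le (leq_maxl M M') xM.
have {}yM' := degree_lt_le (leq_maxr M M') yM'.
set K := maxn M M' in xM yM'.
have z w : (K <= size w)%N -> inner (lcomp w x) y = 0.
  move=> Kw; rewrite (inner_lcomp _ _ xM) big1// => v _.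
  by rewrite yM' ?rmorph0 ?mulr0// size_cat (leq_trans Kw)// leq_addr.
rewrite (fourier_series cB xM yM').
have cv : (fun n => \sum_(w <- words d K) fejer_coef n.+1 B w * inner (lcomp w x) y) @ \oo
    --> \sum_(w <- words d K) inner (B (mxi [::])) (mxi w) * inner (lcomp w x) y.
  apply: cvg_big => [|w _]; first exact: add_continuous.
  apply: cvgMl; rewrite -[inner (B _) _ in X in _ --> X]mul1r; apply: cvgMl.
  rewrite -[1 in X in _ --> X]subr0 -[0 in X in _ --> X](mulr0 (size w)%:R).
  by apply: cvgB; [exact: cvg_cst|apply: cvgMr; exact: inv_cvg0].
apply: cvg_trans cv; apply: near_eq_cvg; exists K => // n /= Kn.
rewrite inner_fejer; apply/esym/sum_words_widen; first exact: leqW.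
by move=> w /z ->; rewrite mulr0.
Qed.

Lemma fejer_wstar_cvg B : rcommutant B ->
  (fun n => fejer n.+1 B : wstar V) @ \oo --> (B : wstar V).
Proof.
move=> cB; have [c c0 Bc] := bop_bounded B.
have cc : 0 <= c%:C%C :> R[i] by rewrite lecR ltW.
apply: (wstar_cvg_bounded cc) => //.
- by move=> n z; exact: fejer_norm_le.
- by move=> x y; exact: fejer_weak_cvg.
Qed.

End GradedCoinvariant.

(** * Commutant lifting *)

Section FullModel.
Context (R : realType) (d : nat).

Definition full_fock : graded_coinvariant d (l2 R d).
Proof.
refine (@GradedCoinvariant R d (l2 R d) (fun x => x) _ _ _ _ _).
- by move=> a x y.
- by [].
- by move=> u x; exists (adj (Lshift R u) x).
- by move=> i x; exists (rstar R i x).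
- by move=> D x; exists (cut R d D x).
Defined.

End FullModel.

Section Lifting.
Context (R : realType) (d : nat) (V : hilbertType R) (j : graded_coinvariant d V).
Context (B : bop V) (cB : rcommutant j B).
Local Notation word := (seq 'I_d).
Local Notation H := (l2 R d).
Local Notation r := (mrstar j).
Implicit Types (x y z h : V) (u : word -> R[i]) (w : word).

(** The image of the compressed vacuum, which determines [B]. *)
Definition symbol : V := B (mxi j [::]).
Local Notation f := symbol.

Lemma emb_adj_vacuum x : j (adj B x) [::] = inner x f.
Proof. by rewrite -inner_mxi inner_adjl. Qed.

Lemma sum_mrstar x y :
  \sum_i inner (r i x) (r i y) = inner x y - j x [::] * (j y [::])^*.
Proof.
rewrite -(inner_emb j) -sum_rstar; apply: eq_bigr => i _; rewrite -(inner_emb j).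
by congr (inner _ _); apply: l2_eq => w; rewrite emb_mrstar rstarE.
Qed.

Context (c : R) (adjBc : forall x, `|adj B x| <= c%:C%C * `|x|).

(** At least [1 + ||B||^2], so that the form below is bounded from below; the
    lift will have norm at most the square root of the gain. *)
Definition gain : R[i] := (c ^+ 2 + 1)%:C%C.
Local Notation a := gain.

Lemma gain_ge1 : 1 <= a.
Proof. by rewrite /gain -[1](rmorph1 (real_complex R)) lecR lerDr sqr_ge0. Qed.

Lemma gain_gt0 : 0 < a. Proof. exact: lt_le_trans ltr01 gain_ge1. Qed.

Lemma gain_conj : a^* = a. Proof. exact: conj_real. Qed.

(** The energy of a state: the defect form of [B^*], up to the gain. *)
Definition storage x y : R[i] := a * inner x y - inner (adj B x) (adj B y).
Local Notation K := storage.

(** The energy of a state together with that of the input it accounts for. *)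
Definition augmented x y : R[i] := K x y + inner x f * inner f y.
Local Notation G := augmented.

Lemma storagePl b x y z : K (b *: x + y) z = b * K x z + K y z.
Proof. by rewrite /storage linearP !innerPl; ring. Qed.

Lemma storageC x y : K x y = (K y x)^*.
Proof. by rewrite /storage rmorphB rmorphM/= gain_conj -!innerC. Qed.

Lemma storagePr b x y z : K z (b *: x + y) = b^* * K z x + K z y.
Proof. by rewrite storageC storagePl rmorphD rmorphM/= -!storageC. Qed.

Lemma storage_ge x : `|x| ^+ 2 <= K x x.
Proof.
rewrite /storage -!normE_inner lerBrDr /gain rmorphD rmorph1 mulrDl mul1r addrC lerD2r.
rewrite rmorphXn/= -exprMn ler_pXn2r ?nnegrE//.
exact: le_trans (adjBc x).
Qed.

Lemma augmentedPl b x y z : G (b *: x + y) z = b * G x z + G y z.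
Proof. by rewrite /augmented storagePl innerPl; ring. Qed.

Lemma augmentedC x y : G x y = (G y x)^*.
Proof.
by rewrite /augmented rmorphD rmorphM/= -storageC -!innerC mulrC.
Qed.

Lemma augmented_ge x : `|x| ^+ 2 <= G x x.
Proof.
apply: le_trans (storage_ge x) _.
by rewrite /augmented lerDl [inner f x]innerC mul_conjC_ge0.
Qed.

Definition form_bound : R := (c ^+ 2 + 1) + c ^+ 2 + complex.Re `|f| ^+ 2.

Lemma storage_bound x y : `|K x y| <= (c ^+ 2 + 1 + c ^+ 2)%:C%C * (`|x| * `|y|).
Proof.
rewrite rmorphD mulrDl; apply: le_trans (ler_normB _ _) _; apply: lerD.
  by rewrite normrM ger0_norm ?(ltW gain_gt0)// ler_wpM2l ?(ltW gain_gt0)// norm_inner.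
apply: le_trans (norm_inner _ _) _; rewrite rmorphXn/= expr2 mulrACA.
by apply: ler_pM.
Qed.

Lemma augmented_bound x y : `|G x y| <= form_bound%:C%C * (`|x| * `|y|).
Proof.
rewrite /form_bound rmorphD mulrDl; apply: le_trans (ler_normD _ _) _; apply: lerD.
  exact: storage_bound.
rewrite rmorphXn/= -normr_ReE normrM expr2 mulrACA mulrC [`|f| * `|x|]mulrC.
by rewrite [leRHS]mulrC; apply: ler_pM => //; exact: norm_inner.
Qed.

(** The energy balance. The identity [sum_i R_i R_i^* = 1 - (vacuum)] compresses
    to [N]; subtract from its multiple by the gain its conjugate by [B]. *)
Lemma augmentedE x y :
  G x y = \sum_i K (r i x) (r i y) + a * (j x [::] * (j y [::])^*).
Proof.
rewrite /storage sumrB -mulr_sumr sum_mrstar.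
under [X in _ - X]eq_bigr do rewrite !adj_mrstar//.
rewrite sum_mrstar !emb_adj_vacuum -innerC /augmented /storage.
by ring.
Qed.

Lemma augmented_inj x y : (forall z, G x z = G y z) -> x = y.
Proof.
move=> xy; apply/eqP; rewrite -subr_eq0 -normr_eq0 -sqrf_eq0 eq_le exprn_ge0// andbT.
apply: le_trans (augmented_ge _) _.
by rewrite -[- y]scaleN1r addrC augmentedPl -xy mulN1r addNr.
Qed.

Lemma solve_subproof h (v : R[i]) : exists x, forall y, G x y = K h y + v * inner f y.
Proof.
pose C := (c ^+ 2 + 1 + c ^+ 2) * complex.Re `|h| + complex.Re `|v| * complex.Re `|f|.
have [||||y||z zP] := @symmetric_lax_milgram R V G (fun y => (K h y + v * inner f y)^*)
  form_bound C.
- exact: augmentedPl.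
- exact: augmentedC.
- exact: augmented_ge.
- exact: augmented_bound.
- move=> x z; rewrite storagePr innerDr innerZr !rmorphD !rmorphM/= !rmorphD !rmorphM/= !conjCK.
  by ring.
- move=> y; rewrite norm_conjC /C rmorphD mulrDl; apply: le_trans (ler_normD _ _) _.
  apply: lerD; first by rewrite rmorphM/= -normr_ReE -mulrA storage_bound.
  rewrite rmorphM/= -!normr_ReE normrM -mulrA.
  by apply: ler_wpM2l => //; exact: norm_inner.
by exists z => y; rewrite augmentedC zP conjCK.
Qed.

(** The next state after the inflow [h] and the input [v]. *)
Definition solve h (v : R[i]) : V := sval (cid (solve_subproof h v)).

Lemma solveP h v y : G (solve h v) y = K h y + v * inner f y.
Proof. exact: (svalP (cid (solve_subproof h v))). Qed.

Lemma solve_linear b h h' v v' :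
  solve (b *: h + h') (b * v + v') = b *: solve h v + solve h' v'.
Proof.
by apply: augmented_inj => y; rewrite solveP augmentedPl !solveP storagePl; ring.
Qed.

Lemma solve0 : solve 0 0 = 0.
Proof.
by have := solve_linear (-1) 0 0 0 0; rewrite !scaleN1r mulN1r !oppr0 !addr0 addNr.
Qed.

(** The new state [x] minimises [K (h - x) (h - x) + |v - <x, f>|^2], and the
    minimum is the energy lost. *)
Lemma solve_energy h v : G (solve h v) (solve h v) <= K h h + `|v| ^+ 2.
Proof.
set x := solve h v.
have E : K h x + v * inner f x = G x x by rewrite -solveP.
have E' : K x h + v^* * inner x f = G x x.
  by rewrite augmentedC -E rmorphD rmorphM/= -storageC -innerC.
have h0 : 0 <= K (h - x) (h - x) + `|v - inner x f| ^+ 2.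
  by rewrite addr_ge0 ?exprn_ge0// (le_trans _ (storage_ge _)) ?exprn_ge0.
rewrite -subr_ge0; apply: le_trans h0 _; rewrite le_eqVlt; apply/orP; left; apply/eqP.
rewrite !normCK rmorphB/= -innerC -[h - x]addrC -scaleN1r storagePl !storagePr.
rewrite rmorphN1; move: E E'; rewrite /augmented => E E'.
have -> : -1 * (-1 * K x x + K x h) + (-1 * K h x + K h h) +
    (v - inner x f) * (v^* - inner f x) =
  K h h + v * v^* + (K x x + inner x f * inner f x) - (K h x + v * inner f x)
    - (K x h + v^* * inner x f) by ring.
by rewrite E E'; ring.
Qed.

(** The state at the word [w]. It depends on the inputs at the suffixes of [w]
    only, because the flow goes from a word to its extensions on the left. *)
Fixpoint state u w : V :=
  if w is i :: v then solve (r i (state u v)) (u w) else solve 0 (u [::]).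

Definition inflow u w : V := if w is i :: v then r i (state u v) else 0.

Lemma stateE u w : state u w = solve (inflow u w) (u w).
Proof. by case: w. Qed.

Lemma state_linear b u u' w :
  state (fun v => b * u v + u' v) w = b *: state u w + state u' w.
Proof.
elim: w => [|i w IHw] /=; first by rewrite -solve_linear scaler0 addr0.
by rewrite IHw linearP solve_linear.
Qed.

Lemma storage0 x : K 0 x = 0.
Proof. by rewrite /storage linear0 !inner0l mulr0 subrr. Qed.

(** What leaves the states at words of length less than [n] flows into their
    one-letter extensions, so the stored energies telescope. *)
Lemma state_energy u n :
  a * \sum_(w <- words d n) `|j (state u w) [::]| ^+ 2 <=
  \sum_(w <- words d n) `|u w| ^+ 2.
Proof.
have inc : \sum_(w <- words d n) K (inflow u w) (inflow u w) <=
    \sum_(w <- words d n) (G (state u w) (state u w) - a * `|j (state u w) [::]| ^+ 2).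
  have <- : \sum_(w <- words d n.+1) K (inflow u w) (inflow u w) =
      \sum_(w <- words d n) (G (state u w) (state u w) - a * `|j (state u w) [::]| ^+ 2).
    rewrite sum_words_cons /= storage0 add0r exchange_big/=; apply: eq_bigr => w _.
    by rewrite augmentedE -normCK addrK.
  apply: sum_words_le => // w; exact: le_trans (exprn_ge0 2 (normr_ge0 _)) (storage_ge _).
have le : \sum_(w <- words d n) G (state u w) (state u w) <=
    \sum_(w <- words d n) (K (inflow u w) (inflow u w) + `|u w| ^+ 2).
  by apply: ler_sum => w _; rewrite stateE; exact: solve_energy.
move: inc le; rewrite [X in _ <= X -> _]sumrB [X in _ -> _ <= X -> _]big_split/=.
rewrite -[X in _ - X]mulr_sumr.
set P := \sum_(w <- _) K _ _; set Q := \sum_(w <- _) G _ _.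
set X := a * _; set U := \sum_(w <- _) `|u _| ^+ 2 => PQ QP.
have := le_trans PQ (lerB QP (lexx X)).
by rewrite -addrA lerDl subr_ge0.
Qed.

Lemma lifting_subproof :
  exists A : bop H, forall (x : H) w, A x w = a * j (state x w) [::].
Proof.
apply: (@coord_bop R d (fun u w => a * j (state u w) [::]) a (ltW gain_gt0)).
  move=> b u u'; apply/funext => w; rewrite state_linear (emb_linear j).
  by rewrite -[(b *: j _ + j _) _]/(b * j _ _ + j _ _); ring.
move=> u n; under eq_bigr do rewrite normrM exprMn.
rewrite -mulr_sumr ger0_norm ?(ltW gain_gt0)// expr2 -mulrA.
rewrite ler_wpM2l ?(ltW gain_gt0)//; apply: le_trans (state_energy u n) _.
by apply: sum_words_le => // w; rewrite exprn_ge0.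
Qed.

(** The transfer function of the system: the output at [w] is the vacuum
    coordinate of the state at [w]. *)
Definition lifting : bop H := sval (cid lifting_subproof).

Lemma liftingE (x : H) w : lifting x w = a * j (state x w) [::].
Proof. exact: (svalP (cid lifting_subproof)). Qed.

Lemma full_mrstar i (x : H) : mrstar (full_fock R d) i x = rstar R i x.
Proof.
apply: l2_eq => w.
by rewrite -[LHS]/(full_fock R d (mrstar (full_fock R d) i x) w) emb_mrstar rstarE.
Qed.

Lemma full_rcomp i (x : H) w :
  rcomp (full_fock R d) i x w =
  (if w is k :: v then if last k v == i then x (belast k v) else 0 else 0).
Proof.
rewrite -[LHS]inner_xi inner_adjl.
have E v : mrstar (full_fock R d) i (xi R w) v = (rcons v i == w)%:R.
  by rewrite -[LHS]/(full_fock R d (mrstar (full_fock R d) i (xi R w)) v) emb_mrstar.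
case: w E => [|k w] E.
  rewrite (_ : mrstar _ _ _ = 0) ?inner0r//; apply: l2_eq => v; rewrite E.
  by case: v {E}.
have {}E v : mrstar (full_fock R d) i (xi R (k :: w)) v =
    ((v == belast k w) && (i == last k w))%:R.
  by rewrite E lastI eqseq_rcons.
have [ki|ki] := eqVneq (last k w) i.
  rewrite (_ : mrstar _ _ _ = xi R (belast k w)) ?inner_xi//.
  by apply: l2_eq => v; rewrite E ki eqxx andbT.
rewrite (_ : mrstar _ _ _ = 0) ?inner0r//; apply: l2_eq => v; rewrite E.
by rewrite [i == _]eq_sym (negbTE ki) andbF.
Qed.

(** Inputs supported on words ending in [i] leave the system at rest until that
    letter has been read. *)
Lemma state_shift i (x : H) w : state (rcomp (full_fock R d) i x) w =
  (if w is k :: v then if last k v == i then state x (belast k v) else 0 else 0).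
Proof.
elim: w => [|k w IHw]; first by rewrite /= full_rcomp solve0.
rewrite /= IHw full_rcomp; case: w {IHw} => [|l w] /=.
  by case: eqP => _; rewrite linear0 // solve0.
by case: eqP => _ //; rewrite linear0 solve0.
Qed.

(** The system does not notice a common suffix of its inputs. *)
Lemma lift_rcommutant : rcommutant (full_fock R d) lifting.
Proof.
move=> i x y; set z := lifting _.
have zE k : rstar R k z = if k == i then lifting x else 0.
  apply: l2_eq => w; rewrite rstarE /z liftingE state_shift.
  have -> : rcons w k = (if w is l :: v then l else k) :: (if w is l :: v then rcons v k else [::]).
    by case: w.
  have -> : last (if w is l :: v then l else k) (if w is l :: v then rcons v k else [::]) = k.
    by case: w => //= l v; rewrite last_rcons.
  have -> : belast (if w is l :: v then l else k) (if w is l :: v then rcons v k else [::]) = w.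
    by case: w => //= l v; rewrite belast_rcons.
  by case: eqP => _; rewrite ?liftingE// emb0 mulr0.
have z0 : z [::] = 0 by rewrite /z liftingE state_shift emb0 mulr0.
have -> : inner z y = \sum_k inner (rstar R k z) (rstar R k y).
  by rewrite sum_rstar z0 mul0r subr0.
rewrite (bigD1 i)//= big1 ?addr0 => [|k /negbTE ki]; last by rewrite zE ki inner0l.
rewrite zE eqxx; congr (inner _ _); apply: l2_eq => w.
by rewrite full_mrstar.
Qed.

(** For the vacuum as input the energy balance telescopes along the suffixes of
    a word, without remainder against a vector of finite degree. *)
Lemma lift_vacuum_finite M y : degree_lt j M y ->
  inner (lifting (xi R [::])) (j y) = inner f y.
Proof.
move=> yM; pose u : word -> R[i] := xi R [::].
have T n : \sum_(w <- words d n.+1) G (state u w) (rword j w y) =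
    inner f y + \sum_(w <- words d n)
      (G (state u w) (rword j w y) - a * j (state u w) [::] * (j y w)^*).
  rewrite sum_words_cons exchange_big/=; congr (_ + _).
    by rewrite solveP storage0 add0r -[u _]/((nil == nil :> word)%:R) eqxx mul1r.
  apply: eq_bigr => w _; rewrite augmentedE.
  rewrite emb_rword cat0s -mulrA addrK.
  apply: eq_bigr => i _; rewrite solveP -[u _]/((i :: w == nil :> word)%:R).
  by rewrite mul0r addr0.
have y0 w : (M <= size w)%N -> rword j w y = 0.
  move=> Mw; apply: (@emb_inj _ _ _ j); rewrite emb0; apply: l2_eq => v.
  by rewrite emb_rword yM// size_cat (leq_trans Mw)// leq_addl.
have := T M; rewrite (sum_words_widen (leqnSn M)) => [|w Mw]; last first.
  by rewrite y0// augmentedC /augmented storage0 inner0l mul0r addr0 rmorph0.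
rewrite sumrB addrCA -[LHS]addr0 => /addrI/esym/eqP; rewrite subr_eq0 => /eqP ->.
rewrite (@inner_finite _ _ _ _ M) => [|w Mw]; last by rewrite yM// rmorph0 mulr0.
by apply: eq_bigr => w _; rewrite liftingE.
Qed.

Lemma lift_vacuum y : inner (lifting (xi R [::])) (j y) = inner f y.
Proof.
pose Q N := mcut j (fun k => k < N)%N.
have h1 : (fun N => inner f (Q N y)) @ \oo --> inner f y.
  by apply: inner_cvg; [exact: cvg_cst|exact: mcut_cvg].
have h2 : (fun N => inner (lifting (xi R [::])) (j (Q N y))) @ \oo -->
    inner (lifting (xi R [::])) (j y).
  apply: inner_cvg; first exact: cvg_cst.
  by under eq_fun do rewrite emb_mcutE; exact: cut_cvg.
apply: (lim_uniq h2); apply: cvg_trans h1; apply: near_eq_cvg; near=> N.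
by rewrite (@lift_vacuum_finite N)//; exact: mcut_degree_lt.
Unshelve. all: by end_near. Qed.

(** Both adjoints commute with the stripping of letters, so it is enough to
    compare vacuum coordinates. *)
Lemma adj_lift y : adj lifting (j y) = j (adj B y).
Proof.
apply: l2_eq => v; elim/last_ind: v y => [|v i IHv] y.
  rewrite emb_adj_vacuum -inner_xi inner_adjl innerC lift_vacuum.
  by rewrite -innerC.
have cA := adj_mrstar lift_rcommutant.
rewrite -rstarE -full_mrstar -cA full_mrstar.
have -> : rstar R i (j y) = j (r i y) by apply: l2_eq => w; rewrite rstarE emb_mrstar.
by rewrite IHv adj_mrstar// emb_mrstar.
Qed.

Lemma lift_compression x y : inner (lifting (j x)) (j y) = inner (B x) y.
Proof. by rewrite -inner_adjr adj_lift inner_emb inner_adjr. Qed.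

End Lifting.

Lemma commutant_lifting (R : realType) (d : nat) (V : hilbertType R)
    (j : graded_coinvariant d V) (B : bop V) : rcommutant j B ->
  exists2 A : bop (l2 R d), rcommutant (full_fock R d) A &
    forall x y, inner (A (j x)) (j y) = inner (B x) y.
Proof.
move=> cB; have [c _ Bc] := bop_bounded (adj B).
exists (lifting cB Bc); first exact: lift_rcommutant.
exact: lift_compression.
Qed.

(** * Homogeneous ideals *)

Section FreeSemigroupAlgebraLemmas.
Context (R : realType) (d : nat).
Local Notation H := (l2 R d).
Local Notation FF := (full_fock R d).
Local Notation Lalg := (@free_semigroup_algebra R d).

Lemma rcommutant_rcomp (A : bop H) : rcommutant FF A ->
  forall i x, A (rcomp FF i x) = rcomp FF i (A x).
Proof. by move=> cA i x; apply: inner_eq => y; rewrite cA inner_adjl. Qed.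

Lemma rcommutant_Lshift u : rcommutant FF (Lshift R u).
Proof.
move=> i x y; rewrite -inner_adjr inner_adjl -inner_adjr; congr (inner _ _).
by apply: l2_eq => w; rewrite !full_mrstar rstarE !lstarE rstarE rcons_cat.
Qed.

Lemma rcommutant_algebra : wot_closed_unital_algebra (rcommutant FF).
Proof.
split; first exact: rcommutant_lin.
- by move=> i x y; rewrite inner_adjl.
- by move=> A B cA cB i x y /=; rewrite rcommutant_rcomp// cA.
- exact: rcommutant_wot_closed.
Qed.

Lemma full_lcomp u : lcomp FF u = Lshift R u.
Proof.
apply: bop_eq => x y; rewrite inner_adjl -inner_adjr; congr (inner _ _).
by apply: l2_eq => w; rewrite -[LHS]/(FF (mlstar FF u y) w) emb_mlstar lstarE.
Qed.

(** The Fejer means of an operator commuting with the right creation operators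
    are polynomials in the left ones. *)
Lemma free_semigroup_algebraE : Lalg = rcommutant FF.
Proof.
apply/seteqP; split.
  apply: smallest_sub; first exact: rcommutant_algebra.
  by move=> _ [u _ <-]; exact: rcommutant_Lshift.
move=> A cA M [[Ml M1 MM Mc] LM].
have MF n : M (fejer FF n.+1 A).
  apply: lin_subspace_sum => // w _; apply: lin_subspaceZ => //.
  by rewrite full_lcomp; apply: LM; exists w.
apply: (@closed_cvg _ (wot H) \oo _ (fun n => fejer FF n.+1 A : wot H) M Mc) => //.
  by apply: nearW.
by apply: wot_cvgP => x y; exact: fejer_weak_cvg.
Qed.

Lemma free_semigroup_algebra_wot : wot_closed_unital_algebra Lalg.
Proof. by rewrite free_semigroup_algebraE; exact: rcommutant_algebra. Qed.

Lemma Lshift_in_algebra u : Lalg (Lshift R u).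
Proof. by rewrite free_semigroup_algebraE; exact: rcommutant_Lshift. Qed.

Lemma ideal_free_semigroup_algebra : is_ideal Lalg.
Proof.
have [Ll L1 LM Lc] := free_semigroup_algebra_wot.
by split=> // A X LA LX; split; exact: LM.
Qed.

Lemma homogeneous_in_algebra : @homogeneous_polynomial R d `<=` Lalg.
Proof.
have [Ll _ _ _] := free_semigroup_algebra_wot.
move=> _ [n [a ->]]; apply: lin_subspace_sum => // w _.
by apply: (lin_subspaceZ _ Ll); exact: Lshift_in_algebra.
Qed.

Lemma ideal_smallest (G : set (bop H)) : G `<=` Lalg -> is_ideal (smallest (@is_ideal R d) G).
Proof.
move=> GL; split.
- by apply: smallest_sub => //; exact: ideal_free_semigroup_algebra.
- split; first by move=> M [[_ [M0 _] _ _] _].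
  move=> a A B JA JB M MP; have [[_ [_ MD] _ _] _] := MP.
  by apply: MD; [exact: JA|exact: JB].
- by apply: (@closed_bigI (wot H)) => M [[]].
- move=> A X LA JX; split => M MP; have [[_ _ _ MI] _] := MP.
    by have [] := MI A X LA (JX M MP).
  by have [] := MI A X LA (JX M MP).
Qed.

End FreeSemigroupAlgebraLemmas.

Section CoinvariantSpace.
Context (R : realType) (d : nat) (J : set (bop (l2 R d))).
Local Notation H := (l2 R d).
Local Notation FF := (full_fock R d).
Local Notation Lalg := (@free_semigroup_algebra R d).
Local Notation N := (orthocomp (vacuum_orbit J)).
Context (JI : is_ideal J).

Lemma coinvariantP x : x \in N <-> forall A, J A -> inner x (A (xi R [::])) = 0.
Proof.
split=> [/asboolP xN A JA|xN]; first by apply: xN; exists A.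
by apply/asboolP => _ [A JA <-]; exact: xN.
Qed.

Lemma ideal_Lalg A : J A -> Lalg A.
Proof. by have [h _ _ _] := JI; exact: h. Qed.

Lemma ideal_mull A X : Lalg A -> J X -> J (bcomp A X).
Proof. by have [_ _ _ h] := JI; move=> LA JX; have [] := h _ _ LA JX. Qed.

Lemma ideal_mulr A X : Lalg A -> J X -> J (bcomp X A).
Proof. by have [_ _ _ h] := JI; move=> LA JX; have [] := h _ _ LA JX. Qed.

Lemma coinvariant_adj A x : Lalg A -> x \in N -> adj A x \in N.
Proof.
move=> LA /coinvariantP xN; apply/coinvariantP => X JX; rewrite inner_adjl.
exact: (xN (bcomp A X) (ideal_mull LA JX)).
Qed.

Lemma rcomp_vacuum i : rcomp FF i (xi R [::]) = Lshift R [:: i] (xi R [::]).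
Proof.
rewrite Lshift_xi; apply: inner_eq => y; rewrite inner_adjl full_mrstar.
by rewrite innerC inner_xi rstarE [RHS]innerC inner_xi.
Qed.

(** On the vacuum, creation on the right is creation on the left, and [J] is
    also a right ideal. *)
Lemma coinvariant_rstar i x : x \in N -> rstar R i x \in N.
Proof.
move=> /coinvariantP xN; apply/coinvariantP => X JX.
have cX : rcommutant FF X by rewrite -free_semigroup_algebraE; exact: ideal_Lalg.
rewrite -full_mrstar innerC -cX rcomp_vacuum -innerC.
exact: (xN (bcomp X (Lshift R [:: i])) (ideal_mulr (@Lshift_in_algebra R d _) JX)).
Qed.

(** As a right ideal, [J] maps everything into the closure of the orbit of the
    vacuum. *)
Lemma coinvariant_orth x X z : x \in N -> J X -> inner (X z) x = 0.
Proof.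
move=> /coinvariantP xN JX; rewrite -inner_adjr.
suff -> : adj X x = 0 by rewrite inner0r.
apply: l2_eq => w; rewrite -inner_xi inner_adjl -{1}[w]cats0 -Lshift_xi.
exact: (xN (bcomp X (Lshift R w)) (ideal_mulr (@Lshift_in_algebra R d _) JX)).
Qed.

End CoinvariantSpace.

Section HomogeneousIdeal.
Context (R : realType) (d : nat) (J : set (bop (l2 R d))).
Local Notation H := (l2 R d).
Local Notation FF := (full_fock R d).
Local Notation Lalg := (@free_semigroup_algebra R d).
Local Notation N := (orthocomp (vacuum_orbit J)).
Context (Jh : homogeneous_ideal J).

Lemma homogeneous_is_ideal : is_ideal J.
Proof.
have [G Gh ->] := Jh; apply: ideal_smallest.
exact: subset_trans Gh (@homogeneous_in_algebra _ _).
Qed.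
Local Notation JI := homogeneous_is_ideal.

Lemma lstar_cut u D (y : H) : adj (Lshift R u) (cut R d D y) =
  cut R d (fun k => D (size u + k)%N) (adj (Lshift R u) y).
Proof. by apply: l2_eq => w; rewrite lstarE !cutE lstarE size_cat. Qed.

(** The orthogonal complement of the graded hull of [N_J]. *)
Definition graded_orth : set H :=
  [set s | forall D y, y \in N -> inner s (cut R d D y) = 0].

(** The adjoint of [L_u] maps the graded hull of [N_J] to itself, by shifting
    degrees. *)
Lemma graded_orth_algebra A s : Lalg A -> graded_orth s -> graded_orth (A s).
Proof.
move=> LA; pose M : set (bop H) := [set X | forall s, graded_orth s -> graded_orth (X s)].
suff : M A by apply.
apply: LA; split; last first.
  move=> _ [u _ <-] t tP D y yN; rewrite -inner_adjr lstar_cut; apply: tP.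
  exact: (coinvariant_adj JI (@Lshift_in_algebra R d u) yN).
split.
- split=> [t tP D y yN|a X Y XM YM t tP D y yN]; first by rewrite inner0l.
  by rewrite -[(a *: X + Y) t]/(a *: X t + Y t) innerPl XM// YM// mulr0 addr0.
- by [].
- by move=> X Y XM YM t tP; apply: XM; exact: YM.
- have -> : M = \bigcap_(p in [set p : H * (nat -> bool) * H | graded_orth p.1.1 /\ p.2 \in N])
     [set X : bop H | inner (X p.1.1) (cut R d p.1.2 p.2) = inner (X 0) 0].
    apply/seteqP; split => [X XM [[t D] y] /= [tP yN]|X XM t tP D y yN].
      by rewrite XM// inner0r.
    by have := XM (t, D, y) (conj tP yN); rewrite /= inner0r.
  by apply: (@closed_bigI (wot H)) => p _; exact: wot_closed_eq.
Qed.

(** The elements of the algebra with range in [graded_orth] form an ideal. It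
    contains the homogeneous generators of [J], since these intertwine
    projections onto sets of degrees, and hence it contains [J]. *)
Lemma homogeneous_graded_orth A x : J A -> graded_orth (A x).
Proof.
have [G Gh JE] := Jh.
pose J' : set (bop H) := [set X | Lalg X /\ forall z, graded_orth (X z)].
suff : J `<=` J' by move=> h /h[_]; apply.
have [[L0 LD] L1 LM Lc] := free_semigroup_algebra_wot R d.
have GJ : G `<=` J by rewrite JE; exact: sub_gen_smallest.
rewrite [X in X `<=` _]JE; apply: smallest_sub.
  split; first by move=> X [].
  - split; first by split=> // z D y _; rewrite inner0l.
    move=> a X Y [LX XP] [LY YP]; split; first exact: LD.
    move=> z D y yN.
    by rewrite -[(a *: X + Y) z]/(a *: X z + Y z) innerPl XP// YP// mulr0 addr0.
  - have -> : J' = Lalg `&`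
        \bigcap_(p in [set p : H * (nat -> bool) * H | p.2 \in N])
        [set X : bop H | inner (X p.1.1) (cut R d p.1.2 p.2) = inner (X 0) 0].
      apply/seteqP; split => [X [LX XP]|X [LX XP]].
        by split=> // [[[t D] y]] /= yN; rewrite XP// inner0r.
      by split=> // t D y yN; have := XP (t, D, y) yN; rewrite /= inner0r.
    apply: (@closedI (wot H)) => //.
    by apply: (@closed_bigI (wot H)) => p _; exact: wot_closed_eq.
  - move=> X Y LX [LY YP]; split; split.
    + exact: LM.
    + by move=> z; apply: (graded_orth_algebra LX); exact: YP.
    + exact: LM.
    + by move=> z /=; exact: YP.
move=> X GX; split; first by apply: homogeneous_in_algebra; exact: Gh.
move=> z D y yN; have [n [a XE]] := Gh _ GX.
suff -> : inner (X z) (cut R d D y) = inner (X (cut R d (fun k => D (n + k)%N) z)) y.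
  exact: (coinvariant_orth JI _ yN (GJ _ GX)).
rewrite XE !bop_sumE !inner_suml; apply: eq_bigr => w _.
rewrite -![(_ *: Lshift R w) _]/(a w *: Lshift R w _) !innerZl; congr (_ * _).
by rewrite -inner_adjr lstar_cut size_tuple -inner_cut inner_adjr.
Qed.

Lemma coinvariant_cut D y : y \in N -> cut R d D y \in N.
Proof.
move=> yN; apply/coinvariantP => A JA; rewrite innerC.
by rewrite homogeneous_graded_orth// rmorph0.
Qed.

Definition coinvariant_model : graded_coinvariant d (coinvariant J).
Proof.
refine (@GradedCoinvariant R d (coinvariant J) (fun x => val x) _ _ _ _ _).
- by move=> a x y.
- by [].
- move=> u x; have h := coinvariant_adj JI (@Lshift_in_algebra R d u) (orthocP x).
  by exists (Orthoc h).
- move=> i x; have h := coinvariant_rstar JI i (orthocP x).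
  by exists (Orthoc h).
- move=> D x; have h := coinvariant_cut D (orthocP x).
  by exists (Orthoc h).
Defined.

(** A compression commutes with the compressed right creations because [N_J] is
    coinvariant for both; the converse is commutant lifting. *)
Lemma compressionE : compression J = rcommutant coinvariant_model.
Proof.
apply/seteqP; split => [B [A LA AB] i x y|B cB].
  have cA : rcommutant FF A by rewrite -free_semigroup_algebraE.
  have AE z t : inner (B z) t = inner (A (val z)) (val t).
    have [_ /(_ _ (orthocP t))] := AB z; rewrite innerBl => /eqP.
    by rewrite subr_eq0 => /eqP ->.
  have h := coinvariant_adj JI LA (orthocP y).
  rewrite !AE -!inner_adjr.
  set t := rcomp coinvariant_model i x.
  have -> : inner (val t) (adj A (val y)) = inner t (Orthoc h) by [].
  rewrite inner_adjl -(inner_emb coinvariant_model).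
  congr (inner _ _); apply: l2_eq => w; rewrite emb_mrstar.
  rewrite -[LHS]rstarE -full_mrstar -adj_mrstar// full_mrstar; congr (adj A _ w).
  by apply: l2_eq => v; rewrite rstarE -[RHS]/(coinvariant_model _ _) emb_mrstar.
have [A cA AB] := commutant_lifting cB.
exists A; first by rewrite free_semigroup_algebraE.
move=> x; split; first exact: orthocP.
by move=> y yN; rewrite innerBl [X in X - _](AB x (Orthoc yN)) subrr.
Qed.

End HomogeneousIdeal.

(** * Approximation properties of the compression algebra *)

Section FejerApproximation.
Context (R : realType) (d : nat) (V : hilbertType R) (j : graded_coinvariant d V).

Lemma lcomp_rcommutant u : rcommutant j (lcomp j u).
Proof.
move=> i x y; rewrite !inner_adjl; congr (inner _ _).
by apply: (@emb_inj _ _ _ j); apply: l2_eq => w; rewrite emb_mrstar !emb_mlstar emb_mrstar rcons_cat.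
Qed.

Lemma fejer_coef_inner n B w :
  fejer_coef j n B w = inner (B (mxi j [::])) ((1 - (size w)%:R / n%:R) *: mxi j w).
Proof.
rewrite innerZr rmorphB rmorph1 fmorph_div !rmorph_nat.
by [].
Qed.

Lemma fejer_linear n a A B : fejer j n (a *: A + B) = a *: fejer j n A + fejer j n B.
Proof.
rewrite /fejer scaler_sumr -big_split/=; apply: eq_bigr => w _.
by rewrite scalerA -scalerDl /fejer_coef bop_lincombE innerPl; congr (_ *: _); ring.
Qed.

Lemma fejer_wstar_continuous n : continuous (fejer j n : wstar V -> wstar V).
Proof.
move=> A; apply: (@wstar_cvgP _ _ (wstar V) (nbhs A) (fejer j n) (fejer j n A)) => phi phin.
rewrite /fejer (normal_functional_sum phin).
under eq_fun do rewrite (normal_functional_sum phin).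
apply: cvg_big => [|w _]; first exact: add_continuous.
apply: cvgMl; rewrite /fejer_coef; apply: cvgMr.
exact: (normal_continuous (vector_functional_normal _ _)).
Qed.

Lemma rcommutant_CCAP : CCAP (rcommutant j).
Proof.
split; first exact: rcommutant_wstar_closed.
exists nat, (fun m n => m <= n)%N, (fun n => fejer j n.+1); split.
- split=> //; first by move=> i k l; exact: leq_trans.
  by move=> i k; exists (maxn i k); rewrite leq_maxl leq_maxr.
- move=> n; split.
  + move=> A _; apply: lin_subspace_sum; first exact: rcommutant_lin.
    by move=> w _; apply: (lin_subspaceZ _ (rcommutant_lin j)); exact: lcomp_rcommutant.
  + by move=> a A B _ _; exact: fejer_linear.
  + exists (size (words d n.+1)), (fun i => lcomp j (nth [::] (words d n.+1) i)) => A _.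
    exists (fun i => fejer_coef j n.+1 A (nth [::] (words d n.+1) i)).
    by rewrite /fejer (big_nth [::]) big_mkord.
  + exact: fejer_completely_contractive.
  + by apply: continuous_subspaceT; exact: fejer_wstar_continuous.
- move=> A cA; apply: cvg_trans (fejer_wstar_cvg cA).
  move=> P [N _ NP]; exists N => // n /= Nn; exact: NP.
Qed.

(** The Fejer coefficients are matrix coefficients with respect to fixed
    vectors, so the Fejer means are of the form required. *)
Lemma rcommutant_S_sigma : property_S_sigma (rcommutant j).
Proof.
split=> [|K HK t T TT]; first exact: rcommutant_wstar_closed.
pose q n w := (1 - (size w)%:R / n.+1%:R) *: mxi j w.
have E n : finite_rank_map (fun n => words d n.+1) (fun _ _ => mxi j [::]) q
    (fun _ => lcomp j) n = fejer j n.+1.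
  apply/funext => A; apply: eq_bigr => w _.
  by rewrite fejer_coef_inner.
apply: (@fubini_normal _ _ _ _ (fun n => words d n.+1) (fun _ _ => mxi j [::]) q
  (fun _ => lcomp j)) => //.
- exact: rcommutant_wstar_closed.
- by move=> _ w; exact: lcomp_rcommutant.
- by move=> n; rewrite E; exact: fejer_completely_contractive.
- by move=> A cA x y; under eq_fun do rewrite E; exact: fejer_weak_cvg.
Qed.

End FejerApproximation.

Theorem theorem2p4 (R : realType) (d : nat) (d_gt0 : (0 < d)%N)
    (J : set (bop (l2 R d))) (J_homogeneous : homogeneous_ideal J) :
  CCAP (compression J) /\ property_S_sigma (compression J).
Proof.
rewrite (compressionE J_homogeneous).
by split; [exact: rcommutant_CCAP|exact: rcommutant_S_sigma].
Qed.
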